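(* Under the unequal-cluster-size setting in the context (null log-linear model true), for any admissible $\phi_1,\phi_2$, \[ \frac{T^{\phi_1}(\boldsymbol{Y},\widehat{\boldsymbol{\theta}}_{\phi_2})}{\widetilde{\vartheta}_{\widehat{n}^*,N,\phi_2}}\xrightarrow[N\to\infty]{\mathcal{L}}\chi^2_{M-M_0-1},\qquad T^{\phi_1}(\boldsymbol{Y},\widehat{\boldsymbol{\theta}}_{\phi_2})=\frac{2\sum_{g=1}^GN_gn_g}{\phi_1''(1)}d_{\phi_1}\big(\widehat{\boldsymbol{p}},\boldsymbol{p}(\widehat{\boldsymbol{\theta}}_{\phi_2})\big). \]
   Context: Let $M\ge 3$ and $1\le M_0<M-1$. Let $\boldsymbol{W}$ be a real $M\times M_0$ matrix of full column rank whose columns, together with $\boldsymbol{1}_M$, are linearly independent; $\boldsymbol{p}(\boldsymbol{\theta})=\exp\{\boldsymbol{W}\boldsymbol{\theta}\}/(\boldsymbol{1}_M^T\exp\{\boldsymbol{W}\boldsymbol{\theta}\})$ for $\boldsymbol{\theta}\in\mathbb{R}^{M_0}$; $\boldsymbol{D}_{\boldsymbol{p}}=\mathrm{diag}(\boldsymbol{p})$, $\boldsymbol{\Sigma}_{\boldsymbol{p}}=\boldsymbol{D}_{\boldsymbol{p}}-\boldsymbol{p}\boldsymbol{p}^T$. Unequal cluster sizes: there are $G$ groups of clusters; group $g$ contains $N_g$ clusters, each of size $n_g\ge2$ (distinct $n_g$); $N=\sum_{g=1}^G N_g$, and $N_g/N\to N_g^*\in(0,1]$ as $N\to\infty$. The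 cluster frequency vectors $\boldsymbol{Y}^{(g,\ell)}$, $\ell=1,\dots,N_g$, $g=1,\dots,G$, are independent, with nonnegative integer entries summing to $n_g$, identically distributed within each group, $\mathrm{E}[\boldsymbol{Y}^{(g,\ell)}]=n_g\boldsymbol{p}(\boldsymbol{\theta}_0)$, $\mathrm{Var}[\boldsymbol{Y}^{(g,\ell)}]=\vartheta_{n_g}n_g\boldsymbol{\Sigma}_{\boldsymbol{p}(\boldsymbol{\theta}_0)}$, $\vartheta_{n_g}=1+(n_g-1)\rho^2$, $\rho^2\ge0$, $\boldsymbol{\theta}_0$ the unknown true parameter. Let $\boldsymbol{Y}=\sum_g\sum_\ell\boldsymbol{Y}^{(g,\ell)}$, $\widehat{\boldsymbol{p}}=\boldsymbol{Y}/\sum_{h}n_hN_h$, $\widehat{\boldsymbol{p}}^{(g,\ell)}=\boldsymbol{Y}^{(g,\ell)}/n_g$, $\widehat{\boldsymbol{p}}^{(g)}=\frac{1}{n_gN_g}\sum_{\ell=1}^{N_g}\boldsymbol{Y}^{(g,\ell)}$, $w_g=n_gN_g/\sum_hn_hN_h$, $\widehat{n}^*=\sum_gw_gn_g$. Admissible $\phi:(0,\infty)\to\mathbb{R}$: convex, twice continuously differentiable, $\phi(1)=\phi'(1)=0$, $\phi''(1)>0$, conventions $0\phi(0/0)=0$, $0\phi(p/0)=p\lim_{u\to\infty}\phi(u)/u$; $d_\phi(\boldsymbol{p},\boldsymbol{q})=\sum_r q_r\phi(p_r/q_r)$; QM$\phi$E $\widehat{\boldsymbol{\theta}}_\phi=\arg\min_{\boldsymbol{\theta}}d_\phi(\widehat{\boldsymbol{p}},\boldsymbol{p}(\boldsymbol{\theta}))$.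 Semi-parametric design effect estimator: $\widetilde{\vartheta}_{\widehat{n}^*,N,\phi}=\sum_{g=1}^Gw_g\widetilde{\vartheta}_{n_g,N_g,\phi}$, where $\widetilde{\vartheta}_{n_g,N_g,\phi}=\frac{n_g}{(N_g-1)(M-1)}\sum_{r=1}^M\frac{1}{p_r(\widehat{\boldsymbol{\theta}}_\phi)}\sum_{\ell=1}^{N_g}(\widehat{p}^{(g,\ell)}_r-\widehat{p}^{(g)}_r)^2$. *)

(* Defs.v *)
From HB Require Import structures.
From mathcomp Require Import all_boot all_order all_algebra.
From mathcomp Require Import all_classical all_reals all_analysis.
Set Implicit Arguments. Unset Strict Implicit. Unset Printing Implicit Defensive.
Import Order.TTheory GRing.Theory Num.Theory.
Import numFieldNormedType.Exports.
Local Open Scope classical_set_scope.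
Local Open Scope ring_scope.

Section Defs.
Variable R : realType.

Definition admissible (phi : R -> R) : Prop :=
  [/\ (forall x y t : R, 0 < x -> 0 < y -> 0 <= t <= 1 ->
         phi (t * x + (1 - t) * y) <= t * phi x + (1 - t) * phi y),
      (forall x : R, 0 < x -> derivable phi x 1),
      (forall x : R, 0 < x -> derivable (derive1 phi) x 1),
      (forall x : R, 0 < x -> {for x, continuous (derive1n 2 phi)}) &
      [/\ phi 1 = 0, derive1 phi 1 = 0 & 0 < derive1n 2 phi 1]].

(* phi extended to [0,oo) with values in \bar R: phi(0) := lim_{u->0+} phi(u),
   which (phi being convex with phi'(1)=0, hence nonincreasing on (0,1])
   equals sup_{0<u<1} phi(u) (possibly +oo). *)
Definition phiE (phi : R -> R) (u : R) : \bar R :=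
  if 0 < u then (phi u)%:E
  else ereal_sup ((fun v => (phi v)%:E) @` `]0, 1[%classic).

(* phi-divergence d_phi(p, q) = sum_r q_r phi(p_r / q_r).  It is only
   applied with q = p(theta), whose entries are all > 0, so the conventions
   for q_r = 0 are never needed. *)
Definition dphi (M : nat) (phi : R -> R) (p q : 'I_M -> R) : \bar R :=
  (\sum_(r < M) (q r)%:E * phiE phi (p r / q r))%E.

Definition pmodel (M M0 : nat) (W : 'M[R]_(M, M0)) (th : 'cV[R]_M0)
  : 'I_M -> R :=
  fun r => expR ((W *m th) r ord0) / \sum_(s < M) expR ((W *m th) s ord0).

Definition chi2_kernel (k : nat) (t : R) : R :=
  powR t (k%:R / 2 - 1) * expR (- t / 2).

Definition chi2_cdf (k : nat) (x : R) : R :=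
  if x < 0 then 0 else
  fine (\int[lebesgue_measure]_(t in (`[(0%R:R), x]%classic : set R))
          (chi2_kernel k t)%:E)%E /
  fine (\int[lebesgue_measure]_(t in (`[(0%R:R), +oo[%classic : set R))
          (chi2_kernel k t)%:E)%E.

Definition cvec (M n : nat) := {ffun 'I_M -> 'I_n.+1}.

Definition dataset (G M : nat) (n : 'I_G -> nat) (Ng : 'I_G -> nat) :=
  {dffun forall g : 'I_G, {ffun 'I_(Ng g) -> cvec M (n g)}}.

Section Data.
Variables (G M : nat) (n Ng : 'I_G -> nat).
Variable d : dataset M n Ng.

Definition ntot : nat := (\sum_(g < G) n g * Ng g)%N.
Definition Ytot (r : 'I_M) : R :=
  \sum_(g < G) \sum_(l < Ng g) ((d g l r : nat)%:R).
Definition phat (r : 'I_M) : R := Ytot r / (ntot%:R).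
Definition phat_gl (g : 'I_G) (l : 'I_(Ng g)) (r : 'I_M) : R :=
  (d g l r : nat)%:R / (n g)%:R.
Definition phat_g (g : 'I_G) (r : 'I_M) : R :=
  (\sum_(l < Ng g) (d g l r : nat)%:R) / ((n g)%:R * (Ng g)%:R).
Definition wgt (g : 'I_G) : R := ((n g)%:R * (Ng g)%:R) / (ntot%:R).

(* semi-parametric design-effect estimators, given the model probabilities
   pth = p(hat theta_phi) *)
Definition deff_g (pth : 'I_M -> R) (g : 'I_G) : R :=
  (n g)%:R / (((Ng g)%:R - 1) * (M%:R - 1)) *
  \sum_(r < M) (pth r)^-1 *
     \sum_(l < Ng g) (phat_gl l r - phat_g g r) ^+ 2.
Definition deff (pth : 'I_M -> R) : R :=
  \sum_(g < G) wgt g * deff_g pth g.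

(* probability of the data set under independent clusters, cluster vectors
   of group g having probability mass function q g *)
Definition data_prob (q : forall g : 'I_G, cvec M (n g) -> R) : R :=
  \prod_(g < G) \prod_(l < Ng g) q g (d g l).
End Data.

Definition Tstat (G M M0 : nat) (n Ng : 'I_G -> nat) (W : 'M[R]_(M, M0))
  (phi1 : R -> R) (d : dataset M n Ng) (th : 'cV[R]_M0) : \bar R :=
  ((2 * (ntot n Ng)%:R / derive1n 2 phi1 1)%:E *
    dphi phi1 (phat d) (pmodel W th))%E.

End Defs.

(* Main.v *)
(* With [z] the deviation of the observed proportions from the true ones, the
   statistic is asymptotically n |P D^(-1/2) z|^2 / vartheta, where P is the
   orthogonal projector on the complement of sqrt p and of the tangent space of the
   model, and has trace M - M0 - 1.  No expansion of the estimator itself is needed: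
   near the true probabilities both divergences are Pearson's weighted square distance
   up to a factor 1 + o(1), so the minimizer is compared with the linear least squares
   parameter from above and with the tangent space from below.

   The covariance of every cluster is a multiple of the same matrix, which after
   projection acts as a multiple of P.  Hence Lindeberg's replacement argument,
   applied to exp (- l |.|^2), only involves the Gaussian smoothings of this function,
   which are explicit; it gives the Laplace transform (1 + 2 l)^(-k/2) of the limit.
   Convergence of Laplace transforms yields convergence of distribution functions
   because the polynomials (1 - v^n)^(2^n) in v = exp (- l q) approximate the
   indicator of q > x when exp (- l x) = 1/2.

   The events whose complements have vanishing probability generate a filter.
   Convergence in probability is convergence along it, so the comparison of the
   divergences and the consistency of the design effect estimator are plain limits,
   and a Slutsky argument concludes. *)
Require Import Defs.
From mathcomp Require Import all_boot all_order all_algebra.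
From mathcomp Require Import all_classical all_reals all_analysis.
From mathcomp Require Import measurable_realfun ring lra.
Set Implicit Arguments.
Unset Strict Implicit.
Unset Printing Implicit Defensive.
Import Order.TTheory GRing.Theory Num.Theory.
Import numFieldNormedType.Exports.
Local Open Scope classical_set_scope.
Local Open Scope ring_scope.

(** * Finite probability *)

Section FiniteProbability.
Variables (R : realType) (T : finType).
Implicit Types (P X Y : T -> R) (A B C : pred T).

Definition is_pmf P : Prop := (forall w, 0 <= P w) /\ \sum_w P w = 1.
Definition expect P X : R := \sum_w P w * X w.
Definition prob P A : R := expect P (fun w => (A w)%:R).

Lemma expect_cst P (c : R) : is_pmf P -> expect P (cst c) = c.
Proof. by case=> _ P1; rewrite /expect -mulr_suml P1 mul1r. Qed.

Lemma expectD P X Y : expect P (fun w => X w + Y w) = expect P X + expect P Y.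
Proof. by rewrite /expect -big_split; apply: eq_bigr => w _; rewrite mulrDr. Qed.

Lemma expectZ P (c : R) X : expect P (fun w => c * X w) = c * expect P X.
Proof. by rewrite /expect mulr_sumr; apply: eq_bigr => w _; rewrite mulrCA. Qed.

Lemma expectB P X Y : expect P (fun w => X w - Y w) = expect P X - expect P Y.
Proof. by rewrite /expect -sumrB; apply: eq_bigr => w _; rewrite mulrBr. Qed.

Lemma expect_sum P (I : Type) (r : seq I) (X : I -> T -> R) :
  expect P (fun w => \sum_(i <- r) X i w) = \sum_(i <- r) expect P (X i).
Proof. by rewrite /expect exchange_big; apply: eq_bigr => w _; rewrite mulr_sumr. Qed.

Lemma le_expect P X Y : is_pmf P -> (forall w, P w != 0 -> X w <= Y w) -> expect P X <= expect P Y.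
Proof.
move=> [P0 _] XY; apply: ler_sum => w _.
by have [->|Pw] := eqVneq (P w) 0; rewrite ?mul0r// ler_wpM2l ?XY.
Qed.

Lemma prob_ge0 P A : is_pmf P -> 0 <= prob P A.
Proof. by move=> Pp; rewrite -(expect_cst 0 Pp) le_expect. Qed.

Lemma markov_le P X (t : R) : is_pmf P -> (forall w, 0 <= X w) -> 0 < t ->
  prob P (fun w => t < X w) <= expect P X / t.
Proof.
move=> P_pmf X0 t0; rewrite mulrC -expectZ; apply: le_expect => // w _.
case: ltP => tX; last by rewrite mulr_ge0 ?invr_ge0// ltW.
by rewrite mulrC ler_pdivlMr// mul1r ltW.
Qed.

Lemma le_prob P A B : is_pmf P -> (forall w, P w != 0 -> A w -> B w) -> prob P A <= prob P B.
Proof.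
move=> P_pmf AB; apply: le_expect => // w Pw.
by rewrite ler_nat; case Aw: (A w) => //; rewrite AB.
Qed.

Lemma prob_le_or P A B C : is_pmf P -> (forall w, P w != 0 -> A w -> B w || C w) ->
  prob P A <= prob P B + prob P C.
Proof.
move=> P_pmf ABC; rewrite -expectD; apply: le_expect => // w Pw.
rewrite -natrD ler_nat; case Aw: (A w) => //.
by case/orP: (ABC w Pw Aw) => ->; rewrite ?addn1.
Qed.

End FiniteProbability.

(** * Continuity theorem for Laplace transforms *)

Section StepPolynomial.
Variable R : realType.

Lemma ler_Bernoulli (y : R) (m : nat) : y <= 1 -> 1 - m%:R * y <= (1 - y) ^+ m.
Proof.
move=> y1; elim: m => [|m IH]; first by rewrite mul0r subr0.
rewrite exprS; apply: le_trans (ler_wpM2l _ IH); last by rewrite subr_ge0.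
rewrite -natr1; have := mulr_ge0 (ler0n R m) (sqr_ge0 y); rewrite expr2; lra.
Qed.

Lemma expr_onem_le_expR (y : R) (m : nat) : y <= 1 -> (1 - y) ^+ m <= expR (- (m%:R * y)).
Proof.
move=> y1; rewrite -mulrN expRM_natl; apply: lerXn2r.
- by rewrite nnegrE subr_ge0.
- by rewrite nnegrE expR_ge0.
- exact: expR_ge1Dx.
Qed.

(* For [v] in [0, 1], [(1 - v ^ n) ^ (2 ^ n)] tends to 1 if [v < 1/2] and to 0 if
   [v > 1/2]; [l] is chosen so that [exp (- l x) = 1/2]. *)
Lemma approx_step_poly (x d e : R) : 0 < x -> 0 < d -> 0 < e ->
  exists2 l : R, 0 < l & exists p : {poly R}, forall t : R, 0 <= t ->
    (t <= x - d)%R%:R - e <= p.[expR (- (l * t))] <= (t <= x + d)%R%:R + e.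
Proof.
move=> x0 d0 e0; have ln2 : 0 < ln (2 : R) by rewrite ln_gt0// ltr1n.
set l := ln 2 / x; have l0 : 0 < l by rewrite divr_gt0.
have ld : 0 < l * d by rewrite mulr_gt0.
have [n tail] : exists n : nat, expR (- (l * d * n%:R)) <= e.
  exists (Num.bound (e^-1 / (l * d))); set n := Num.bound _.
  rewrite expRN -[leRHS]invrK lef_pV2 ?posrE ?expR_gt0 ?invr_gt0//.
  apply: le_trans (_ : _ <= l * d * n%:R) _.
    by rewrite mulrC -ler_pdivrMr//; apply/ltW/archi_boundP; rewrite divr_ge0 ?invr_ge0 ?ltW.
  by apply: le_trans (expR_ge1Dx _); rewrite lerDr.
exists l => //; exists (1 - (1 - 'X^n) ^+ (2 ^ n)) => t t0.
set v := expR _; rewrite [_.[_]](_ : _ = 1 - (1 - v ^+ n) ^+ (2 ^ n)); last by rewrite !hornerE.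
have vn0 : 0 <= v ^+ n by rewrite exprn_ge0 ?expR_ge0.
have vn1 : v ^+ n <= 1.
  by rewrite exprn_ile1 ?expR_ge0// expR_le1 oppr_le0 mulr_ge0// ltW.
have v2E : (2 ^ n)%:R * v ^+ n = expR (l * (x - t) * n%:R).
  rewrite natrX -exprMn expRM_natr -{1}[2]lnK ?posrE// /v -expRD.
  by congr (expR _ ^+ _); rewrite /l; field; rewrite gt_eqF.
have q0 : 0 <= (1 - v ^+ n) ^+ (2 ^ n) by rewrite exprn_ge0 ?subr_ge0.
have q1 : (1 - v ^+ n) ^+ (2 ^ n) <= 1 by rewrite exprn_ile1 ?subr_ge0// gerBl.
have := ler_Bernoulli (2 ^ n) vn1; have := expr_onem_le_expR (2 ^ n) vn1; rewrite {}v2E.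
move: (_ ^+ (2 ^ n)) q0 q1 => q q0 q1 qU qL.
have far y : d <= y -> expR (- (l * y * n%:R)) <= e.
  by move=> dy; apply: le_trans tail; rewrite ler_expR lerN2 ler_wpM2r// ler_pM2l.
apply/andP; split.
- case: (leP t (x - d)) => tx /=; last by lra.
  have xt : d <= x - t by lra.
  have := far _ xt; set a := l * _ * _ in qU *.
  suff : expR (- expR a) <= expR (- a) by lra.
  by rewrite ler_expR lerN2; have := expR_ge1Dx a; lra.
- case: (leP t (x + d)) => tx /=; first by lra.
  have tx' : d <= t - x by lra.
  by have := far _ tx'; rewrite -[t - x]opprB mulrN mulNr opprK; lra.
Qed.

End StepPolynomial.

Section LaplaceContinuity.
Variable R : realType.
Notation mu := (@lebesgue_measure R).

Definition density_cdf (f : R -> R) (x : R) : R := \int[mu]_(t in `[0%R, x]) f t.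

Definition laplace (f : R -> R) (l : R) : R :=
  \int[mu]_(t in `[0%R, +oo[) (expR (- (l * t)) * f t).

Variable f : R -> R.
Hypothesis f_ge0 : forall t, 0 <= f t.
Hypothesis f_int : mu.-integrable `[0%R, +oo[ (EFin \o f).
Hypothesis f_mass : \int[mu]_(t in `[0%R, +oo[) f t = 1.

Lemma integrable_bounded_mul (h : R -> R) (K : R) : measurable_fun setT h ->
  (forall t, 0 <= t -> `|h t| <= K) ->
  mu.-integrable `[0%R, +oo[ (EFin \o (fun t => h t * f t)).
Proof.
move=> mh hK.
apply: (@eq_integrable _ _ _ mu _ _ ((EFin \o h) \* (EFin \o f))%E) => //.
apply: integrableMr => //; first exact: measurable_funTS.
exists K; split; first exact: num_real.
by move=> y Ky t /=; rewrite in_itv/= andbT => t0; rewrite (le_trans (hK _ t0))// ltW.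
Qed.

Lemma measurable_expR_scale (l : R) : measurable_fun setT (fun t : R => expR (- (l * t))).
Proof.
apply: measurableT_comp; first exact: measurable_expR.
by apply: measurableT_comp => //; exact: mulrl_measurable.
Qed.

Lemma expR_scale_le1 (l t : R) : 0 <= l -> 0 <= t -> expR (- (l * t)) <= 1.
Proof. by move=> l0 t0; rewrite expR_le1 oppr_le0 mulr_ge0. Qed.

Lemma integrable_laplace (l : R) : 0 <= l ->
  mu.-integrable `[0%R, +oo[ (EFin \o (fun t => expR (- (l * t)) * f t)).
Proof.
move=> l0; apply: (integrable_bounded_mul (K := 1)); first exact: measurable_expR_scale.
by move=> t t0; rewrite ger0_norm ?expR_ge0 ?expR_scale_le1.
Qed.

Lemma integrable_laplace_poly (l : R) (p : {poly R}) : 0 <= l ->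
  mu.-integrable `[0%R, +oo[ (EFin \o (fun t => p.[expR (- (l * t))] * f t)).
Proof.
move=> l0; apply: (integrable_bounded_mul (K := \sum_(j < size p) `|p`_j|)).
  apply: (@measurableT_comp _ _ _ _ _ _ (horner p)); last exact: measurable_expR_scale.
  apply: continuous_measurable_fun; exact: continuous_horner.
move=> t t0; rewrite horner_coef; apply: (le_trans (ler_norm_sum _ _ _)).
apply: ler_sum => j _; rewrite normrM ler_piMr// normrX ger0_norm ?expR_ge0//.
by rewrite exprn_ile1 ?expR_ge0 ?expR_scale_le1.
Qed.

Lemma laplace_poly (l : R) (p : {poly R}) : 0 <= l ->
  \int[mu]_(t in `[0%R, +oo[) (p.[expR (- (l * t))] * f t) =
  \sum_(j < size p) p`_j * laplace f (l * j%:R).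
Proof.
move=> l0; have int_term (c : R) (j : nat) :
    mu.-integrable `[0%R, +oo[ (EFin \o (fun t => c * (expR (- (l * j%:R * t)) * f t))).
  apply: (@eq_integrable _ _ _ mu _ _
    (fun t => c%:E * (expR (- (l * j%:R * t)) * f t)%:E)%E) => //.
  by apply: integrableZl => //; apply: integrable_laplace; rewrite mulr_ge0.
have polyE t : (p.[expR (- (l * t))] * f t)%:E =
    (\sum_(j < size p) (p`_j * (expR (- (l * j%:R * t)) * f t))%:E)%E.
  rewrite sumEFin horner_coef mulr_suml; congr _%:E; apply: eq_bigr => j _.
  by rewrite -mulrA -expRM_natr; congr (_ * (expR _ * _)); ring.
rewrite /Rintegral; under eq_integral do rewrite polyE.
rewrite integral_sum//=; last by move=> j; exact: int_term.
rewrite -sum_fine; last by move=> j _; apply: integrable_fin_num => //; exact: int_term.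
apply: eq_bigr => j _; rewrite /laplace -RintegralZl//.
by apply: integrable_laplace; rewrite mulr_ge0.
Qed.

Lemma density_cdfE (x : R) :
  density_cdf f x = \int[mu]_(t in `[0%R, +oo[) ((t <= x)%R%:R * f t).
Proof.
rewrite /density_cdf
  (_ : `[0%R, x]%classic = `[0%R, +oo[%classic `&` `]-oo, x]%classic :> set R); last first.
  by apply/seteqP; split => t /=; rewrite !in_itv/= andbT => /andP.
rewrite Rintegral_mkcondr; apply: eq_Rintegral => t _.
rewrite patchE; case: ifPn; rewrite ?inE ?notin_setE/= in_itv/= => tx.
  by rewrite tx mul1r.
by move/negP/negbTE: tx => ->; rewrite mul0r.
Qed.

Lemma integrable_indic_le (x : R) :
  mu.-integrable `[0%R, +oo[ (EFin \o (fun t => (t <= x)%R%:R * f t)).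
Proof.
apply: (integrable_bounded_mul (K := 1)).
  rewrite (_ : (fun t => _) = \1_(`]-oo, x]%classic : set R)); first exact: measurable_indic.
  by apply/funext => t; rewrite indicE mem_setE in_itv.
by move=> t _; rewrite normr_nat lern1 leq_b1.
Qed.

Lemma density_cdf_ge0 (x : R) : 0 <= density_cdf f x.
Proof. by apply: Rintegral_ge0. Qed.

Lemma density_cdf_le0 (x : R) : x <= 0 -> density_cdf f x = 0.
Proof.
rewrite /density_cdf le_eqVlt => /predU1P[->|x0]; first by rewrite set_itv1 Rintegral_set1.
by rewrite set_itv_ge ?Rintegral_set0// bnd_simp -ltNge.
Qed.

Lemma continuous_density_cdf : continuous (density_cdf f).
Proof.
move=> x; pose A := `|x| + 1; have xA : - A < x < A by rewrite -ltr_norml ltrDl.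
have A0 : - A < A by case/andP: xA; exact: lt_trans.
have fA_int : mu.-integrable `[- A, A] (EFin \o (f \_ `[0%R, +oo[)).
  rewrite -restrict_EFin; apply/integrable_restrict => //.
  by apply: integrableS f_int => //; exact: measurableI.
have := parameterized_integral_continuous (ltW A0) fA_int.
move=> /(continuous_within_itvP _ A0)[/(_ x) + _ _]; rewrite in_itv/= => /(_ xA).
suff cdfE y : parameterized_integral mu (- A) y (f \_ `[0%R, +oo[) = density_cdf f y.
  by rewrite (_ : (fun y => _) = density_cdf f)//; apply/funext.
rewrite /parameterized_integral -Rintegral_mkcondr; congr (Rintegral _ _ _).
apply/seteqP; split => t /=; rewrite !in_itv/= andbT; first by case=> /andP[_ ->] ->.
move=> /andP[t0 ->]; rewrite t0; split=> //; rewrite andbT (le_trans _ t0)// oppr_le0.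
by rewrite addr_ge0.
Qed.

Lemma density_cdf_poly_sandwich (x d e l : R) (p : {poly R}) : 0 <= l ->
  (forall t, 0 <= t ->
    (t <= x - d)%R%:R - e <= p.[expR (- (l * t))] <= (t <= x + d)%R%:R + e) ->
  density_cdf f (x - d) - e <= \sum_(j < size p) p`_j * laplace f (l * j%:R) <=
  density_cdf f (x + d) + e.
Proof.
move=> l0 pP; rewrite -laplace_poly//.
have ef_int : mu.-integrable `[0%R, +oo[ (EFin \o (fun t => e * f t)).
  by apply: (integrable_bounded_mul (h := cst e) (K := `|e|)).
have eE : e = \int[mu]_(t in `[0%R, +oo[) (e * f t) by rewrite RintegralZl// f_mass mulr1.
rewrite !density_cdfE; apply/andP; split.
- rewrite [X in _ - X]eE -RintegralB//; try exact: integrable_indic_le.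
  apply: le_Rintegral => //; first exact: (integrableB _ (integrable_indic_le _) ef_int).
    exact: integrable_laplace_poly.
  move=> t /=; rewrite in_itv/= andbT => /pP/andP[low _].
  by rewrite -mulrBl ler_wpM2r.
- rewrite [X in _ + X]eE -RintegralD//; try exact: integrable_indic_le.
  apply: le_Rintegral => //; first exact: integrable_laplace_poly.
    exact: (integrableD _ (integrable_indic_le _) ef_int).
  move=> t /=; rewrite in_itv/= andbT => /pP/andP[_ up].
  by rewrite -mulrDl ler_wpM2r.
Qed.

Section Convergence.
Variables (T : nat -> finType) (P X : forall N, T N -> R).
Hypothesis P_pmf : forall N, is_pmf (@P N).
Hypothesis X_ge0 : forall N w, 0 <= @X N w.
Hypothesis laplace_cvg : forall l : R, 0 < l ->
  expect (@P N) (fun w => expR (- (l * X w))) @[N --> \oo] --> laplace f l.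

Lemma expect_poly_cvg (l : R) (p : {poly R}) : 0 < l ->
  expect (@P N) (fun w => p.[expR (- (l * X w))]) @[N --> \oo] -->
  \sum_(j < size p) p`_j * laplace f (l * j%:R).
Proof.
move=> l0.
rewrite (_ : (fun N => _) = (fun N => \sum_(j < size p)
    p`_j * expect (@P N) (fun w => expR (- (l * j%:R * X w))))); last first.
  apply/funext => N; rewrite -(eq_bigr _ (fun j _ => expectZ _ _ _)) -expect_sum.
  apply: eq_bigr => w _; congr (_ * _); rewrite horner_coef; apply: eq_bigr => j _.
  by rewrite -expRM_natr; congr (_ * expR _); ring.
apply: cvg_big; first exact: add_continuous.
move=> j _; apply: cvgM; first exact: cvg_cst.
case: j => -[|j] _ /=; last by apply: laplace_cvg; rewrite mulr_gt0.
rewrite mulr0 /laplace; under eq_Rintegral do rewrite mul0r oppr0 expR0 mul1r.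
rewrite f_mass (_ : (fun N => _) = cst 1); first exact: cvg_cst.
apply/funext => N; rewrite -(expect_cst 1 (P_pmf N)).
by apply: eq_bigr => w _; rewrite mul0r oppr0 expR0.
Qed.

Lemma near_prob_le (x d e : R) : 0 < d -> 0 < e ->
  \forall N \near \oo,
    prob (@P N) (fun w => X w <= x - d) <= density_cdf f (x + d) + e /\
    density_cdf f (x - d) - e <= prob (@P N) (fun w => X w <= x + d).
Proof.
move=> d0 e0; have [x0|x0] := leP x 0.
  near=> N; split.
    rewrite (_ : prob _ _ = 0) ?addr_ge0 ?density_cdf_ge0 ?(ltW e0)//.
    apply: big1 => w _; rewrite leNgt (lt_le_trans _ (X_ge0 w)) ?mulr0//; lra.
  rewrite density_cdf_le0; last by lra.
  by rewrite sub0r (le_trans _ (prob_ge0 _ (P_pmf N)))// oppr_le0 ltW.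
have e3 : 0 < e / 3 by rewrite divr_gt0.
have [l l0 [p pP]] := approx_step_poly x0 d0 e3.
have /andP[low up] := density_cdf_poly_sandwich (ltW l0) pP.
have /cvgrPdist_le/(_ _ e3) := @expect_poly_cvg l p l0.
apply: filterS => N; rewrite ler_distl => /andP[Nlow Nup].
have pX (w : T N) := andP (pP _ (X_ge0 w)).
have Plow : prob (@P N) (fun w => X w <= x - d) - e / 3 <=
    expect (@P N) (fun w => p.[expR (- (l * X w))]).
  rewrite -[X in _ - X](expect_cst _ (P_pmf N)) -expectB; apply: le_expect => // w _.
  by case: (pX w).
have Pup : expect (@P N) (fun w => p.[expR (- (l * X w))]) <=
    prob (@P N) (fun w => X w <= x + d) + e / 3.
  rewrite -[X in _ + X](expect_cst _ (P_pmf N)) -expectD; apply: le_expect => // w _.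
  by case: (pX w).
by split; lra.
Unshelve. all: by end_near. Qed.

Theorem laplace_cvg_cdf (x : R) :
  prob (@P N) (fun w => X w <= x) @[N --> \oo] --> density_cdf f x.
Proof.
apply/cvgrPdist_le => e e0; have e2 : 0 < e / 2 by rewrite divr_gt0.
have /cvgrPdist_le/(_ _ e2)/nbhs_ballP[r /= r0 cdf_near] := @continuous_density_cdf x.
have r4 : 0 < r / 4 by rewrite divr_gt0.
have /= := near_prob_le (x + r / 4) r4 e2.
have /= := near_prob_le (x - r / 4) r4 e2.
apply: filterS2 => N [_ low] [up _].
have := cdf_near (x + r / 4 + r / 4); have := cdf_near (x - r / 4 - r / 4).
rewrite addrK in up; rewrite subrK in low.
rewrite /ball/= !ler_distl !ltr_distl => /(_ _)/andP[]; first by lra.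
move=> ? ? /(_ _)/andP[]; lra.
Qed.

End Convergence.

End LaplaceContinuity.

(** * The chi-squared law *)

Lemma exprn_le_fact_expR (R : realType) (n : nat) (s : R) : 0 <= s -> s ^+ n <= n`!%:R * expR s.
Proof.
case: n => [|n] s0; first by rewrite expr0 fact0 mul1r -expR0 ler_expR.
have := expR_ge1Dxn n s0; rewrite -ler_pdivrMl ?ltr0n ?fact_gt0// mulrC; lra.
Qed.

Section LebesgueScale.
Variable R : realType.
Notation mu := (@lebesgue_measure R).

Lemma ge0_integral_itv0y_scale (c : {posnum R}) (f : R -> \bar R) :
  measurable_fun setT f -> (forall t, (0 <= f t)%E) ->
  (\int[mu]_(t in `[0%R, +oo[) f t =
   c%:num%:E * \int[mu]_(t in `[0%R, +oo[) f (c%:num * t)%R)%E.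
Proof.
move=> mf f0.
pose mulc : measurableTypeR R -> measurableTypeR R := *%R c%:num.
have mmulc : measurable_fun setT mulc by exact: mulrl_measurable.
rewrite (@eq_measure_integral _ _ _ _ (mscale (c%:num)%:nng (pushforward mu mulc))); last first.
  move=> A mA _; apply: lebesgue_measure_unique => // _ [[a b]] _ <-.
  rewrite -[RHS]/(c%:num%:E * mu (mulc @^-1` `]a, b]))%E.
  rewrite (_ : _ @^-1` _ = `]a / c%:num, b / c%:num]%classic); last first.
    by apply/seteqP; split => t /=; rewrite !in_itv/= ltr_pdivrMr// ler_pdivlMr// [t * _]mulrC.
  rewrite !lebesgue_measure_itv/= !lte_fin ltr_pM2r ?invr_gt0//.
  case: ifP => _; last by rewrite mule0.
  by rewrite -!EFinB -mulrBl -EFinM [_ * (_ / _)]mulrC mulfVK.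
rewrite ge0_integral_mscale//; last exact: measurable_funTS.
rewrite ge0_integral_pushforward//; last exact: measurable_funTS.
congr (_ * integral _ _ _)%E; apply/seteqP.
by split => t /=; rewrite !in_itv/= !andbT pmulr_rge0.
Qed.

End LebesgueScale.

Section Chi2Kernel.
Variable R : realType.
Notation mu := (@lebesgue_measure R).

Lemma chi2_kernel_ge0 (k : nat) (t : R) : 0 <= chi2_kernel k t.
Proof. by rewrite /chi2_kernel mulr_ge0 ?powR_ge0 ?expR_ge0. Qed.

Lemma measurable_chi2_kernel (k : nat) : measurable_fun setT (@chi2_kernel R k).
Proof.
rewrite /chi2_kernel; apply: measurable_funM; first exact: measurable_powR.
apply: measurableT_comp; first exact: measurable_expR.
by apply: measurable_funM => //; exact: measurable_oppr.
Qed.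

Definition exp_sqrt_density (t : R) : R := expR (- Num.sqrt t) / (2 * Num.sqrt t).

Lemma is_derive_exp_sqrt (t : R) : 0 < t ->
  is_derive t 1 (fun t => - expR (- Num.sqrt t)) (exp_sqrt_density t).
Proof.
move=> t0; have sqrt' := is_derive1_sqrt t0.
by apply: is_derive_eq; rewrite /GRing.scale/= /exp_sqrt_density; ring.
Qed.

Lemma continuous_exp_sqrt_density (t : R) : 0 < t -> {for t, continuous exp_sqrt_density}.
Proof.
move=> t0; have csqrt : {for t, continuous Num.sqrt} := @sqrt_continuous R t.
apply: cvgM; first by apply: continuous_comp; [exact: cvgN csqrt|exact: continuous_expR].
by apply: cvgV; [rewrite mulf_neq0 ?gt_eqF ?sqrtr_gt0|apply: cvgM => //; exact: cvg_cst].
Qed.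

Lemma cvg_exp_sqrty : (- expR (- Num.sqrt t) : R) @[t --> +oo] --> (0 : R).
Proof.
rewrite -oppr0; apply: cvgN; apply: (@cvg_comp _ _ _ Num.sqrt (fun s : R => expR (- s)) _ +oo).
  apply/cvgryPge => A; near=> t; apply: (@le_trans _ _ `|A|); first exact: ler_norm.
  by rewrite -sqrtr_sqr ler_wsqrtr//; near: t; exact: nbhs_pinfty_ge.
exact: cvgr_expR.
Unshelve. all: by end_near. Qed.

Lemma integral_exp_sqrt_density_itvcy (a : R) : 0 < a ->
  (\int[mu]_(t in `[a, +oo[) (exp_sqrt_density t)%:E = (expR (- Num.sqrt a))%:E)%E.
Proof.
move=> a0; have pos t : t \in `]a, +oo[ -> 0 < t.
  by rewrite in_itv/= andbT; exact: lt_trans.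
rewrite (@ge0_continuous_FTC2y _ _ (fun t => - expR (- Num.sqrt t)) a 0).
- by rewrite -EFinB sub0r opprK.
- by move=> t _; rewrite divr_ge0 ?expR_ge0// mulr_ge0 ?sqrtr_ge0.
- apply: continuous_in_subspaceT => t; rewrite inE/= in_itv/= andbT => at_.
  exact/continuous_exp_sqrt_density/(lt_le_trans a0).
- exact: cvg_exp_sqrty.
- by move=> t /(lt_trans a0) /is_derive_exp_sqrt[].
- suff cF : {for a, continuous (fun t => - expR (- Num.sqrt t))} by exact: cvg_at_right_filter.
  apply/differentiable_continuous/derivable1_diffP.
  by have [] := is_derive_exp_sqrt a0.
- by move=> t /pos/is_derive_exp_sqrt[_ <-]; rewrite derive1E.
Qed.

Lemma ge0_cvg_integral_itv0y (f : R -> R) : (forall t, 0 <= f t) ->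
  measurable_fun (`]0, +oo[%classic : set R) f ->
  (\int[mu]_(t in `[(j.+1%:R^-1)%R, +oo[) (f t)%:E)%E @[j --> \oo] -->
  (\int[mu]_(t in `[0%R, +oo[) (f t)%:E)%E.
Proof.
move=> f0 mf; rewrite -integral_itv_obnd_cbnd; last exact/measurable_EFinP.
rewrite itvoyEbigcup; under eq_cvg do rewrite -[_^-1]add0r.
apply: ge0_nondecreasing_set_cvg_integral => //.
- move=> i j ij; apply/subsetPset => t /=; rewrite !in_itv/= !andbT; apply: le_trans.
  by rewrite lerD2l lef_pV2 ?posrE ?ltr0Sn// ler_nat.
- move=> j; apply/measurable_EFinP; apply: measurable_funS mf => // t /=.
  by rewrite !in_itv/= !andbT; apply: lt_le_trans; rewrite add0r invr_gt0.
- by move=> j t _; rewrite lee_fin.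
Qed.

Lemma integral_exp_sqrt_density_le1 :
  (\int[mu]_(t in `[0%R, +oo[) (exp_sqrt_density t)%:E <= 1%:E)%E.
Proof.
have exhaust := @ge0_cvg_integral_itv0y exp_sqrt_density.
apply: (cvge_to_le (exhaust _ _)).
- by move=> t; rewrite divr_ge0 ?expR_ge0// mulr_ge0 ?sqrtr_ge0.
- apply: open_continuous_measurable_fun => // t.
  by rewrite inE/= in_itv/= andbT => /continuous_exp_sqrt_density.
near=> j; rewrite integral_exp_sqrt_density_itvcy ?invr_gt0//.
by rewrite lee_fin expR_le1 oppr_le0 sqrtr_ge0.
Unshelve. all: by end_near. Qed.

Lemma chi2_kernel_le_exp_sqrt (k : nat) (t : R) : (0 < k)%N -> 0 < t ->
  chi2_kernel k t <= (2 * (k.-1)`!%:R * expR 2) * exp_sqrt_density t.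
Proof.
move=> k0 t0; rewrite /chi2_kernel /exp_sqrt_density.
set s := Num.sqrt t; have s0 : 0 < s by rewrite sqrtr_gt0.
have tE : t = s ^+ 2 by rewrite sqr_sqrtr// ltW.
have -> : t `^ (k%:R / 2 - 1) = s ^+ k.-1 / s.
  have sE : s = t `^ 2^-1 by rewrite powR12_sqrt ?ltW.
  rewrite sE -powR_mulrn ?powR_ge0// -powRN -!powRrM -powRD; last by rewrite (gt_eqF t0) implybT.
  congr (_ `^ _); rewrite -[in LHS](prednK k0) -natr1; by field.
have powb := exprn_le_fact_expR k.-1 (ltW s0).
have expb : expR s * expR (- t / 2) <= expR 2 * expR (- s).
  by rewrite -!expRD ler_expR tE; have := sqr_ge0 (s - 2); rewrite !expr2; lra.
rewrite [leRHS](_ : _ = s^-1 * ((k.-1)`!%:R * (expR 2 * expR (- s)))); last first.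
  by field; rewrite gt_eqF.
rewrite [leLHS](_ : _ = s^-1 * (s ^+ k.-1 * expR (- t / 2))); last by ring.
rewrite ler_pM2l ?invr_gt0//; apply: le_trans (ler_wpM2l _ expb) => //.
by rewrite mulrA ler_wpM2r ?expR_ge0.
Qed.

Lemma integrable_chi2_kernel (k : nat) : (0 < k)%N ->
  mu.-integrable `[0%R, +oo[ (EFin \o @chi2_kernel R k).
Proof.
move=> k0; set C : R := 2 * (k.-1)`!%:R * expR 2.
have mk D : measurable_fun D (EFin \o @chi2_kernel R k).
  by apply/measurable_EFinP/measurable_funTS; exact: measurable_chi2_kernel.
apply/integrableP; split; first exact: mk.
under eq_integral do rewrite /= ger0_norm ?chi2_kernel_ge0//.
rewrite -integral_itv_obnd_cbnd//.
have mg : measurable_fun (`]0%R, +oo[%classic : set R) (EFin \o exp_sqrt_density).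
  apply/measurable_EFinP; apply: open_continuous_measurable_fun => // t.
  by rewrite inE/= in_itv/= andbT => /continuous_exp_sqrt_density.
have C0 : 0 <= C by rewrite !mulr_ge0 ?expR_ge0.
have g0 (t : R) : (0 <= (exp_sqrt_density t)%:E)%E.
  by rewrite lee_fin divr_ge0 ?expR_ge0// mulr_ge0 ?sqrtr_ge0.
apply: (@le_lt_trans _ _ (\int[mu]_(t in `]0%R, +oo[) (C%:E * (exp_sqrt_density t)%:E))%E).
  apply: ge0_le_integral => //.
  - by move=> t _; rewrite lee_fin chi2_kernel_ge0.
  - exact: mk.
  - exact: measurable_funeM.
  - by move=> t /=; rewrite in_itv/= andbT -EFinM lee_fin; exact: chi2_kernel_le_exp_sqrt.
rewrite ge0_integralZl// integral_itv_obnd_cbnd//.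
apply: le_lt_trans (lee_wpmul2l _ integral_exp_sqrt_density_le1) _; rewrite ?lee_fin//.
by rewrite mule1 ltry.
Qed.

Definition chi2_mass (k : nat) : R := \int[mu]_(t in `[0%R, +oo[) chi2_kernel k t.

End Chi2Kernel.

Section Chi2Law.
Variables (R : realType) (k : nat).
Hypothesis k_gt0 : (0 < k)%N.
Notation mu := (@lebesgue_measure R).

Lemma chi2_mass_gt0 : 0 < chi2_mass R k.
Proof.
pose c : R := 2^-1 * expR (- 1).
have c0 : 0 < c by rewrite mulr_gt0 ?invr_gt0 ?expR_gt0.
have kernel_ge (t : R) : 1 <= t <= 2 -> c <= chi2_kernel k t.
  move=> /andP[t1 t2]; have t0 : 0 < t by lra.
  apply: ler_pM; rewrite ?invr_ge0 ?expR_ge0//; last by rewrite ler_expR; lra.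
  apply: (@le_trans _ _ (t `^ (-1))).
    by rewrite powR_inv1 ?(ltW t0)// lef_pV2 ?posrE.
  by rewrite ler_powR// lerDr divr_ge0.
have sub12 : (`[1%R, 2%R]%classic : set R) `<=` `[0%R, +oo[%classic.
  by move=> t /=; rewrite !in_itv/= andbT => /andP[t1 _]; lra.
apply: (lt_le_trans c0); rewrite -lee_fin fineK; last first.
  exact/integrable_fin_num/integrable_chi2_kernel.
apply: (@le_trans _ _ (\int[mu]_(t in `[1%R, 2%R]) (chi2_kernel k t)%:E)%E); last first.
  apply: ge0_subset_integral => //.
    by apply/measurable_EFinP; apply: measurable_funTS; exact: measurable_chi2_kernel.
  by move=> t _; rewrite lee_fin chi2_kernel_ge0.
rewrite (_ : c%:E = \int[mu]_(t in `[1%R, 2%R]) c%:E)%E; last first.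
  rewrite integral_cst//= lebesgue_measure_itv/= lte_fin ltr1n/= -EFinB -EFinM.
  by congr _%:E; ring.
apply: ge0_le_integral => //.
- by move=> t _; rewrite lee_fin ltW.
- by apply/measurable_EFinP; apply: measurable_funTS; exact: measurable_chi2_kernel.
Qed.

Definition chi2_density (t : R) : R := (chi2_mass R k)^-1 * chi2_kernel k t.

Lemma chi2_density_ge0 (t : R) : 0 <= chi2_density t.
Proof. by rewrite mulr_ge0 ?invr_ge0 ?chi2_kernel_ge0// ltW ?chi2_mass_gt0. Qed.

Lemma integrable_chi2_density : mu.-integrable `[0%R, +oo[ (EFin \o chi2_density).
Proof.
apply: (@eq_integrable _ _ _ mu _ _
  (fun t => ((chi2_mass R k)^-1)%:E * (chi2_kernel k t)%:E)%E) => //.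
by apply: integrableZl => //; exact: integrable_chi2_kernel.
Qed.

Lemma Rintegral_chi2_density : \int[mu]_(t in `[0%R, +oo[) chi2_density t = 1.
Proof.
rewrite RintegralZl//; last exact: integrable_chi2_kernel.
by rewrite mulVf// gt_eqF ?chi2_mass_gt0.
Qed.

Lemma chi2_cdfE (x : R) : chi2_cdf k x = density_cdf chi2_density x.
Proof.
rewrite /chi2_cdf; have [x0|x0] := ltP x 0; first by rewrite density_cdf_le0// ltW.
rewrite /density_cdf RintegralZl//; first by rewrite mulrC.
apply: integrableS (integrable_chi2_kernel R k_gt0) => // t /=.
by rewrite !in_itv/= andbT => /andP[].
Qed.

Lemma continuous_chi2_cdf : continuous (@chi2_cdf R k).
Proof.
rewrite (_ : chi2_cdf k = density_cdf chi2_density); last exact/funext/chi2_cdfE.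
exact/continuous_density_cdf/integrable_chi2_density.
Qed.

Lemma chi2_kernel_scale (l t : R) : 0 <= l -> 0 <= t ->
  expR (- (l * t)) * chi2_kernel k t =
  (1 + 2 * l) `^ (1 - k%:R / 2) * chi2_kernel k ((1 + 2 * l) * t).
Proof.
move=> l0 t0; rewrite /chi2_kernel; set c := 1 + 2 * l.
have c0 : 0 < c by rewrite /c; lra.
have cc : c `^ (1 - k%:R / 2) * c `^ (k%:R / 2 - 1) = 1.
  by rewrite -opprB powRN mulVf// gt_eqF// powR_gt0.
have ee : expR (- (l * t)) * expR (- t / 2) = expR (- (c * t) / 2).
  by rewrite -expRD; congr expR; rewrite /c; field.
by rewrite -[LHS]mul1r -[X in X * _]cc powRM ?(ltW c0)// -ee; ring.
Qed.

Lemma laplace_chi2_density (l : R) : 0 <= l ->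
  laplace chi2_density l = (1 + 2 * l) `^ (- (k%:R / 2)).
Proof.
move=> l0; have c0 : 0 < 1 + 2 * l by lra.
have mk : measurable_fun setT (EFin \o @chi2_kernel R k).
  by apply/measurable_EFinP; exact: measurable_chi2_kernel.
have mkc : measurable_fun setT (fun t => (chi2_kernel k ((1 + 2 * l) * t))%:E).
  apply/measurable_EFinP; apply: measurableT_comp; first exact: measurable_chi2_kernel.
  exact: mulrl_measurable.
have k0 (t : R) : (0 <= (chi2_kernel k t)%:E)%E by rewrite lee_fin chi2_kernel_ge0.
rewrite /laplace /chi2_density; under eq_Rintegral do rewrite mulrCA.
rewrite RintegralZl//; last by apply: integrable_laplace => //; exact: integrable_chi2_kernel.
rewrite (_ : Rintegral _ _ _ = (1 + 2 * l) `^ (- (k%:R / 2)) * chi2_mass R k).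
  by rewrite mulrCA mulVf ?mulr1// gt_eqF ?chi2_mass_gt0.
have mass_fin : (\int[mu]_(t in `[0%R, +oo[) (chi2_kernel k t)%:E \is a fin_num)%E.
  exact/integrable_fin_num/integrable_chi2_kernel.
rewrite /chi2_mass /Rintegral -[RHS]/(fine _%:E * _) -fineM//; congr fine.
rewrite [in RHS](ge0_integral_itv0y_scale (PosNum c0) mk k0)/= muleA -EFinM.
under eq_integral => t t0.
  rewrite chi2_kernel_scale// ?EFinM; last by move: t0; rewrite inE/= in_itv/= andbT.
  over.
rewrite ge0_integralZl//; last 3 first.
- exact: measurable_funTS.
- by move=> t _; exact: k0.
- by rewrite lee_fin powR_ge0.
congr (_%:E * _)%E; rewrite -[X in _ = _ * X]powRr1 ?(ltW c0)// -powRD; last first.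
  by rewrite (gt_eqF c0) implybT.
by congr (_ `^ _); rewrite addrC.
Qed.

End Chi2Law.

(** * Taylor bounds *)

Section Taylor.
Variables (R : realType) (A : set R) (a : R).
Hypotheses (A_itv : is_interval A) (Aa : A a).

Lemma MVT_pow_bound (f df : R -> R) (K : R) (n : nat) : 0 <= K -> f a = 0 ->
  (forall x, A x -> is_derive x 1 f (df x)) ->
  (forall x, A x -> `|df x| <= K * `|x - a| ^+ n) ->
  forall x, A x -> `|f x| <= K * `|x - a| ^+ n.+1.
Proof.
move=> K0 fa fd dfb x Ax.
suff [c Ac [cx ->]] : exists2 c, A c & `|c - a| <= `|x - a| /\ `|f x| = `|df c| * `|x - a|.
  rewrite exprSr mulrA ler_wpM2r//; apply: (le_trans (dfb c Ac)).
  by rewrite ler_wpM2l// lerXn2r ?nnegrE.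
have MVT (u v : R) : u <= v -> (forall y, u <= y <= v -> A y) ->
    exists2 c, u <= c <= v & f v - f u = df c * (v - u).
  move=> uv uvA.
  have [|c cuv E] := @MVT_segment R f df u v uv (fun y yuv => fd y (uvA y (subset_itv_oo_cc yuv))).
    by apply: derivable_within_continuous => y /uvA/fd[].
  by exists c.
have [xa|/ltW ax] := leP x a.
- have [c /andP[xc ca] E] := MVT x a xa (A_itv Ax Aa).
  exists c; first by apply: (A_itv Ax Aa); rewrite xc.
  split; first by rewrite !ler0_norm ?subr_le0// lerN2 lerD2r.
  by move: E; rewrite fa sub0r -normrN => ->; rewrite normrM [`|a - x|]distrC.
- have [c /andP[ac cx] E] := MVT a x ax (A_itv Aa Ax).
  exists c; first by apply: (A_itv Aa Ax); rewrite ac.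
  split; first by rewrite !ger0_norm ?subr_ge0// lerD2r.
  by move: E; rewrite fa subr0 => ->; rewrite normrM.
Qed.

Definition taylor (f : nat -> R -> R) (n : nat) (x : R) : R :=
  \sum_(i < n) f i a * (x - a) ^+ i / i`!%:R.

Lemma taylorS (f : nat -> R -> R) (n : nat) (x : R) :
  taylor f n.+1 x = f 0 a + \sum_(i < n) f i.+1 a * (x - a) ^+ i.+1 / i.+1`!%:R.
Proof. by rewrite /taylor big_ord_recl expr0 mulr1 divr1. Qed.

Lemma is_derive_taylor (f : nat -> R -> R) (n : nat) (x : R) :
  is_derive x 1 (taylor f n.+1) (taylor (fun i => f i.+1) n x).
Proof.
pose term i (y : R) := f i.+1 a * (y - a) ^+ i.+1 / i.+1`!%:R.
have -> : taylor f n.+1 = cst (f 0 a) + \sum_(i < n) term i.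
  by apply/funext => y; rewrite taylorS [RHS]/GRing.add/= fct_sumE.
rewrite -[X in is_derive _ _ _ X]add0r; apply: is_deriveD; apply: is_derive_sum => i.
have -> : term i = (f i.+1 a / i.+1`!%:R) *: (id - cst a : R -> R) ^+ i.+1.
  by apply/funext => y; rewrite exprfctE/= /term mulrAC.
apply: is_derive_eq; rewrite /GRing.scale/= subr0 mulr1 factS natrM.
rewrite -[(id - cst a) x]/(x - a); field.
by rewrite nat1r !pnatr_eq0 -lt0n fact_gt0.
Qed.

Lemma taylor_bound (f : nat -> R -> R) (K : R) (n m : nat) : 0 <= K ->
  (forall i x, (i < n)%N -> A x -> is_derive x 1 (f i) (f i.+1 x)) ->
  (forall x, A x -> `|f n x - f n a| <= K * `|x - a| ^+ m) ->
  forall x, A x -> `|f 0 x - taylor f n.+1 x| <= K * `|x - a| ^+ (n + m).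
Proof.
move=> K0; elim: n f => [|n IH] f fd fn x Ax.
  by rewrite taylorS big_ord0 addr0; exact: fn.
apply: (@MVT_pow_bound (fun y => f 0 y - taylor f n.+2 y)
  (fun y => f 1 y - taylor (fun i => f i.+1) n.+1 y) K (n + m)) => //.
- rewrite taylorS big1 ?addr0 ?subrr// => i _.
  by rewrite exprS mul0r mulr0 mul0r.
- move=> y Ay; have fd0 := fd 0 y isT Ay; have td := is_derive_taylor f n.+1 y.
  exact: is_deriveB.
- by move=> y Ay; apply: (IH (fun i => f i.+1)) => // i z ij; exact: fd.
Qed.

Lemma taylor_bound_derive (f : nat -> R -> R) (K : R) (n : nat) :
  (forall i x, (i <= n)%N -> A x -> is_derive x 1 (f i) (f i.+1 x)) ->
  (forall x, A x -> `|f n.+1 x| <= K) ->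
  forall x, A x -> `|f 0 x - taylor f n.+1 x| <= K * `|x - a| ^+ n.+1.
Proof.
move=> fd fn x Ax; rewrite -[n.+1 in leRHS]addn1.
have K0 : 0 <= K := le_trans (normr_ge0 _) (fn a Aa).
apply: taylor_bound Ax => // [i y /ltnW|y Ay]; first exact: fd.
apply: (@MVT_pow_bound (fun x => f n x - f n a) (f n.+1) K 0) => //; first exact: subrr.
- move=> z Az; have fdn := fd n z (leqnn n) Az.
  by rewrite -[f n.+1 z]subr0; apply: is_deriveB.
- by move=> z Az; rewrite expr0 mulr1; exact: fn.
Qed.

End Taylor.

(** * The heat flow of a Gaussian function *)

Section Heat.
Variable R : realType.

Lemma cubic_mul_expRN_sqr_le (y : R) : 0 <= y -> (8 * y ^+ 3 + 12 * y) * expR (- y ^+ 2) <= 24.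
Proof.
move=> y0; rewrite expRN ler_pdivrMr ?expR_gt0//.
have := exprn_le_fact_expR 1 (sqr_ge0 y); have := exprn_le_fact_expR 2 (sqr_ge0 y).
have := sqr_ge0 (y - 1); have := sqr_ge0 (y ^+ 2 - y); have := expR_ge1Dx (y ^+ 2).
rewrite (_ : 2`!%:R = 2 :> R)// (_ : 1`!%:R = 1 :> R)// expr1 mul1r !sqrrB mulr1 expr1n.
by rewrite -exprM -exprSr; lra.
Qed.

Lemma gaussian_derive3_le (q r m d : R) : 0 <= q -> 0 <= m <= d ^+ 2 -> 0 <= d ->
  r ^+ 2 <= 4 * (q * m) -> `|(6 * m * r - r ^+ 3) * expR (- q)| <= 24 * d ^+ 3.
Proof.
move=> q0 /andP[m0 md] d0 rq.
pose y := Num.sqrt q; have y0 : 0 <= y by exact: sqrtr_ge0.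
have yq : y ^+ 2 = q by rewrite sqr_sqrtr.
have dy0 : 0 <= d * y by exact: mulr_ge0.
have ry : `|r| <= 2 * (d * y).
  rewrite -ler_sqr ?nnegrE ?mulr_ge0// real_normK ?num_real// (le_trans rq)//.
  rewrite (_ : (2 * (d * y)) ^+ 2 = 4 * (q * d ^+ 2)); last by rewrite -yq; ring.
  by rewrite ler_pM2l// ler_wpM2l.
have cubic : `|6 * m * r - r ^+ 3| <= (8 * y ^+ 3 + 12 * y) * d ^+ 3.
  apply: (le_trans (ler_normB _ _)).
  rewrite [leRHS](_ : _ = 6 * d ^+ 2 * (2 * (d * y)) + (2 * (d * y)) ^+ 3); last by ring.
  apply: lerD; last by rewrite normrX lerXn2r ?nnegrE ?mulr_ge0.
  by rewrite normrM ler_pM// ger0_norm ?mulr_ge0// ler_pM2l.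
rewrite normrM (ger0_norm (expR_ge0 _)) -yq.
apply: le_trans (ler_wpM2r (expR_ge0 _) cubic) _; rewrite mulrAC.
by rewrite ler_wpM2r ?exprn_ge0 ?cubic_mul_expRN_sqr_le.
Qed.

(* The second-order expansion of [t |-> exp (- |u + t x|^2)] at [t = 1], where
   [w = |u|^2], [s = <u, x>] and [m = |x|^2]. *)
Lemma gaussian_shift_taylor (w s m d : R) : 0 <= w -> 0 <= m <= d ^+ 2 -> 0 <= d ->
  s ^+ 2 <= w * m ->
  `|expR (- (w + 2 * s + m)) - expR (- w) * (1 - 2 * s - m + 2 * s ^+ 2)| <= 24 * d ^+ 3.
Proof.
move=> w0 md d0 swm; have /andP[m0 _] := md.
pose q t := w + 2 * s * t + m * t ^+ 2; pose r t := 2 * s + 2 * m * t.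
pose g t := expR (- q t).
pose f i := nth (cst 0) [:: g; (fun t => - r t * g t); (fun t => (r t ^+ 2 - 2 * m) * g t);
   (fun t => (6 * m * r t - r t ^+ 3) * g t)] i.
have gd (t : R) : is_derive t 1 g (- r t * g t).
  by apply: is_derive_eq; rewrite /GRing.scale/= /g /r; ring.
have fd i (t : R) : (i <= 2)%N -> `[0, 1]%classic t -> is_derive t 1 (f i) (f i.+1 t).
  move: i => [|[|[|//]]] _ _; first exact: gd.
  - by have gdt := gd t; apply: is_derive_eq; rewrite /GRing.scale/= /f/= /r; ring.
  - by have gdt := gd t; apply: is_derive_eq; rewrite /GRing.scale/= /f/= /r; ring.
have q0 (t : R) : 0 <= q t.
  move: m0; rewrite le_eqVlt => /predU1P[mE|m0].
    move: swm; rewrite /q -mE mulr0 mul0r addr0 => s0.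
    suff -> : s = 0 by lra.
    by apply/eqP; rewrite -sqrf_eq0 eq_le s0 sqr_ge0.
  have := sqr_ge0 (s + m * t); rewrite (_ : _ ^+ 2 = s ^+ 2 - w * m + m * q t); last first.
    by rewrite /q; ring.
  by move=> smt; rewrite -(pmulr_rge0 _ m0); lra.
have f3 (t : R) : `[0, 1]%classic t -> `|f 3%N t| <= 24 * d ^+ 3.
  move=> _; apply: gaussian_derive3_le => //.
  rewrite [r t ^+ 2](_ : _ = 4 * s ^+ 2 + 4 * (q t - w) * m); last by rewrite /r /q; ring.
  by lra.
have itv01 : is_interval (`[(0 : R), 1]%classic) by exact: interval_is_interval.
have in01 (t : R) : t \in `[0, 1] -> `[0, 1]%classic t by [].
have := taylor_bound_derive itv01 (in01 0 _) fd f3 (in01 1 _).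
rewrite !in_itv/= !lexx ler01 => /(_ isT isT).
rewrite /taylor subr0 normr1 expr1n mulr1 !big_ord_recr big_ord0/= !expr1n.
rewrite (_ : 0`!%:R = 1 :> R)// (_ : 2`!%:R = 2 :> R)//.
rewrite (_ : f 0%N 1 - _ = expR (- (w + 2 * s + m)) - expR (- w) * (1 - 2 * s - m + 2 * s ^+ 2))//.
have -> : f 0%N 1 = expR (- (w + 2 * s + m)) by rewrite /f/= /g /q expr1n !mulr1.
have g0 : g 0 = expR (- w) by rewrite /g /q expr0n/= !mulr0 !addr0.
by rewrite /f/= g0 /r; field.
Qed.

(* [heat k l (1 + 2 l s) |u|^2] is the value at [u] of the Gaussian smoothing of
   variance [s] of [exp (- l |.|^2)] in dimension [k]. *)
Definition heat (k : nat) (l a w : R) : R := expR (- (k%:R / 2 * ln a)) * expR (- (l / a * w)).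

Lemma heat1 (k : nat) (l w : R) : heat k l 1 w = expR (- (l * w)).
Proof. by rewrite /heat ln1 mulr0 oppr0 expR0 mul1r divr1. Qed.

Lemma heat0 (k : nat) (l a : R) : 0 < a -> heat k l a 0 = a `^ (- (k%:R / 2)).
Proof. by move=> a0; rewrite /heat mulr0 oppr0 expR0 mulr1 /powR gt_eqF// mulNr. Qed.

Lemma quadratic_mul_expRN_le (k : nat) (y : R) : 0 <= y ->
  ((k%:R / 2 + y) ^+ 2 + k%:R / 2 + 2 * y) * expR (- y) <= k%:R ^+ 2 + 2 * k%:R + 4.
Proof.
move=> y0; rewrite expRN ler_pdivrMr ?expR_gt0//.
have := exprn_le_fact_expR 1 y0; have := exprn_le_fact_expR 2 y0.
rewrite (_ : 1`!%:R = 1 :> R)// (_ : 2`!%:R = 2 :> R)// expr1 mul1r.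
have ey : 1 <= expR y by rewrite -expR0 ler_expR.
have k0 : 0 <= k%:R :> R by [].
move=> y2 y1; have ky := ler_wpM2l k0 y1.
have k20 := sqr_ge0 (k%:R : R); have kk := ler_wpM2l k20 ey; have k1 := ler_wpM2l k0 ey.
rewrite sqrrD [X in X + _ + _](_ : _ = k%:R ^+ 2 / 4 + k%:R * y + y ^+ 2); last by field.
lra.
Qed.

Lemma heat_derive2_le (k : nat) (l a w : R) : 0 < l -> 1 <= a -> 0 <= w ->
  `|((l * w * a^-1 ^+ 2 - k%:R / 2 * a^-1) ^+ 2 +
     (k%:R / 2 * a^-1 ^+ 2 - 2 * l * w * a^-1 ^+ 3)) * heat k l a w|
  <= k%:R ^+ 2 + 2 * k%:R + 4.
Proof.
move=> l0 a1 w0; have a0 : 0 < a by lra.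
set y := l / a * w; have y0 : 0 <= y by rewrite mulr_ge0// divr_ge0 ?ltW.
apply: le_trans (quadratic_mul_expRN_le k y0); rewrite normrM; apply: ler_pM => //; last first.
  rewrite /heat ger0_norm ?mulr_ge0 ?expR_ge0// ler_piMl ?expR_ge0// expR_le1 oppr_le0.
  by rewrite mulr_ge0 ?ln_ge0// divr_ge0.
rewrite [X in `|X|](_ : _ = a^-1 ^+ 2 * ((k%:R / 2 - y) ^+ 2 + k%:R / 2 - 2 * y)); last first.
  by rewrite /y; field; rewrite gt_eqF.
have k0 : 0 <= k%:R / 2 * y by rewrite mulr_ge0// divr_ge0.
have ai1 : a^-1 ^+ 2 <= 1 by rewrite exprn_ile1 ?invr_ge0 ?(ltW a0)// invf_le1.
rewrite normrM ger0_norm ?sqr_ge0//; apply: le_trans (ler_piMl (normr_ge0 _) ai1) _.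
have k2 : 0 <= k%:R / 2 :> R by rewrite divr_ge0.
have := sqr_ge0 (k%:R / 2 - y); rewrite ler_norml sqrrB sqrrD; lra.
Qed.

Lemma heat_time_taylor (k : nat) (l a c w : R) : 0 < l -> 1 <= a -> 0 <= c -> 0 <= w ->
  `|heat k l (a + 2 * l * c) w -
    heat k l a w * (1 - l / a * k%:R * c + 2 * (l / a) ^+ 2 * c * w)|
  <= (k%:R ^+ 2 + 2 * k%:R + 4) * (2 * l * c) ^+ 2.
Proof.
move=> l0 a1 c0 w0; have lc0 : 0 <= 2 * l * c by rewrite !mulr_ge0// ltW.
pose r (t : R) := l * w * t^-1 ^+ 2 - k%:R / 2 * t^-1.
pose dr (t : R) := k%:R / 2 * t^-1 ^+ 2 - 2 * l * w * t^-1 ^+ 3.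
pose f i := nth (cst 0) [:: heat k l ^~ w; (fun t => r t * heat k l t w);
   (fun t => (r t ^+ 2 + dr t) * heat k l t w)] i.
have pos (t : R) : `[1, +oo[%classic t -> 1 <= t by rewrite /= in_itv/= andbT.
have heatd (t : R) : 1 <= t -> is_derive t 1 (heat k l ^~ w) (r t * heat k l t w).
  move=> t1; have t0 : 0 < t by lra.
  have lnd := is_derive1_ln t0; have invd := is_deriveV (lt0r_neq0 t0) (is_derive_id t 1).
  by apply: is_derive_eq; rewrite /GRing.scale/= /heat /r; field; rewrite gt_eqF.
have rd (t : R) : 1 <= t -> is_derive t 1 r (dr t).
  move=> t1; have t0 : 0 < t by lra.
  have invd := is_deriveV (lt0r_neq0 t0) (is_derive_id t 1).
  by apply: is_derive_eq; rewrite /GRing.scale/= /r /dr; field; rewrite gt_eqF.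
have fd i (t : R) : (i <= 1)%N -> `[1, +oo[%classic t -> is_derive t 1 (f i) (f i.+1 t).
  move: i => [|[|//]] _ /pos t1; first exact: heatd.
  have := heatd t t1; have := rd t t1 => rdt heatdt.
  by apply: is_derive_eq; rewrite /GRing.scale/= /f/=; ring.
have f2 (t : R) : `[1, +oo[%classic t -> `|f 2%N t| <= k%:R ^+ 2 + 2 * k%:R + 4.
  by move=> /pos t1; exact: heat_derive2_le.
have itv1y : is_interval (`[(1 : R), +oo[%classic) by exact: interval_is_interval.
have in1y (t : R) : 1 <= t -> `[1, +oo[%classic t by rewrite /= in_itv/= andbT.
have a1' : 1 <= a + 2 * l * c by lra.
have := taylor_bound_derive itv1y (in1y a a1) fd f2 (in1y _ a1').
rewrite (_ : a + 2 * l * c - a = 2 * l * c) ?(ger0_norm lc0); last by ring.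
rewrite /taylor !big_ord_recr big_ord0/= (_ : 0`!%:R = 1 :> R)//.
rewrite (_ : f 0%N (a + 2 * l * c) - _ = heat k l (a + 2 * l * c) w -
    heat k l a w * (1 - l / a * k%:R * c + 2 * (l / a) ^+ 2 * c * w))//.
by rewrite /f/= /r; field; rewrite gt_eqF//; lra.
Qed.

End Heat.

(** * Euclidean vectors *)

Section EuclideanVectors.
Variables (R : realFieldType) (M : nat).
Implicit Types u v x : 'cV[R]_M.

Definition dot u v : R := \tr (u^T *m v).
Definition sqnorm u : R := dot u u.

Lemma dotE u v : dot u v = \sum_r u r ord0 * v r ord0.
Proof. by rewrite /dot trace_mx11 mxE; apply: eq_bigr => r _; rewrite mxE. Qed.

Lemma dotC u v : dot u v = dot v u.
Proof. by rewrite /dot -mxtrace_tr trmx_mul trmxK. Qed.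

Lemma dotDr u v x : dot u (v + x) = dot u v + dot u x.
Proof. by rewrite /dot mulmxDr mxtraceD. Qed.

Lemma dotZr (a : R) u v : dot u (a *: v) = a * dot u v.
Proof. by rewrite /dot -scalemxAr mxtraceZ. Qed.

Lemma dot0r u : dot u 0 = 0.
Proof. by rewrite /dot mulmx0 mxtrace0. Qed.

Lemma dotZl (a : R) u v : dot (a *: u) v = a * dot u v.
Proof. by rewrite dotC dotZr dotC. Qed.

Lemma dotNr u v : dot u (- v) = - dot u v.
Proof. by rewrite -scaleN1r dotZr mulN1r. Qed.

Lemma sqnorm0 : sqnorm 0 = 0.
Proof. exact: dot0r. Qed.

Lemma sqnormD u v : sqnorm (u + v) = sqnorm u + 2 * dot u v + sqnorm v.
Proof. by rewrite /sqnorm dotDr !(dotC (u + v)) !dotDr (dotC v u); ring. Qed.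

Lemma sqnormZ (a : R) u : sqnorm (a *: u) = a ^+ 2 * sqnorm u.
Proof. by rewrite /sqnorm dotZr dotC dotZr mulrA. Qed.

Lemma sqnormN u : sqnorm (- u) = sqnorm u.
Proof. by rewrite -scaleN1r sqnormZ sqrrN expr1n mul1r. Qed.

Lemma sqnorm_ge0 u : 0 <= sqnorm u.
Proof. by rewrite /sqnorm dotE; apply: sumr_ge0 => r _; rewrite -expr2 sqr_ge0. Qed.

Lemma sqnorm_eq0 u : sqnorm u = 0 -> u = 0.
Proof.
rewrite /sqnorm dotE => /psumr_eq0P u0; apply/colP => r; rewrite mxE; apply/eqP.
rewrite -[_ == 0]orbb -mulf_eq0; apply/eqP/u0 => // s _.
by rewrite -expr2 sqr_ge0.
Qed.

Lemma sqnorm_trace u : sqnorm u = \tr (u *m u^T).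
Proof. by rewrite mxtrace_mulC. Qed.

Lemma dot_sqr_trace u x : dot u x ^+ 2 = \tr (u^T *m (x *m x^T) *m u).
Proof.
have xu : x^T *m u = (dot u x)%:M by rewrite dotC /dot trace_mx11 -mx11_scalar.
have ux : u^T *m x = (dot u x)%:M by rewrite /dot trace_mx11 -mx11_scalar.
by rewrite mulmxA ux -mulmxA xu -scalar_mxM mxtrace_scalar mulr1n expr2.
Qed.

Lemma cauchy_schwarz u v : dot u v ^+ 2 <= sqnorm u * sqnorm v.
Proof.
have [v0|v0] := eqVneq (sqnorm v) 0.
  by rewrite (sqnorm_eq0 v0) dot0r expr0n/= sqnorm0 mulr0.
have := sqnorm_ge0 (sqnorm v *: u - dot u v *: v).
rewrite sqnormD sqnormN !sqnormZ dotNr dotZl dotZr.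
rewrite (_ : _ + _ = sqnorm v * (sqnorm u * sqnorm v - dot u v ^+ 2)); last by ring.
by rewrite pmulr_rge0 ?subr_ge0// lt_neqAle eq_sym v0 sqnorm_ge0.
Qed.

Lemma sqnormD_le (e : R) u v : 0 < e ->
  sqnorm (u + v) <= (1 + e) * sqnorm u + (1 + e^-1) * sqnorm v.
Proof.
move=> e0; have young := sqnorm_ge0 (e *: u - v).
rewrite sqnormD sqnormN sqnormZ dotNr dotZl in young.
rewrite -subr_ge0 sqnormD.
rewrite (_ : _ - _ = e^-1 * (e ^+ 2 * sqnorm u + 2 * - (e * dot u v) + sqnorm v)).
  by rewrite mulr_ge0 ?invr_ge0 ?(ltW e0).
by field; rewrite gt_eqF.
Qed.

End EuclideanVectors.

(** * Product laws *)

Lemma sum_dffun_prod (R : comPzSemiRingType) (I : finType) (T : I -> finType)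
    (F : forall i, T i -> R) :
  \sum_(f : {dffun forall i, T i}) \prod_i F i (f i) = \prod_i \sum_t F i t.
Proof.
rewrite (reindex (@dffun_of_fprod I T))/=; last exact/onW_bij/dffun_of_fprod_bij.
pose F_ i := [ffun t => F i t].
transitivity (\sum_(t : fprod T) \prod_(i in I) F_ i (t i)).
  by apply: eq_bigr => f _; apply: eq_bigr => i _; rewrite /F_ !ffunE.
rewrite big_fprod -(bigA_distr_big_dep _ (fun i u => untag 0 (F_ i) u)).
apply: eq_bigr => i _; transitivity (\sum_t F_ i t); last first.
  by apply: eq_bigr => t _; rewrite ffunE.
exact/esym/(big_tag (fun i t => F_ i t)).
Qed.

Section ProductLaw.
Variables (R : realType) (I : finType) (T : I -> finType).
Variable p : forall i, T i -> R.
Hypothesis p_pmf : forall i, is_pmf (@p i).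
Local Notation sample := {dffun forall i, T i}.
Implicit Types w : sample.

Definition prod_pmf w : R := \prod_i p (w i).

Lemma pmf_prod : is_pmf prod_pmf.
Proof.
split; first by move=> w; apply: prodr_ge0 => i _; case: (p_pmf i).
by rewrite sum_dffun_prod big1// => i _; case: (p_pmf i).
Qed.

Lemma prod_pmf_neq0 w i : prod_pmf w != 0 -> p (w i) != 0.
Proof. by move/prodf_neq0; exact. Qed.

Definition update w i (v : T i) : sample := finfun (eqtype.dfwith (fun j => w j) v).

Lemma update_in w i (v : T i) : update w v i = v.
Proof. by rewrite ffunE eqtype.dfwith_in. Qed.

Lemma update_out w i j (v : T i) : j != i -> update w v j = w j.
Proof. by move=> ji; rewrite ffunE eqtype.dfwith_out// eq_sym. Qed.

Lemma updateK w i (v : T i) : update (update w v) (w i) = w.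
Proof.
apply/ffunP => j; have [->|ji] := eqVneq j i; first by rewrite update_in.
by rewrite !update_out.
Qed.

Lemma prod_pmf_update w i (v : T i) : prod_pmf (update w v) * p (w i) = prod_pmf w * p v.
Proof.
rewrite /prod_pmf (bigD1 i)//= update_in [in RHS](bigD1 i)//=.
rewrite (eq_bigr (fun j => p (w j))); first by ring.
by move=> j ji; rewrite update_out.
Qed.

(* Swapping the [i]-th coordinate with an independent copy is a measure-preserving
   involution. *)
Lemma expect_update i (F : sample -> R) :
  expect prod_pmf F = expect prod_pmf (fun w => expect (@p i) (fun v => F (update w v))).
Proof.
rewrite /expect; under [RHS]eq_bigr do rewrite mulr_sumr.
rewrite pair_big/=.
pose swap (z : sample * T i) := (update z.1 z.2, z.1 i).
have swapK : involutive swap by move=> [w v]; rewrite /swap/= updateK update_in.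
rewrite (reindex_inj (inv_inj swapK))/=.
transitivity (\sum_(z : sample * T i) prod_pmf z.1 * (p z.2 * F z.1)).
  rewrite -(pair_big predT predT (fun w v => prod_pmf w * (p v * F w)))/=.
  apply: eq_bigr => w _; rewrite -mulr_sumr -mulr_suml.
  by have [_ ->] := p_pmf i; rewrite mul1r.
by apply: eq_bigr => -[w v] _ /=; rewrite updateK !mulrA prod_pmf_update.
Qed.

Lemma expect_add_coord (V : nmodType) (s : seq I) i (x : forall i, T i -> V) (H : V -> R) :
  i \notin s ->
  expect prod_pmf (fun w => H (\sum_(j <- s) x j (w j) + x i (w i))) =
  expect prod_pmf (fun w => expect (@p i) (fun v => H (\sum_(j <- s) x j (w j) + x i v))).
Proof.
move=> nis; rewrite (expect_update i); apply: eq_bigr => w _; congr (_ * _).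
apply: eq_bigr => v _; rewrite update_in; congr (_ * H (_ + _)).
by apply: eq_big_seq => j js; rewrite update_out//; apply: contraNneq nis => <-.
Qed.

Lemma expect_sqr_sum_centered (f : forall i, T i -> R) :
  (forall i, expect (@p i) (f i) = 0) ->
  expect prod_pmf (fun w => (\sum_i f i (w i)) ^+ 2) =
  \sum_i expect (@p i) (fun v => f i v ^+ 2).
Proof.
move=> f0; elim: (index_enum I) (index_enum_uniq I) => [_|i s IH /= /andP[nis us]].
  rewrite big_nil -[RHS](expect_cst _ pmf_prod).
  by apply: eq_bigr => w _; rewrite big_nil expr0n.
rewrite big_cons -(IH us) -[X in X + _](expect_cst _ pmf_prod) -expectD.
transitivity (expect prod_pmf (fun w => (\sum_(j <- s) f j (w j) + f i (w i)) ^+ 2)).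
  by apply: eq_bigr => w _; rewrite big_cons addrC.
rewrite (@expect_add_coord _ s i f (fun y => y ^+ 2) nis).
apply: eq_bigr => w _; congr (_ * _); set S := \sum_(j <- s) _.
transitivity (expect (@p i) (cst (S ^+ 2)) + 2 * S * expect (@p i) (f i) +
    expect (@p i) (fun v => f i v ^+ 2)).
  by rewrite -expectZ -!expectD; apply: eq_bigr => v _; rewrite /cst; congr (_ * _); ring.
by rewrite expect_cst// f0 mulr0 addr0 addrC.
Qed.

End ProductLaw.

(** * Lindeberg's replacement argument *)

(* Independent centered vectors whose covariances are multiples [c i] of the same
   projector [proj]: replacing one of them by a Gaussian of the same covariance
   amounts to running the heat flow for the time [c i]. *)
Section Lindeberg.
Variables (R : realType) (M k : nat) (I : finType) (T : I -> finType).
Variables (p : forall i, T i -> R) (x : forall i, T i -> 'cV[R]_M).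
Variables (proj : 'M[R]_M) (c : I -> R) (d l : R).
Hypothesis k_gt0 : (0 < k)%N.
Hypothesis l_gt0 : 0 < l.
Hypothesis d_ge0 : 0 <= d.
Hypothesis p_pmf : forall i, is_pmf (@p i).
Hypothesis proj_rank : \tr proj = k%:R.
Hypothesis x_proj : forall i v, proj *m @x i v = x v.
Hypothesis x_mean : forall i, \sum_v p v *: @x i v = 0.
Hypothesis x_cov : forall i, \sum_v p v *: (@x i v *m (x v)^T) = c i *: proj.
Hypothesis x_le : forall i v, sqnorm (@x i v) <= d ^+ 2.

Lemma expect_dot i (u : 'cV[R]_M) : expect (@p i) (fun v => dot u (x v)) = 0.
Proof.
rewrite -(dot0r u) -(x_mean i) /dot mulmx_sumr raddf_sum.
by apply: eq_bigr => v _; rewrite -scalemxAr /= mxtraceZ.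
Qed.

Lemma expect_dot_sqr i (u : 'cV[R]_M) : proj *m u = u ->
  expect (@p i) (fun v => dot u (x v) ^+ 2) = c i * sqnorm u.
Proof.
move=> Pu; transitivity (\tr (u^T *m (c i *: proj) *m u)); last first.
  by rewrite -scalemxAr -scalemxAl mxtraceZ -mulmxA Pu.
rewrite -x_cov mulmx_sumr mulmx_suml raddf_sum; apply: eq_bigr => v _.
by rewrite dot_sqr_trace -scalemxAr -scalemxAl /= mxtraceZ.
Qed.

Lemma expect_sqnorm i : expect (@p i) (fun v => sqnorm (x v)) = c i * k%:R.
Proof.
rewrite -proj_rank -mxtraceZ -x_cov raddf_sum; apply: eq_bigr => v _.
by rewrite /= mxtraceZ sqnorm_trace.
Qed.

Lemma cov_scale_ge0 i : 0 <= c i.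
Proof.
rewrite -(pmulr_lge0 (c i) (_ : 0 < k%:R)) ?ltr0n// -expect_sqnorm.
by rewrite -(expect_cst 0 (p_pmf i)); apply: le_expect => // v _; exact: sqnorm_ge0.
Qed.

Lemma cov_scale_le i : c i <= d ^+ 2.
Proof.
apply: (@le_trans _ _ (c i * k%:R)); first by rewrite ler_peMr ?cov_scale_ge0// ler1n.
by rewrite -expect_sqnorm -(expect_cst (d ^+ 2) (p_pmf i)); exact: le_expect.
Qed.

Definition lindeberg_const : R := 24 * Num.sqrt l ^+ 3 + 4 * l ^+ 2 * (k%:R ^+ 2 + 2 * k%:R + 4).

Lemma heat_space_step i (a : R) (u : 'cV[R]_M) : 1 <= a -> proj *m u = u ->
  `|expect (@p i) (fun v => heat k l a (sqnorm (u + x v))) -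
    heat k l a (sqnorm u) * (1 - l / a * k%:R * c i + 2 * (l / a) ^+ 2 * c i * sqnorm u)|
  <= 24 * (Num.sqrt l * d) ^+ 3.
Proof.
move=> a1 Pu; set b := l / a; have a0 : 0 < a by lra.
have b0 : 0 <= b by rewrite divr_ge0 ?ltW.
have bl : b <= l by rewrite ler_pdivrMr// ler_peMr// ltW.
set A := expR (- (k%:R / 2 * ln a)).
have A1 : A <= 1 by rewrite expR_le1 oppr_le0 mulr_ge0 ?ln_ge0// divr_ge0.
pose q v := 1 - 2 * (b * dot u (x v)) - b * sqnorm (x v) + 2 * (b * dot u (@x i v)) ^+ 2.
have -> : 1 - b * k%:R * c i + 2 * b ^+ 2 * c i * sqnorm u = expect (@p i) q.
  transitivity (expect (@p i) (cst 1) - 2 * b * expect (@p i) (fun v => dot u (x v)) -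
      b * expect (@p i) (fun v => sqnorm (x v)) +
      2 * b ^+ 2 * expect (@p i) (fun v => dot u (x v) ^+ 2)).
    by rewrite expect_cst// expect_dot expect_sqnorm expect_dot_sqr//; ring.
  rewrite -!expectZ -!expectB -expectD.
  by apply: eq_bigr => v _; congr (_ * _); rewrite /q /cst; ring.
rewrite -expectZ -expectB; apply: (le_trans (ler_norm_sum _ _ _)).
rewrite -[leRHS](expect_cst _ (p_pmf i)); apply: ler_sum => v _.
have [p0 _] := p_pmf i; rewrite normrM (ger0_norm (p0 v)) ler_wpM2l//.
rewrite /heat -/b -/A -mulrA -mulrBr normrM (ger0_norm (expR_ge0 _)).
apply: (le_trans (ler_piMl (normr_ge0 _) A1)).
have bx : 0 <= b * sqnorm (x v) <= (Num.sqrt l * d) ^+ 2.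
  rewrite mulr_ge0 ?sqnorm_ge0//= exprMn sqr_sqrtr ?(ltW l_gt0)//.
  by apply: ler_pM => //; exact: sqnorm_ge0.
rewrite sqnormD mulrDr mulrDr [b * (2 * _)]mulrCA.
apply: gaussian_shift_taylor => //.
- by rewrite mulr_ge0 ?sqnorm_ge0.
- by rewrite mulr_ge0 ?sqrtr_ge0.
- rewrite exprMn (_ : b * _ * _ = b ^+ 2 * (sqnorm u * sqnorm (x v))); last by ring.
  by rewrite ler_wpM2l ?sqr_ge0// cauchy_schwarz.
Qed.

Lemma heat_step i (a : R) (u : 'cV[R]_M) : 1 <= a -> proj *m u = u ->
  `|expect (@p i) (fun v => heat k l a (sqnorm (u + x v))) -
    heat k l (a + 2 * l * c i) (sqnorm u)| <= lindeberg_const * (d ^+ 3 + d ^+ 2 * c i).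
Proof.
move=> a1 Pu.
have time := heat_time_taylor k l_gt0 a1 (cov_scale_ge0 i) (sqnorm_ge0 u).
have space := heat_space_step i a1 Pu; rewrite distrC in time.
apply: le_trans (ler_distD _ _ _) (le_trans (lerD space time) _).
have l3 : 0 <= 24 * Num.sqrt l ^+ 3 by rewrite mulr_ge0 ?exprn_ge0 ?sqrtr_ge0.
pose K : R := 4 * l ^+ 2 * (k%:R ^+ 2 + 2 * k%:R + 4).
have K0 : 0 <= K by rewrite !(sqr_ge0, mulr_ge0, addr_ge0).
rewrite exprMn mulrA (_ : _ * (2 * l * c i) ^+ 2 = K * c i ^+ 2); last by rewrite /K; ring.
have cc : c i ^+ 2 <= d ^+ 2 * c i by rewrite expr2 ler_wpM2r ?cov_scale_ge0 ?cov_scale_le.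
have := ler_wpM2l K0 cc; have := mulr_ge0 K0 (exprn_ge0 3 d_ge0).
have := mulr_ge0 l3 (mulr_ge0 (sqr_ge0 d) (cov_scale_ge0 i)).
rewrite /lindeberg_const -/K; lra.
Qed.

Lemma heat_telescope (s : seq I) (r : R) : uniq s -> 0 <= r ->
  `|expect (prod_pmf p) (fun w => heat k l (1 + 2 * l * r) (sqnorm (\sum_(i <- s) x (w i)))) -
    heat k l (1 + 2 * l * (r + \sum_(i <- s) c i)) 0|
  <= lindeberg_const * \sum_(i <- s) (d ^+ 3 + d ^+ 2 * c i).
Proof.
elim: s r => [|i s IH] r /=.
  move=> _ _; rewrite !big_nil addr0 mulr0 -(expect_cst (heat _ _ _ 0) (pmf_prod p_pmf)).
  rewrite -expectB /expect big1 ?normr0// => w _.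
  by rewrite /cst big_nil sqnorm0 subrr mulr0.
move=> /andP[nis us] r0; have rc0 : 0 <= r + c i by rewrite addr_ge0 ?cov_scale_ge0.
have := IH _ us rc0; rewrite !big_cons -addrA [lindeberg_const * (_ + _ + _)]mulrDr.
set after := expect _ _ => rest.
have -> : expect (prod_pmf p) (fun w =>
      heat k l (1 + 2 * l * r) (sqnorm (\sum_(j <- i :: s) x (w j)))) =
    expect (prod_pmf p) (fun w => expect (@p i) (fun v =>
      heat k l (1 + 2 * l * r) (sqnorm (\sum_(j <- s) x (w j) + x v)))).
  rewrite -(expect_add_coord p_pmf x (fun u => heat k l (1 + 2 * l * r) (sqnorm u)) nis).
  by apply: eq_bigr => w _; rewrite big_cons [x _ + _]addrC.
set before := expect _ _.
apply: (le_trans (ler_distD after _ _)); apply: lerD rest.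
rewrite -expectB; apply: (le_trans (ler_norm_sum _ _ _)).
rewrite -[leRHS](expect_cst _ (pmf_prod p_pmf)); apply: ler_sum => w _.
have [P0 _] := pmf_prod p_pmf; rewrite normrM (ger0_norm (P0 w)) ler_wpM2l//.
rewrite [2 * l * (r + _)]mulrDr [1 + (_ + _)]addrA; apply: heat_step.
  by rewrite lerDl !mulr_ge0// ltW.
by rewrite mulmx_sumr; apply: eq_bigr => j _; rewrite x_proj.
Qed.

Theorem laplace_sqnorm_sum : \sum_i c i = 1 ->
  `|expect (prod_pmf p) (fun w => expR (- (l * sqnorm (\sum_i x (w i))))) -
    (1 + 2 * l) `^ (- (k%:R / 2))| <= lindeberg_const * (#|I|%:R * d ^+ 3 + d ^+ 2).
Proof.
move=> c1.
have -> : expect (prod_pmf p) (fun w => expR (- (l * sqnorm (\sum_i x (w i))))) =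
    expect (prod_pmf p) (fun w => heat k l 1 (sqnorm (\sum_i x (w i)))).
  by apply: eq_bigr => w _; rewrite heat1.
have := heat_telescope (index_enum_uniq I) (lexx 0).
rewrite add0r c1 mulr0 addr0 mulr1 heat0; last by rewrite addr_gt0// mulr_gt0.
by rewrite big_split/= -[\sum_i (_ * c i)]mulr_sumr c1 mulr1 sumr_const -[_ *+ #|_|]mulr_natl.
Qed.

End Lindeberg.

(** * Least squares residuals *)

Section ResidualProjector.
Variables (R : realFieldType) (m n : nat) (A : 'M[R]_(m, n)).
Hypothesis A_full : \rank A = n.

Lemma gram_unit : A^T *m A \in unitmx.
Proof.
rewrite -row_free_unit -kermx_eq0; apply/eqP/row_matrixP => i; rewrite row0.
set v := row i _; have vker : v *m (A^T *m A) = 0 by apply/sub_kermxP/row_sub.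
have Av0 : A *m v^T = 0.
  apply: sqnorm_eq0; rewrite /sqnorm /dot trmx_mul trmxK -mulmxA mulmxA.
  by rewrite -mulmxA [A^T *m _]mulmxA mulmxA vker mul0mx mxtrace0.
have /row_fullP[L LA] : row_full A by rewrite /row_full A_full.
by rewrite -[v]trmxK -[v^T]mul1mx -LA -mulmxA Av0 mulmx0 trmx0.
Qed.

Definition lsq : 'M[R]_(n, m) := invmx (A^T *m A) *m A^T.

Definition resproj : 'M[R]_m := 1%:M - A *m lsq.

Lemma resproj_sym : resproj^T = resproj.
Proof.
by rewrite /resproj /lsq linearB/= trmx1 !trmx_mul trmx_inv trmx_mul trmxK mulmxA.
Qed.

Lemma resproj_mulmx : resproj *m A = 0.
Proof. by rewrite mulmxBl mul1mx /lsq -!mulmxA mulVmx ?gram_unit// mulmx1 subrr. Qed.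

Lemma resproj_idem : resproj *m resproj = resproj.
Proof. by rewrite {2}/resproj mulmxBr mulmx1 mulmxA resproj_mulmx mul0mx subr0. Qed.

Lemma resproj_trace : \tr resproj = m%:R - n%:R.
Proof.
rewrite /resproj linearB/= mxtrace1 mxtrace_mulC /lsq -mulmxA mulVmx ?gram_unit//.
by rewrite mxtrace1.
Qed.

Lemma mulmx_resproj (y : 'cV[R]_m) : resproj *m y = y - A *m (lsq *m y).
Proof. by rewrite mulmxBl mul1mx mulmxA. Qed.

Lemma sqnorm_resproj_le (y : 'cV[R]_m) : sqnorm (resproj *m y) <= sqnorm y.
Proof.
have -> : sqnorm y = sqnorm (resproj *m y) + sqnorm (y - resproj *m y).
  rewrite -{1}[y](subrKC (resproj *m y)) [LHS]sqnormD.
  rewrite (_ : dot (resproj *m y) _ = 0) ?mulr0 ?addr0//.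
  by rewrite /dot trmx_mul resproj_sym -mulmxA mulmxBr mulmxA resproj_idem subrr mulmx0 mxtrace0.
by rewrite lerDl sqnorm_ge0.
Qed.

Lemma sqnorm_resproj_le_dist (y : 'cV[R]_m) (b : 'cV[R]_n) :
  sqnorm (resproj *m y) <= sqnorm (y - A *m b).
Proof.
apply: le_trans (sqnorm_resproj_le _).
by rewrite mulmxBr mulmxA resproj_mulmx mul0mx subr0.
Qed.

End ResidualProjector.

Section FrobeniusBound.
Variable R : realFieldType.

Lemma sqr_entry_le_sqnorm (n : nat) (u : 'cV[R]_n) i : u i ord0 ^+ 2 <= sqnorm u.
Proof.
rewrite /sqnorm dotE (bigD1 i)//= expr2 lerDl sumr_ge0// => j _.
by rewrite -expr2 sqr_ge0.
Qed.

Lemma mxtrace_mul_tr_ge0 (m n : nat) (A : 'M[R]_(m, n)) : 0 <= \tr (A *m A^T).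
Proof.
apply: sumr_ge0 => i _; rewrite mxE sumr_ge0// => j _.
by rewrite [A^T _ _]mxE -expr2 sqr_ge0.
Qed.

Lemma sqnorm_mulmx_le (m n : nat) (A : 'M[R]_(m, n)) (u : 'cV[R]_n) :
  sqnorm (A *m u) <= \tr (A *m A^T) * sqnorm u.
Proof.
rewrite {1}/sqnorm dotE /mxtrace mulr_suml; apply: ler_sum => i _.
have -> : (A *m u) i ord0 = dot (row i A)^T u.
  by rewrite dotE mxE; apply: eq_bigr => j _; rewrite !mxE.
rewrite -expr2 (le_trans (cauchy_schwarz _ _))// ler_wpM2r ?sqnorm_ge0//.
rewrite /sqnorm dotE mxE le_eqVlt; apply/orP; left; apply/eqP.
by apply: eq_bigr => j _; rewrite !mxE.
Qed.

End FrobeniusBound.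

Section Pearson.
Variables (R : realType) (M : nat) (p : 'I_M -> R).
Hypothesis p_gt0 : forall r, 0 < p r.
Implicit Types y z : 'I_M -> R.

Definition scaled z : 'cV[R]_M := \col_r (z r / Num.sqrt (p r)).
Definition pearson z : R := sqnorm (scaled z).

Lemma scaledB y z : scaled (y \- z) = scaled y - scaled z.
Proof. by apply/colP => r; rewrite !mxE mulrBl. Qed.

Lemma scaledD y z : scaled (y \+ z) = scaled y + scaled z.
Proof. by apply/colP => r; rewrite !mxE mulrDl. Qed.

Lemma pearsonE z : pearson z = \sum_r z r ^+ 2 / p r.
Proof.
rewrite /pearson /sqnorm dotE; apply: eq_bigr => r _.
by rewrite !mxE -expr2 exprMn exprVn sqr_sqrtr// ltW.
Qed.

Lemma pearson_ge0 z : 0 <= pearson z.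
Proof. exact: sqnorm_ge0. Qed.

Lemma pearson_distC y z : pearson (y \- z) = pearson (z \- y).
Proof. by rewrite /pearson !scaledB -sqnormN opprB. Qed.

Lemma pearsonD_le (e : R) y z : 0 < e ->
  pearson (y \+ z) <= (1 + e) * pearson y + (1 + e^-1) * pearson z.
Proof. by move=> e0; rewrite /pearson scaledD sqnormD_le. Qed.

Lemma pearson_le_sqr z (c : R) : (forall r, `|z r| <= c) ->
  pearson z <= (\sum_r (p r)^-1) * c ^+ 2.
Proof.
move=> zc; rewrite pearsonE mulr_suml; apply: ler_sum => r _.
rewrite mulrC ler_wpM2l ?invr_ge0 ?(ltW (p_gt0 r))// -real_normK ?num_real//.
by rewrite lerXn2r ?nnegrE// (le_trans _ (zc r)).
Qed.

End Pearson.

(** * Local behaviour of phi-divergences *)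

Section Admissible.
Variables (R : realType) (phi : R -> R).
Hypothesis phi_adm : admissible phi.
Local Notation curv := (derive1n 2 phi 1).

Lemma admissible_derive2_gt0 : 0 < curv.
Proof. by case: phi_adm => _ _ _ _ []. Qed.

Lemma near_phi_quadratic (e : R) : 0 < e ->
  \forall u \near (1 : R), `|phi u - curv / 2 * (u - 1) ^+ 2| <= e * (u - 1) ^+ 2.
Proof.
move=> e0; have [_ d1 d2 c2 [phi1 dphi1 _]] := phi_adm.
have /cvgrPdist_le/(_ e e0)/nbhs_ballP[d /= d0 near_c] := c2 1 ltr01.
pose d' := Num.min d (1 / 2); have d'0 : 0 < d' by rewrite lt_min d0 divr_gt0.
pose A := ball (1 : R) d'.
have A1 : A 1 by exact: ballxx.
have A_itv : is_interval A.
  move=> x y; rewrite /A /ball/= !ltr_distl => /andP[x1 x2] /andP[y1 y2] z /andP[xz zy].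
  by rewrite ltr_distl; apply/andP; split; lra.
have A_gt0 u : A u -> 0 < u by rewrite /A /ball/= lt_min !ltr_distl => /andP[_ /andP[]]; lra.
apply/nbhs_ballP; exists d' => // u Au.
pose f i := nth (cst 0) [:: phi; derive1 phi; derive1n 2 phi] i.
have fd i x : (i < 2)%N -> A x -> is_derive x 1 (f i) (f i.+1 x).
  move: i => [|[|//]] _ /A_gt0 x0; split; rewrite /f/= -?derive1E//; [exact: d1|exact: d2].
have fn x : A x -> `|f 2%N x - f 2%N 1| <= e * `|x - 1| ^+ 0.
  by rewrite /A /ball/= lt_min => /andP[xd _]; rewrite mulr1 distrC; exact: near_c.
have := taylor_bound A_itv A1 (ltW e0) fd fn Au; rewrite addn0 real_normK ?num_real//.
rewrite /taylor !big_ord_recr big_ord0 /f/= phi1 dphi1 !mul0r !add0r.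
by rewrite (_ : 2`!%:R = 2 :> R)// mulrAC.
Qed.

(* Convexity propagates the quadratic growth near 1 to a linear growth away from 1. *)
Lemma phi_linear_growth : exists2 d, 0 < d < 1 &
  forall h u, 0 <= h <= d -> 0 < u -> h <= `|u - 1| -> curv / 4 * h * `|u - 1| <= phi u.
Proof.
have [cvx _ _ _ [phi1 _ curv_gt0]] := phi_adm.
have c4 : 0 < curv / 4 by rewrite divr_gt0.
have /nbhs_ballP[r /= r0 quad] := near_phi_quadratic c4.
pose d := Num.min (r / 2) (1 / 2); have d0 : 0 < d by rewrite lt_min !divr_gt0.
have dr : d < r by rewrite gt_min ltr_pdivrMr// ltr_pMr// ltr1n.
have d1 : d < 1 by rewrite gt_min [X in _ || X]ltr_pdivrMr// mul1r ltr1n orbT.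
have low u : `|u - 1| <= d -> curv / 4 * `|u - 1| ^+ 2 <= phi u.
  move=> ud; rewrite real_normK ?num_real//.
  have := quad u; rewrite /ball/= distrC ler_distl => /(_ (le_lt_trans ud dr)); lra.
exists d; first by rewrite d0.
move=> h u /andP[h0 hd] u0 hu.
have [ud|ud] := leP `|u - 1| d.
  by apply: le_trans (low u ud); rewrite -mulrA ler_pM2l// expr2 ler_wpM2r.
set a := `|u - 1| in ud hu *; have a0 : 0 < a := lt_trans d0 ud.
pose t := d / a.
have t01 : 0 <= t <= 1.
  by apply/andP; split; [rewrite divr_ge0 ?ltW|rewrite ler_pdivrMr// mul1r ltW].
have chord : phi (t * u + (1 - t) * 1) <= t * phi u.
  by have := cvx u 1 t u0 ltr01 t01; rewrite phi1 mulr0 addr0.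
have at_d : `|(t * u + (1 - t) * 1) - 1| = d.
  rewrite (_ : _ - 1 = t * (u - 1)); last by ring.
  by rewrite normrM -/a ger0_norm ?(andP t01).1// /t mulfVK// gt_eqF.
have := le_trans (low _ _) chord; rewrite at_d lexx => /(_ isT) growth.
apply: (@le_trans _ _ (curv / 4 * d * a)); first by rewrite ler_pM2r// ler_wpM2l// ltW.
have : curv / 4 * d ^+ 2 * (a / d) <= t * phi u * (a / d) by rewrite ler_wpM2r// divr_ge0 ?ltW.
rewrite (_ : curv / 4 * d ^+ 2 * (a / d) = curv / 4 * d * a); last by field; rewrite gt_eqF.
by rewrite (_ : t * phi u * (a / d) = phi u)// /t; field; rewrite !gt_eqF.
Qed.

Lemma phi_ge0 (u : R) : 0 < u -> 0 <= phi u.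
Proof.
move=> u0; have [d /andP[d0 _] growth] := phi_linear_growth.
by have := growth 0 u; rewrite lexx (ltW d0) mulr0 mul0r; apply.
Qed.

Lemma continuous_phi (u : R) : 0 < u -> {for u, continuous phi}.
Proof.
move=> u0; apply/differentiable_continuous/derivable1_diffP.
by case: phi_adm => _ d1 _ _ _; exact: d1.
Qed.

End Admissible.

Section PhiDivergence.
Variables (R : realType) (M : nat).
Implicit Types p q : 'I_M -> R.

Definition phi_div (phi : R -> R) p q : R := \sum_r q r * phi (p r / q r).

Lemma dphiE (phi : R -> R) p q : (forall r, 0 < p r) -> (forall r, 0 < q r) ->
  dphi phi p q = (phi_div phi p q)%:E.
Proof.
move=> p0 q0; rewrite /dphi /phi_div -sumEFin; apply: eq_bigr => r _.
by rewrite /phiE divr_gt0.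
Qed.

Lemma phi_div_diag (phi : R -> R) p : admissible phi -> (forall r, 0 < p r) ->
  phi_div phi p p = 0.
Proof.
case=> _ _ _ _ [phi1 _ _] p0; apply: big1 => r _.
by rewrite divff ?phi1 ?mulr0// gt_eqF.
Qed.

Lemma cvg_phi_div (phi : R -> R) (U : Type) (F : set_system U) {FF : Filter F}
    (p q : U -> 'I_M -> R) (p0 q0 : 'I_M -> R) :
  admissible phi -> (forall r, 0 < p0 r) -> (forall r, 0 < q0 r) ->
  (forall r, p^~ r @ F --> p0 r) -> (forall r, q^~ r @ F --> q0 r) ->
  phi_div phi (p u) (q u) @[u --> F] --> phi_div phi p0 q0.
Proof.
move=> adm p0_gt0 q0_gt0 pF qF; apply: cvg_big => [|r _]; first exact: add_continuous.
have q0_neq0 : q0 r != 0 by rewrite gt_eqF.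
apply: cvgM => //; apply: (@cvg_comp _ _ _ (fun u => p u r / q u r) phi); last first.
  by apply: continuous_phi => //; rewrite divr_gt0.
by apply: cvgM => //; exact: cvgV.
Qed.

Lemma phi_div_away (phi : R -> R) (d : R) : admissible phi -> 0 < d ->
  exists2 b, 0 < b & forall p q r, (forall t, 0 < p t) -> (forall t, 0 < q t) ->
    q r <= 1 -> d <= `|p r - q r| -> b <= phi_div phi p q.
Proof.
move=> adm d0; have curv_gt0 := admissible_derive2_gt0 adm.
have [d1 /andP[d10 _] growth] := phi_linear_growth adm.
set curv := derive1n 2 phi 1 in curv_gt0 growth.
pose h := Num.min d d1; have h0 : 0 < h by rewrite lt_min d0.
have hd : h <= d by rewrite ge_min lexx.
have hd1 : 0 <= h <= d1 by rewrite ltW//= ge_min lexx orbT.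
exists (curv / 4 * h * d); first by rewrite !mulr_gt0// invr_gt0.
move=> p q r p0 q0 q1 pq.
have ratio : `|p r / q r - 1| = `|p r - q r| / q r.
  by rewrite -[X in _ = _ / X](gtr0_norm (q0 r)) -normf_div mulrBl divff ?gt_eqF.
have hu : h <= `|p r / q r - 1|.
  by rewrite ratio ler_pdivlMr// (le_trans _ pq)// (le_trans _ hd)// ler_piMr// ltW.
have := growth h _ hd1 (divr_gt0 (p0 r) (q0 r)) hu; rewrite ratio => low.
have term_ge0 t : 0 <= q t * phi (p t / q t).
  by rewrite mulr_ge0 ?(ltW (q0 t))// phi_ge0// divr_gt0.
rewrite /phi_div (bigD1 r)//=; apply: (@le_trans _ _ (q r * phi (p r / q r))); last first.
  by rewrite lerDl sumr_ge0.
apply: le_trans (ler_wpM2l (ltW (q0 r)) low).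
rewrite [leRHS](_ : _ = curv / 4 * h * `|p r - q r|); last by field; rewrite gt_eqF.
by rewrite ler_wpM2l// mulr_ge0 ?divr_ge0// ltW.
Qed.

End PhiDivergence.

Section PhiDivergenceLimit.
Variables (R : realType) (M : nat) (p0 : 'I_M -> R).
Variables (U : Type) (F : set_system U).
Context {FF : Filter F}.
Hypothesis p0_gt0 : forall r, 0 < p0 r.

Lemma near_forall_gt0 (p : U -> 'I_M -> R) : (forall r, p^~ r @ F --> p0 r) ->
  \forall u \near F, forall r, 0 < p u r.
Proof. by move=> pF; apply: filter_forall => r; exact: cvgr_gt (pF r) _ (p0_gt0 r). Qed.

Variable phi : R -> R.
Hypothesis phi_adm : admissible phi.
Local Notation curv := (derive1n 2 phi 1).

Lemma near_phi_div_term (x y : U -> R) (a e : R) : 0 < a -> 0 < e ->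
  x @ F --> a -> y @ F --> a ->
  \forall u \near F, `|2 / curv * (y u * phi (x u / y u)) - (x u - y u) ^+ 2 / a|
    <= e * ((x u - y u) ^+ 2 / a).
Proof.
move=> a0 e0 xF yF; have curv_gt0 := admissible_derive2_gt0 phi_adm.
have ce : 0 < curv * e / 8 by rewrite divr_gt0// mulr_gt0.
have e2 : 0 < Num.min (e / 2) 1 by rewrite lt_min ltr01 divr_gt0.
have a_neq0 : a != 0 by rewrite gt_eqF.
have ratio : (fun u => x u / y u) @ F --> (1 : R).
  by rewrite -(divff a_neq0); exact: cvgM xF (cvgV _ yF).
have ay : (fun u => a / y u) @ F --> (1 : R).
  by rewrite -(divff a_neq0); apply: cvgM (cvgV _ yF) => //; exact: cvg_cst.
near=> u.
have yu0 : 0 < y u by near: u; exact: cvgr_gt yF _ a0.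
have quad : `|phi (x u / y u) - curv / 2 * (x u / y u - 1) ^+ 2|
      <= curv * e / 8 * (x u / y u - 1) ^+ 2.
  by near: u; exact: ratio (near_phi_quadratic phi_adm ce).
have ayu : `|1 - a / y u| <= Num.min (e / 2) 1 by near: u; exact: (cvgrPdist_le _ _).1 ay _ e2.
set s := (x u - y u) ^+ 2 / a; have s0 : 0 <= s by rewrite divr_ge0 ?sqr_ge0// ltW.
have y_neq0 : y u != 0 by rewrite gt_eqF.
have sE : (x u / y u - 1) ^+ 2 * (2 / curv * y u) = 2 / curv * (a / y u * s).
  by rewrite /s; field; rewrite y_neq0 a_neq0 gt_eqF.
have quads : `|2 / curv * (y u * phi (x u / y u)) - a / y u * s| <= e / 4 * (a / y u * s).
  rewrite (_ : _ - _ =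
    (phi (x u / y u) - curv / 2 * (x u / y u - 1) ^+ 2) * (2 / curv * y u)); last first.
    by rewrite mulrBl -(mulrA (curv / 2)) sE; field; rewrite y_neq0 gt_eqF.
  have g0 : 0 < 2 / curv * y u by rewrite mulr_gt0// divr_gt0.
  rewrite normrM (gtr0_norm g0); apply: le_trans (ler_wpM2r (ltW g0) quad) _.
  rewrite -[leLHS]mulrA sE le_eqVlt; apply/orP; left; apply/eqP.
  by field; rewrite y_neq0 gt_eqF.
move: ayu; rewrite le_min => /andP[]; rewrite !ler_distl => /andP[l1 u1] /andP[l2 u2].
have := ler_wpM2r s0 l1; have := ler_wpM2r s0 u1; have := ler_wpM2r s0 l2; have := ler_wpM2r s0 u2.
move: quads; rewrite !ler_distl => /andP[ql qu].
have e4 : e / 4 * (a / y u * s) <= e / 4 * (2 * s).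
  by rewrite ler_wpM2l ?divr_ge0 ?(ltW e0)// ler_wpM2r//; lra.
move=> *; apply/andP; split; lra.
Unshelve. all: by end_near. Qed.

Lemma near_phi_div_quadratic (p q : U -> 'I_M -> R) (e : R) : 0 < e ->
  (forall r, p^~ r @ F --> p0 r) -> (forall r, q^~ r @ F --> p0 r) ->
  \forall u \near F, `|2 / curv * phi_div phi (p u) (q u) - pearson p0 (p u \- q u)|
    <= e * pearson p0 (p u \- q u).
Proof.
move=> e0 pF qF; have : \forall u \near F, forall r,
    `|2 / curv * (q u r * phi (p u r / q u r)) - (p u r - q u r) ^+ 2 / p0 r|
    <= e * ((p u r - q u r) ^+ 2 / p0 r).
  by apply: filter_forall => r; exact: near_phi_div_term.
apply: filterS => u term; rewrite pearsonE// /phi_div !mulr_sumr -sumrB.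
by apply: (le_trans (ler_norm_sum _ _ _)); apply: ler_sum => r _; exact: term.
Qed.

Lemma pearson_cvg0 (z : U -> 'I_M -> R) : (forall r, z^~ r @ F --> (0 : R)) ->
  pearson p0 (z u) @[u --> F] --> (0 : R).
Proof.
move=> zF; suff : pearson p0 (z u) @[u --> F] --> \sum_r (0 ^+ 2 / p0 r).
  by rewrite big1// => r _; rewrite expr0n mul0r.
under eq_cvg do rewrite pearsonE//.
apply: cvg_big => [|r _]; first exact: add_continuous.
by apply: cvgM; [exact: cvgM|exact: cvg_cst].
Qed.

End PhiDivergenceLimit.

(** * The log-linear model *)

Section LogLinearModel.
Variables (R : realType) (M M0 : nat) (W : 'M[R]_(M, M0)).
Hypothesis M_gt0 : (0 < M)%N.
Implicit Types (th b : 'cV[R]_M0) (p : 'I_M -> R).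

Lemma pmodel_norm_gt0 th : 0 < \sum_s expR ((W *m th) s ord0).
Proof.
case: M M_gt0 W => // m _ W'; rewrite (bigD1 ord0)//= ltr_pwDl ?expR_gt0//.
by apply: sumr_ge0 => s _; exact: expR_ge0.
Qed.

Lemma pmodel_gt0 th r : 0 < pmodel W th r.
Proof. by rewrite divr_gt0 ?expR_gt0// pmodel_norm_gt0. Qed.

Lemma pmodel_sum1 th : \sum_r pmodel W th r = 1.
Proof. by rewrite -mulr_suml divff// gt_eqF// pmodel_norm_gt0. Qed.

Lemma sum_onem_pmodel th : \sum_r (1 - pmodel W th r) = M%:R - 1.
Proof. by rewrite sumrB pmodel_sum1 sumr_const card_ord. Qed.

Lemma pmodel_le1 th r : pmodel W th r <= 1.
Proof.
rewrite -(pmodel_sum1 th) (bigD1 r)//= lerDl sumr_ge0// => s _.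
exact/ltW/pmodel_gt0.
Qed.

Lemma pmodel_cvg (U : Type) (F : set_system U) {FF : Filter F} (h : U -> 'cV[R]_M0) th r :
  (forall j, h u j ord0 @[u --> F] --> th j ord0) ->
  pmodel W (h u) r @[u --> F] --> pmodel W th r.
Proof.
move=> hth.
have lin s : (W *m h u) s ord0 @[u --> F] --> (W *m th) s ord0.
  under eq_cvg do rewrite mxE; rewrite mxE.
  apply: cvg_big => [|j _]; first exact: add_continuous.
  by apply: cvgM; [exact: cvg_cst|exact: hth].
have exp s : expR ((W *m h u) s ord0) @[u --> F] --> expR ((W *m th) s ord0).
  apply: (@cvg_comp _ _ _ (fun u => (W *m h u) s ord0) expR); first exact: lin.
  exact: continuous_expR.
apply: cvgM => //; apply: cvgV; first by rewrite gt_eqF// pmodel_norm_gt0.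
by apply: cvg_big => [|s _]; [exact: add_continuous|].
Qed.

Definition tangent p b (r : 'I_M) : R :=
  p r * ((W *m b) r ord0 - \sum_s p s * (W *m b) s ord0).

Lemma is_derive_pmodel th b r (t : R) :
  is_derive t 1 (fun t => pmodel W (th + t *: b) r) (tangent (pmodel W (th + t *: b)) b r).
Proof.
pose x s := (W *m b) s ord0; pose E s t := expR ((W *m th) s ord0 + t * x s).
have EE s v : expR ((W *m (th + v *: b)) s ord0) = E s v.
  by rewrite mulmxDr -scalemxAr mxE [X in _ + X]mxE.
have Ed s : is_derive t 1 (E s) (x s * E s t).
  by apply: is_derive_eq; rewrite /GRing.scale/= /E; ring.
pose S := \sum_s E s; have SE v : S v = \sum_s E s v by rewrite /S fct_sumE.
have S0 : S t != 0.
  rewrite SE gt_eqF//; have := pmodel_norm_gt0 (th + t *: b).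
  by under eq_bigr do rewrite EE.
have Sd : is_derive t 1 S (\sum_s x s * E s t) by exact: is_derive_sum.
have Vd := is_deriveV S0 Sd.
have piE v s : pmodel W (th + v *: b) s = E s v / S v.
  by rewrite /pmodel EE SE; under eq_bigr do rewrite EE.
rewrite (_ : (fun t => _) = (fun t => E r t / S t)); last by apply/funext => v; exact: piE.
apply: is_derive_eq; rewrite /GRing.scale/= /tangent piE -/(x r).
rewrite (_ : \sum_s pmodel _ _ s * _ = (\sum_s x s * E s t) / S t); first by field.
by rewrite mulr_suml; apply: eq_bigr => s _; rewrite piE -/(x s); ring.
Qed.

Definition tangent2 p b (r : 'I_M) : R :=
  tangent p b r * ((W *m b) r ord0 - \sum_s p s * (W *m b) s ord0) -
  p r * \sum_s tangent p b s * (W *m b) s ord0.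

Lemma is_derive_tangent th b r (t : R) :
  is_derive t 1 (fun t => tangent (pmodel W (th + t *: b)) b r)
    (tangent2 (pmodel W (th + t *: b)) b r).
Proof.
pose x s := (W *m b) s ord0; pose mean v := \sum_s pmodel W (th + v *: b) s * x s.
have pd s := is_derive_pmodel th b s t.
have meand : is_derive t 1 mean (\sum_s tangent (pmodel W (th + t *: b)) b s * x s).
  rewrite (_ : mean = \sum_s (fun v => pmodel W (th + v *: b) s * x s)); last first.
    by apply/funext => v; rewrite fct_sumE.
  apply: is_derive_sum => s; apply: is_derive_eq.
  by rewrite /GRing.scale/= mulr0 add0r mulrC.
by apply: is_derive_eq; rewrite /GRing.scale/= /tangent2 -/(mean t) -/(x r); ring.
Qed.

Lemma tangent2_le th b r (c : R) : (forall s, `|(W *m b) s ord0| <= c) ->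
  `|tangent2 (pmodel W th) b r| <= 6 * c ^+ 2.
Proof.
move=> xc; have c0 : 0 <= c := le_trans (normr_ge0 _) (xc r).
set p := pmodel W th; pose x s := (W *m b) s ord0.
have p0 s : 0 <= p s by exact/ltW/pmodel_gt0.
have p1 : \sum_s p s = 1 by exact: pmodel_sum1.
have mean_le (y : 'I_M -> R) e : (forall s, `|y s| <= p s * e) -> `|\sum_s y s| <= e.
  move=> ye; rewrite -[leRHS]mul1r -p1 mulr_suml.
  by apply: (le_trans (ler_norm_sum _ _ _)); apply: ler_sum.
have dev s : `|x s - \sum_s p s * x s| <= 2 * c.
  rewrite mulr2n mulrDl mul1r; apply: (le_trans (ler_normB _ _)); apply: lerD; first exact: xc.
  by apply: mean_le => t; rewrite normrM (ger0_norm (p0 t)) ler_wpM2l//; exact: xc.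
have tan s : `|tangent p b s| <= p s * (2 * c).
  by rewrite normrM (ger0_norm (p0 s)) ler_wpM2l//; exact: dev.
have pr1 : p r <= 1 by exact: pmodel_le1.
have -> : 6 * c ^+ 2 = 2 * c * (2 * c) + 2 * c ^+ 2 by ring.
apply: (le_trans (ler_normB _ _)); apply: lerD; rewrite normrM.
  apply: ler_pM => //; last exact: dev.
  by apply: (le_trans (tan r)); rewrite ler_piMl// mulr_ge0.
rewrite ger0_norm//; apply: le_trans (ler_piMl (normr_ge0 _) pr1) _.
apply: mean_le => s; rewrite normrM (_ : _ * (2 * _) = p s * (2 * c) * c); last by ring.
by apply: ler_pM => //; exact: xc.
Qed.

Lemma tangent_remainder_le th b r :
  `|pmodel W (th + b) r - pmodel W th r - tangent (pmodel W th) b r| <= 6 * sqnorm (W *m b).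
Proof.
pose c := Num.sqrt (sqnorm (W *m b)).
have c2 : c ^+ 2 = sqnorm (W *m b) by rewrite sqr_sqrtr ?sqnorm_ge0.
have xc s : `|(W *m b) s ord0| <= c.
  by rewrite -ler_sqr ?nnegrE ?sqrtr_ge0// real_normK ?num_real// c2 sqr_entry_le_sqnorm.
pose pi t := pmodel W (th + t *: b).
pose f i := nth (cst 0)
  [:: pi ^~ r; (fun t => tangent (pi t) b r); (fun t => tangent2 (pi t) b r)] i.
have fd i (t : R) : (i <= 1)%N -> `[0, 1]%classic t -> is_derive t 1 (f i) (f i.+1 t).
  by case: i => [|[|//]] _ _; [exact: is_derive_pmodel|exact: is_derive_tangent].
have itv01 : is_interval (`[(0 : R), 1]%classic) by exact: interval_is_interval.
have in01 (t : R) : t \in `[0, 1] -> `[0, 1]%classic t by [].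
have := taylor_bound_derive itv01 (in01 0 _) fd (fun t _ => tangent2_le _ _ xc) (in01 1 _).
rewrite !in_itv/= !lexx ler01 => /(_ isT isT).
rewrite /taylor subr0 normr1 expr1n mulr1 !big_ord_recr big_ord0/= (_ : 0`!%:R = 1 :> R)//.
by rewrite /f/= /pi scale1r scale0r !addr0 add0r !expr1n !divr1 !mulr1 c2 opprD addrA.
Qed.

Lemma dist_ln_le (a b : R) : 0 < b -> `|a - b| <= b / 2 -> `|ln a - ln b| <= 2 / b * `|a - b|.
Proof.
move=> b0 ab; have a2 : b / 2 <= a by move: ab; rewrite ler_distl; lra.
have a0 : 0 < a by lra.
have ln_le (x y : R) : 0 < x -> b / 2 <= y -> ln x - ln y <= 2 / b * `|x - y|.
  move=> x0 y2; have y0 : 0 < y by lra.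
  rewrite -ln_div ?posrE//; apply: (@le_trans _ _ ((x - y) / y)).
    have : -1 < x / y - 1 by rewrite ltrBrDl subrr divr_gt0.
    by move/le_ln1Dx; rewrite subrKC mulrBl divff// gt_eqF.
  apply: le_trans (ler_norm _) _; rewrite normrM (gtr0_norm (_ : 0 < y^-1)) ?invr_gt0//.
  rewrite mulrC ler_wpM2r//.
  by rewrite -[leRHS]invrK lef_pV2 ?posrE ?invr_gt0 ?divr_gt0// invf_div.
rewrite ler_norml lerNl opprB [in X in X && _]distrC; apply/andP; split; apply: ln_le => //.
by rewrite ler_pdivrMr// ler_peMr ?ler1n// ltW.
Qed.

End LogLinearModel.

Section ModelGeometry.
Variables (R : realType) (M M0 : nat) (W : 'M[R]_(M, M0)).
Hypothesis M_gt0 : (0 < M)%N.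
Hypothesis design_rank : \rank (row_mx W (const_mx 1 : 'cV[R]_M)) = M0.+1.
Variable th0 : 'cV[R]_M0.
Local Notation p0 := (pmodel W th0).
Local Notation design := (row_mx W (const_mx 1 : 'cV[R]_M)).
Implicit Types (b th : 'cV[R]_M0) (z : 'I_M -> R).

Let p0_gt0 r : 0 < p0 r := pmodel_gt0 W M_gt0 th0 r.
Let sqrtp0_gt0 r : 0 < Num.sqrt (p0 r).
Proof. by rewrite sqrtr_gt0. Qed.
Let sqrtp0_sqr r : Num.sqrt (p0 r) ^+ 2 = p0 r.
Proof. by rewrite sqr_sqrtr// ltW. Qed.

Lemma sqnorm_usubmx_le (m n : nat) (u : 'cV[R]_(m + n)) : sqnorm (usubmx u) <= sqnorm u.
Proof.
rewrite -[u in leRHS]vsubmxK /sqnorm /dot tr_col_mx mul_row_col mxtraceD lerDl.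
exact: sqnorm_ge0.
Qed.

Lemma sqnorm_param_le : exists2 C : R, 0 < C & forall th,
  (forall r, `|pmodel W th r - p0 r| <= p0 r / 2) ->
  sqnorm (th - th0) <= C * pearson p0 (pmodel W th \- p0).
Proof.
have /row_fullP[L LF] : row_full design by rewrite /row_full design_rank addn1.
pose f := \tr (L *m L^T); have f0 : 0 <= f := mxtrace_mul_tr_ge0 L.
pose s := \sum_r (p0 r)^-1; have s0 : 0 <= s by apply: sumr_ge0 => r _; rewrite invr_ge0 ltW.
exists (f * (4 * s) + 1); first by rewrite ltr_wpDl// !mulr_ge0.
move=> th near_p0.
pose v : 'cV[R]_M := \col_r (ln (pmodel W th r) - ln (p0 r)).
pose kappa := ln (\sum_s expR ((W *m th0) s ord0)) - ln (\sum_s expR ((W *m th) s ord0)).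
have vE : design *m col_mx (th - th0) kappa%:M = v.
  apply/colP => r; rewrite mul_row_col mulmxBr !mxE/= big_ord1 !mxE eqxx mulr1n mul1r.
  by rewrite /pmodel !ln_div ?posrE ?expR_gt0 ?pmodel_norm_gt0// !expRK /kappa !mxE; ring.
have v_le : sqnorm v <= 4 * s * pearson p0 (pmodel W th \- p0).
  rewrite pearsonE// /sqnorm dotE mulr_sumr; apply: ler_sum => r _.
  have ps : (p0 r)^-1 <= s.
    by rewrite /s (bigD1 r)//= lerDl sumr_ge0// => t _; rewrite invr_ge0 ltW.
  rewrite mxE -expr2 -real_normK ?num_real//.
  apply: (@le_trans _ _ ((2 / p0 r * `|pmodel W th r - p0 r|) ^+ 2)).
    by rewrite lerXn2r ?nnegrE ?mulr_ge0 ?invr_ge0 ?(ltW (p0_gt0 r))// dist_ln_le.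
  rewrite exprMn real_normK ?num_real// (_ : (2 / p0 r) ^+ 2 * _ =
    4 * (p0 r)^-1 * ((pmodel W th r - p0 r) ^+ 2 / p0 r)); last by ring.
  apply: ler_wpM2r; last by rewrite ler_pM2l.
  by apply: divr_ge0; [exact: sqr_ge0|exact: ltW].
apply: (@le_trans _ _ (f * sqnorm v)).
  apply: le_trans (sqnorm_mulmx_le L v); rewrite -vE mulmxA LF mul1mx.
  by apply: le_trans (sqnorm_usubmx_le _); rewrite col_mxKu.
rewrite mulrDl mul1r; apply: (@le_trans _ _ (f * (4 * s) * pearson p0 (pmodel W th \- p0))).
  by rewrite -[leRHS]mulrA ler_wpM2l.
by rewrite lerDl pearson_ge0.
Qed.

Lemma pearson_tangent_remainder_le : exists2 C : R, 0 < C & forall b,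
  pearson p0 ((pmodel W (th0 + b) \- p0) \- tangent W p0 b) <= C * sqnorm b ^+ 2.
Proof.
pose s := \sum_r (p0 r)^-1; have s0 : 0 <= s by apply: sumr_ge0 => r _; rewrite invr_ge0 ltW.
pose C := s * (6 * \tr (W *m W^T)) ^+ 2.
exists (C + 1); first by rewrite ltr_wpDl// mulr_ge0 ?sqr_ge0.
move=> b; apply: (@le_trans _ _ (C * sqnorm b ^+ 2)); last first.
  by rewrite ler_wpM2r ?sqr_ge0// lerDl.
rewrite /C -mulrA -exprMn -mulrA; apply: pearson_le_sqr => // r /=.
apply: le_trans (tangent_remainder_le W M_gt0 th0 b r) _.
by rewrite ler_pM2l// sqnorm_mulmx_le.
Qed.

Definition scaled_design : 'M[R]_(M, M0 + 1) :=
  diag_mx (\row_r Num.sqrt (p0 r)) *m design.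

Lemma rank_scaled_design : \rank scaled_design = (M0 + 1)%N.
Proof.
rewrite /scaled_design (eqmxMfull design (_ : row_full (diag_mx (\row_r Num.sqrt (p0 r))))).
  by rewrite design_rank addn1.
rewrite row_full_unit unitmxE det_diag unitfE; apply/prodf_neq0 => r _.
by rewrite mxE gt_eqF.
Qed.

Lemma scaled_designE b (kappa : R) r :
  (scaled_design *m col_mx b kappa%:M) r ord0 = Num.sqrt (p0 r) * ((W *m b) r ord0 + kappa).
Proof.
rewrite /scaled_design -mulmxA mul_diag_mx mul_row_col !mxE big_ord1 !mxE eqxx.
by rewrite mulr1n mul1r.
Qed.

Definition sqrt_pmodel : 'cV[R]_M := \col_r Num.sqrt (p0 r).

Lemma sqrt_pmodel_design : sqrt_pmodel = scaled_design *m col_mx 0 1%:M.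
Proof. by apply/colP => r; rewrite scaled_designE mulmx0 !mxE add0r mulr1. Qed.

Lemma dot_sqrt_pmodel_scaled z : dot sqrt_pmodel (scaled p0 z) = \sum_r z r.
Proof. by rewrite dotE; apply: eq_bigr => r _; rewrite !mxE mulrC mulfVK// gt_eqF. Qed.

Lemma scaled_tangent b : scaled p0 (tangent W p0 b) =
  scaled_design *m col_mx b (- \sum_s p0 s * (W *m b) s ord0)%:M.
Proof.
apply/colP => r; rewrite scaled_designE mxE /tangent -{1}[p0 r]sqrtp0_sqr.
by field; rewrite gt_eqF.
Qed.

(* The projector on the orthogonal complement of [sqrt p0] and of the tangent space. *)
Definition tangent_resproj : 'M[R]_M := resproj scaled_design.

Definition lsq_residual z : R := sqnorm (tangent_resproj *m scaled p0 z).

Lemma tangent_resproj_sqrt_pmodel : tangent_resproj *m sqrt_pmodel = 0.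
Proof.
by rewrite sqrt_pmodel_design mulmxA (resproj_mulmx rank_scaled_design) mul0mx.
Qed.

Lemma tangent_resproj_trace : (M0 < M)%N -> \tr tangent_resproj = (M - M0 - 1)%:R.
Proof.
move=> M0_lt; rewrite resproj_trace; last exact: rank_scaled_design.
by rewrite -subnDA natrB// addn1.
Qed.

Lemma lsq_residual_ge0 z : 0 <= lsq_residual z.
Proof. exact: sqnorm_ge0. Qed.

Lemma lsq_residual_le_pearson z : lsq_residual z <= pearson p0 z.
Proof. exact: sqnorm_resproj_le rank_scaled_design _. Qed.

Lemma lsq_residual_le z b : lsq_residual z <= pearson p0 (z \- tangent W p0 b).
Proof.
rewrite /pearson scaledB scaled_tangent.
exact: sqnorm_resproj_le_dist rank_scaled_design _ _.
Qed.

Definition lsq_param z : 'cV[R]_M0 := usubmx (lsq scaled_design *m scaled p0 z).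

Lemma sqnorm_lsq_param_le : exists2 C : R, 0 < C & forall z,
  sqnorm (lsq_param z) <= C * pearson p0 z.
Proof.
pose L := lsq scaled_design; exists (\tr (L *m L^T) + 1).
  by rewrite ltr_wpDl// mxtrace_mul_tr_ge0.
move=> z; apply: le_trans (sqnorm_usubmx_le _) (le_trans (sqnorm_mulmx_le _ _) _).
by rewrite ler_wpM2r ?pearson_ge0// lerDl.
Qed.

Lemma lsq_residualE z : \sum_r z r = 0 ->
  lsq_residual z = pearson p0 (z \- tangent W p0 (lsq_param z)).
Proof.
move=> z0; set y := scaled p0 z; pose beta := lsq scaled_design *m y.
rewrite /pearson scaledB scaled_tangent /lsq_residual mulmx_resproj -/y -/beta.
congr (sqnorm (_ - scaled_design *m _)); rewrite -[LHS]vsubmxK; congr col_mx.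
have [kappa kappaE] : exists kappa : R, dsubmx beta = kappa%:M.
  by exists (dsubmx beta ord0 ord0); rewrite -mx11_scalar.
rewrite kappaE; congr _%:M; apply/eqP; rewrite -subr_eq0 opprK; apply/eqP.
have orth : dot sqrt_pmodel (scaled_design *m beta) = 0.
  have -> : scaled_design *m beta = y - tangent_resproj *m y.
    by rewrite /tangent_resproj mulmx_resproj subKr.
  rewrite dotDr dotNr dot_sqrt_pmodel_scaled z0 sub0r /dot.
  rewrite -[tangent_resproj]resproj_sym mulmxA -trmx_mul.
  by rewrite -/tangent_resproj tangent_resproj_sqrt_pmodel trmx0 mul0mx mxtrace0 oppr0.
rewrite -[RHS]orth -[beta in RHS]vsubmxK kappaE dotE.
under [RHS]eq_bigr do rewrite scaled_designE mxE mulrA -expr2 sqrtp0_sqr mulrDr.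
by rewrite big_split/= -mulr_suml pmodel_sum1// mul1r addrC.
Qed.

End ModelGeometry.

(** * Minimum divergence estimation *)

Section Minimizer.
Variables (R : realType) (M M0 : nat) (W : 'M[R]_(M, M0)).
Hypothesis M_gt0 : (0 < M)%N.
Hypothesis design_rank : \rank (row_mx W (const_mx 1 : 'cV[R]_M)) = M0.+1.
Variable th0 : 'cV[R]_M0.
Local Notation p0 := (pmodel W th0).
Variable phi : R -> R.
Hypothesis phi_adm : admissible phi.
Variables (U : Type) (F : set_system U).
Context {FF : Filter F}.
Variable p : U -> 'I_M -> R.
Hypothesis p_cvg : forall r, p^~ r @ F --> p0 r.

Let p0_gt0 r : 0 < p0 r := pmodel_gt0 W M_gt0 th0 r.

Lemma near_pmodel_close (e : R) : 0 < e -> \forall u \near F, forall th,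
  phi_div phi (p u) (pmodel W th) <= phi_div phi (p u) p0 ->
  forall r, `|pmodel W th r - p0 r| <= e.
Proof.
move=> e0; have e2 : 0 < e / 2 by rewrite divr_gt0.
have [b b0 away] := @phi_div_away R M phi _ phi_adm e2.
have p_gt0 : \forall u \near F, forall r, 0 < p u r by exact: near_forall_gt0.
have p_close : \forall u \near F, forall r, `|p0 r - p u r| <= e / 2.
  by apply: filter_forall => r; move/cvgrPdist_le: (@p_cvg r) => /(_ _ e2).
have small : \forall u \near F, phi_div phi (p u) p0 < b.
  apply: (@cvgr_lt _ _ _ _ (fun u => phi_div phi (p u) p0)); last exact: b0.
  rewrite -(phi_div_diag phi_adm p0_gt0).
  by apply: (cvg_phi_div (q := fun=> p0)) => // r; exact: cvg_cst.
apply: filterS3 p_gt0 p_close small => u pu_gt0 pu_close pu_small th th_le r.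
have near_p : `|p u r - pmodel W th r| < e / 2.
  rewrite ltNge; apply/negP.
  move=> /(away _ _ r pu_gt0 (pmodel_gt0 W M_gt0 th) (pmodel_le1 W M_gt0 th r)).
  by move=> /le_trans/(_ th_le); rewrite leNgt pu_small.
rewrite distrC [e]splitr; apply: le_trans (ler_distD (p u r) _ _) _.
by apply: lerD; [exact: pu_close|exact: ltW].
Qed.

Lemma continuous_phi_div_pmodel (q : 'I_M -> R) : (forall r, 0 < q r) ->
  continuous (fun t : 'rV[R]_M0 => phi_div phi q (pmodel W t^T)).
Proof.
move=> q0 t; apply: (cvg_phi_div (F := nbhs t) (p := fun=> q)) => //.
- by move=> r; exact: pmodel_gt0.
- by move=> r; exact: cvg_cst.
move=> r; apply: (@pmodel_cvg _ _ _ W M_gt0 _ (nbhs t) _ (fun t' : 'rV_M0 => t'^T)) => j.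
under eq_cvg do rewrite mxE; rewrite mxE; exact: coord_continuous.
Qed.

Lemma near_sublevel_bounded : exists2 rho : R, 0 <= rho & \forall u \near F, forall th,
  phi_div phi (p u) (pmodel W th) <= phi_div phi (p u) p0 ->
  forall j, `|th j ord0 - th0 j ord0| <= rho.
Proof.
have [C C0 param_le] := sqnorm_param_le M_gt0 design_rank th0.
pose s := \sum_r (p0 r)^-1; have s0 : 0 <= s by apply: sumr_ge0 => r _; rewrite invr_ge0 ltW.
exists (Num.sqrt (C * s)); first exact: sqrtr_ge0.
have : \forall u \near F, forall r, forall th,
    phi_div phi (p u) (pmodel W th) <= phi_div phi (p u) p0 ->
    forall r', `|pmodel W th r' - p0 r'| <= p0 r / 2.
  by apply: filter_forall => r; apply: near_pmodel_close; rewrite divr_gt0.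
apply: filterS => u close th th_le j.
have close_p0 r : `|pmodel W th r - p0 r| <= p0 r / 2 by exact: close.
rewrite -ler_sqr ?nnegrE ?sqrtr_ge0// real_normK ?num_real// sqr_sqrtr ?mulr_ge0 ?(ltW C0)//.
have -> : th j ord0 - th0 j ord0 = (th - th0) j ord0 by rewrite !mxE.
apply: le_trans (sqr_entry_le_sqnorm _ _) (le_trans (param_le _ close_p0) _).
rewrite ler_wpM2l ?(ltW C0)// -[leRHS]mulr1 -(expr1n R 2); apply: pearson_le_sqr => // r /=.
apply: le_trans (close_p0 r) _; rewrite ler_pdivrMr// mul1r.
by apply: le_trans (pmodel_le1 W M_gt0 th0 r) _; rewrite ler1n.
Qed.

Lemma near_minimizer_exists : \forall u \near F, exists th, forall th',
  phi_div phi (p u) (pmodel W th) <= phi_div phi (p u) (pmodel W th').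
Proof.
have [rho rho0] := near_sublevel_bounded; apply: filterS2 (near_forall_gt0 (F := F) p0_gt0 p_cvg).
move=> u pu_gt0 bounded.
pose box j := `[(th0 j ord0 - rho)%R, (th0 j ord0 + rho)%R]%classic.
pose A : set 'rV[R]_M0 := [set t | forall j, box j (t ord0 j)].
have A_compact : compact A by apply: rV_compact => j; exact: segment_compact.
have A_th0 : A th0^T by move=> j; rewrite /box/= in_itv/= mxE gerBl lerDl rho0.
have [t tA tmin] := EVT_min_rV (ex_intro _ _ A_th0) A_compact
  (continuous_subspaceT (continuous_phi_div_pmodel pu_gt0)).
exists t^T => th'.
have [sublevel|above] := leP (phi_div phi (p u) (pmodel W th')) (phi_div phi (p u) p0).
  have := tmin th'^T; rewrite trmxK; apply; rewrite inE => j.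
  by rewrite /box/= in_itv/= mxE -ler_distl bounded.
by apply: le_trans (ltW above); have := tmin th0^T; rewrite trmxK; apply; rewrite inE.
Qed.

End Minimizer.

Section EstimatorExpansion.
Variables (R : realType) (M M0 : nat) (W : 'M[R]_(M, M0)).
Hypothesis M_gt0 : (0 < M)%N.
Hypothesis design_rank : \rank (row_mx W (const_mx 1 : 'cV[R]_M)) = M0.+1.
Variable th0 : 'cV[R]_M0.
Local Notation p0 := (pmodel W th0).
Variables (U : Type) (F : set_system U).
Context {FF : Filter F}.
Variable p : U -> 'I_M -> R.
Hypothesis p_cvg : forall r, p^~ r @ F --> p0 r.
Local Notation dev u := (p u \- p0).
Local Notation residual u := (lsq_residual W th0 (dev u)).

Let p0_gt0 r : 0 < p0 r := pmodel_gt0 W M_gt0 th0 r.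

Let pearson_dev_cvg0 : pearson p0 (dev u) @[u --> F] --> (0 : R).
Proof.
apply: (pearson_cvg0 p0_gt0 (z := fun u => dev u)) => r; rewrite -(subrr (p0 r)).
by apply: cvgB; [exact: p_cvg|exact: cvg_cst].
Qed.

Section LocalParameter.
Variables (b : U -> 'cV[R]_M0) (C : R).
Hypothesis C_gt0 : 0 < C.
Hypothesis b_le : \forall u \near F, sqnorm (b u) <= C * pearson p0 (dev u).

Lemma pmodel_local_cvg r : pmodel W (th0 + b u) r @[u --> F] --> p0 r.
Proof.
apply: pmodel_cvg => // j; under eq_cvg do rewrite mxE.
suff b_cvg0 : b u j ord0 @[u --> F] --> (0 : R).
  by have := cvgD (cvg_cst (th0 j ord0)) b_cvg0; rewrite addr0; exact.
apply/cvgr0Pnorm_le => e e0.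
have : \forall u \near F, C * pearson p0 (dev u) <= e ^+ 2.
  apply: (@cvgr_le _ _ _ _ (fun u => C * pearson p0 (dev u)) 0).
    by rewrite -(mulr0 C); apply: cvgM; [exact: cvg_cst|].
  by rewrite exprn_gt0.
apply: filterS2 b_le => u bu small.
rewrite -ler_sqr ?nnegrE ?(ltW e0)// real_normK ?num_real//.
exact: le_trans (sqr_entry_le_sqnorm _ _) (le_trans bu small).
Qed.

Lemma near_pearson_tangent_model (e : R) : 0 < e -> \forall u \near F,
  let tangent_dist := pearson p0 (dev u \- tangent W p0 (b u)) in
  let model_dist := pearson p0 (p u \- pmodel W (th0 + b u)) in
  tangent_dist <= (1 + e) * model_dist + e * pearson p0 (dev u) /\
  model_dist <= (1 + e) * tangent_dist + e * pearson p0 (dev u).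
Proof.
move=> e0; have [C1 C10 remainder_le] := pearson_tangent_remainder_le W M_gt0 th0.
pose K := (1 + e^-1) * C1 * C ^+ 2.
have K0 : 0 < K by rewrite !mulr_gt0 ?exprn_gt0// addr_gt0 ?invr_gt0.
have eK : 0 < e / K by rewrite divr_gt0.
have : \forall u \near F, pearson p0 (dev u) <= e / K.
  exact: (@cvgr_le _ _ _ _ (fun u => pearson p0 (dev u)) 0).
apply: filterS2 b_le => u bu small.
set rem := (pmodel W (th0 + b u) \- p0) \- tangent W p0 (b u).
have dev_ge0 := pearson_ge0 p0 (dev u).
have rem_le : (1 + e^-1) * pearson p0 rem <= e * pearson p0 (dev u).
  apply: (@le_trans _ _ (K * pearson p0 (dev u) ^+ 2)).
    rewrite [leRHS](_ : _ = (1 + e^-1) * (C1 * (C * pearson p0 (dev u)) ^+ 2)); last first.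
      by rewrite /K; ring.
    rewrite ler_wpM2l ?addr_ge0 ?invr_ge0 ?(ltW e0)//.
    apply: le_trans (remainder_le _) _; rewrite ler_pM2l// lerXn2r ?nnegrE ?sqnorm_ge0//.
    by rewrite mulr_ge0// ltW.
  by rewrite expr2 mulrA ler_wpM2r// mulrC -ler_pdivlMr.
split.
  have -> : dev u \- tangent W p0 (b u) = (p u \- pmodel W (th0 + b u)) \+ rem.
    by apply/funext => r; rewrite /rem /=; ring.
  by apply: le_trans (pearsonD_le _ _ _ e0) _ => //; rewrite lerD2l.
have -> : p u \- pmodel W (th0 + b u) = (dev u \- tangent W p0 (b u)) \+
    (tangent W p0 (b u) \- (pmodel W (th0 + b u) \- p0)).
  by apply/funext => r /=; ring.
by apply: le_trans (pearsonD_le _ _ _ e0) _ => //; rewrite lerD2l pearson_distC.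
Qed.

End LocalParameter.

Variables (phi2 : R -> R) (th : U -> 'cV[R]_M0).
Hypothesis phi2_adm : admissible phi2.
Hypothesis th_min : \forall u \near F, forall th',
  phi_div phi2 (p u) (pmodel W (th u)) <= phi_div phi2 (p u) (pmodel W th').
Local Notation fitted u := (pmodel W (th u)).

Lemma fitted_cvg r : fitted u r @[u --> F] --> p0 r.
Proof.
apply/cvgrPdist_le => e e0; have := near_pmodel_close (FF := FF) M_gt0 phi2_adm p_cvg e0.
by apply: filterS2 th_min => u min close; rewrite distrC; exact: close.
Qed.

Lemma near_min_pearson_le (b : U -> 'cV[R]_M0) (e : R) : 0 < e ->
  (forall r, pmodel W (th0 + b u) r @[u --> F] --> p0 r) ->
  \forall u \near F, pearson p0 (p u \- fitted u) <=
    (1 + e) * pearson p0 (p u \- pmodel W (th0 + b u)).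
Proof.
move=> e0 b_cvg; pose d := e / (2 + e); have e2 : 0 < 2 + e by rewrite addr_gt0.
have d0 : 0 < d by rewrite divr_gt0.
have c0 : 0 < 2 / derive1n 2 phi2 1 by rewrite divr_gt0// (admissible_derive2_gt0 phi2_adm).
have quad_b := near_phi_div_quadratic (FF := FF) p0_gt0 phi2_adm d0 p_cvg b_cvg.
have quad_th := near_phi_div_quadratic (FF := FF) p0_gt0 phi2_adm d0 p_cvg fitted_cvg.
apply: filterS3 th_min quad_b quad_th => u /(_ (th0 + b u)).
rewrite -(ler_pM2l c0) !ler_distl => min /andP[_ upper] /andP[lower _].
have : (1 - d) * pearson p0 (p u \- fitted u) <=
    (1 + d) * pearson p0 (p u \- pmodel W (th0 + b u)) by lra.
rewrite (_ : 1 + d = (1 - d) * (1 + e)); last by rewrite /d; field; rewrite gt_eqF.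
by rewrite -mulrA ler_pM2l// subr_gt0 ltr_pdivrMr// mul1r ltrDr.
Qed.

Lemma near_pearson_fitted_le : \forall u \near F,
  pearson p0 (p u \- fitted u) <= 2 * pearson p0 (dev u).
Proof.
have := near_min_pearson_le (b := fun=> 0) ltr01; rewrite addr0 => /(_ (fun=> cvg_cst _)).
exact.
Qed.

Lemma near_sqnorm_estimation_error : exists2 C, 0 < C & \forall u \near F,
  sqnorm (th u - th0) <= C * pearson p0 (dev u).
Proof.
have [C C0 param_le] := sqnorm_param_le M_gt0 design_rank th0.
exists (C * 6); first by rewrite mulr_gt0.
have close : \forall u \near F, forall r, `|fitted u r - p0 r| <= p0 r / 2.
  apply: filter_forall => r; have p0r2 : 0 < p0 r / 2 by rewrite divr_gt0.
  have /cvgrPdist_le/(_ _ p0r2) := @fitted_cvg r.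
  by apply: filterS => u; rewrite distrC.
apply: filterS2 close near_pearson_fitted_le => u close_u fitted_le.
apply: le_trans (param_le _ close_u) _; rewrite -mulrA ler_pM2l//.
have -> : fitted u \- p0 = (fitted u \- p u) \+ dev u by apply/funext => r /=; ring.
apply: le_trans (pearsonD_le _ _ _ ltr01) _; rewrite pearson_distC invr1; lra.
Qed.

Hypothesis p_sum1 : \forall u \near F, \sum_r p u r = 1.

Lemma near_pearson_fitted_residual (e : R) : 0 < e -> \forall u \near F,
  `|pearson p0 (p u \- fitted u) - residual u| <= e * pearson p0 (dev u).
Proof.
move=> e0; pose d := Num.min (e / 4) (1 / 2); have d0 : 0 < d by rewrite lt_min !divr_gt0.
have de : 4 * d <= e by rewrite mulrC -ler_pdivlMr// ge_min lexx.
have d2 : d <= 1 / 2 by rewrite ge_min lexx orbT.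
have [C1 C10 lsq_le] := sqnorm_lsq_param_le W th0.
have [C2 C20 th_le] := near_sqnorm_estimation_error.
have lsq_near : \forall u \near F, sqnorm (lsq_param W th0 (dev u)) <= C1 * pearson p0 (dev u).
  by apply: nearW => u; exact: lsq_le.
have lsq_cvg := pmodel_local_cvg lsq_near.
have fitted_vs_lsq := near_min_pearson_le d0 lsq_cvg.
have lsq_lin := near_pearson_tangent_model C10 lsq_near d0.
have fitted_lin := near_pearson_tangent_model C20 th_le d0.
apply: filterS2 p_sum1 (filterI fitted_vs_lsq (filterI lsq_lin fitted_lin)).
move=> u pu1 [fitted_le [[_ lsq_lin_u] [fitted_lin_u _]]].
have dev0 : \sum_r dev u r = 0 by rewrite sumrB pu1 pmodel_sum1// subrr.
rewrite -(lsq_residualE M_gt0 design_rank th0 dev0) in lsq_lin_u.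
rewrite (_ : th0 + (th u - th0) = th u) in fitted_lin_u; last by rewrite addrC subrK.
have {fitted_lin_u} := le_trans (lsq_residual_le M_gt0 design_rank th0 (dev u) _) fitted_lin_u.
have := lsq_residual_le_pearson M_gt0 design_rank th0 (dev u).
have d1 : 0 <= 1 + d by rewrite addr_ge0// ltW.
have {fitted_le lsq_lin_u} := le_trans fitted_le (ler_wpM2l d1 lsq_lin_u).
have := pearson_ge0 p0 (dev u).
move: (pearson p0 (dev u)) (pearson p0 (p u \- fitted u)) (residual u) => D n Q D0 nQ QD Qn.
have {}nQ : n <= Q + 4 * d * D.
  have : 0 <= d * (2 + d) * (D - Q) by rewrite !mulr_ge0 ?subr_ge0 ?addr_ge0 ?(ltW d0).
  have : 0 <= d * (1 - 2 * d) * D by rewrite !mulr_ge0 ?(ltW d0)//; lra.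
  lra.
have dD : d * D <= 1 / 2 * D by rewrite ler_wpM2r.
have : d * n <= d * (3 * D) by rewrite ler_pM2l//; lra.
have : 4 * d * D <= e * D by rewrite ler_wpM2r.
move=> *; rewrite ler_distl; apply/andP; split; lra.
Qed.

Theorem near_phi_div_residual (phi1 : R -> R) (e : R) : admissible phi1 -> 0 < e ->
  \forall u \near F,
    `|2 / derive1n 2 phi1 1 * phi_div phi1 (p u) (fitted u) - residual u|
    <= e * pearson p0 (dev u).
Proof.
move=> phi1_adm e0; have e4 : 0 < e / 4 by rewrite divr_gt0.
have e2 : 0 < e / 2 by rewrite divr_gt0.
have quad := near_phi_div_quadratic (FF := FF) p0_gt0 phi1_adm e4 p_cvg fitted_cvg.
apply: filterS3 quad near_pearson_fitted_le (near_pearson_fitted_residual e2).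
move=> u quad_u fitted_le residual_u.
apply: le_trans (ler_distD (pearson p0 (p u \- fitted u)) _ _) _.
apply: le_trans (lerD quad_u residual_u) _.
rewrite [leRHS](_ : _ = e / 4 * (2 * pearson p0 (dev u)) + e / 2 * pearson p0 (dev u)).
  by rewrite lerD2r ler_pM2l.
by field.
Qed.

End EstimatorExpansion.

(** * Convergence in probability *)

Section HighProbability.
Variables (R : realType) (T : nat -> finType) (P : forall N, T N -> R).
Hypothesis P_pmf : forall N, is_pmf (@P N).
Local Notation outcome := {N : nat & T N}.
Implicit Types (A : set outcome) (X Y Z : outcome -> R).

Definition prob_not A (N : nat) : R := prob (@P N) (fun w => ~~ `[< A (existT _ N w) >]).

(* The sets whose complements have vanishing probability form a filter, and convergence
   along this filter is convergence in probability. *)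
Definition whp : set_system outcome := [set A | prob_not A @ \oo --> (0 : R)].

Lemma whp_le A (b : nat -> R) : b @ \oo --> (0 : R) ->
  (\forall N \near \oo, prob_not A N <= b N) -> whp A.
Proof.
move=> b0 Ab; apply: squeeze_cvgr (cvg_cst 0) b0.
by apply: filterS Ab => N ->; rewrite prob_ge0.
Qed.

Lemma whp_filter : Filter whp.
Proof.
split.
- apply: (@whp_le _ (cst 0)); first exact: cvg_cst.
  by apply: nearW => N; rewrite /prob_not /prob /expect big1// => w _; rewrite asboolT// mulr0.
- move=> A B A0 B0; apply: (@whp_le _ (prob_not A \+ prob_not B)).
    by rewrite -[X in _ --> X](addr0 0); exact: cvgD.
  apply: nearW => N; apply: prob_le_or => // w _.
  by rewrite asbool_and negb_and.
- move=> A B AB A0; apply: (whp_le A0); apply: nearW => N; apply: le_prob => // w _.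
  by case: (asboolP (B _)) => //= nB; case: (asboolP (A _)) => // /AB.
Qed.

Local Existing Instance whp_filter.

Lemma near_tag (B : set nat) : \oo B -> \forall u \near whp, B (tag u).
Proof.
move=> B_oo; apply: (@whp_le _ (cst 0)); first exact: cvg_cst.
apply: filterS B_oo => N BN.
by rewrite /prob_not /prob /expect big1// => w _; rewrite asboolT// mulr0.
Qed.

Lemma cvg_tag (f : nat -> R) (a : R) : f @ \oo --> a -> f (tag u) @[u --> whp] --> a.
Proof. by move=> fa B /fa; exact: near_tag. Qed.

Lemma near_pmf_neq0 : \forall u \near whp, P (tagged u) != 0.
Proof.
apply: (@whp_le _ (cst 0)); first exact: cvg_cst.
apply: nearW => N; rewrite -[leRHS](expect_cst 0 (P_pmf N)).
by apply: le_expect => // w Pw; case: asboolP => // /(_ Pw).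
Qed.

Lemma cvg0_of_le_tight Y Z (C : R) : (forall u, 0 <= Y u) ->
  (\forall N \near \oo, expect (@P N) (fun w => Y (existT _ N w)) <= C) ->
  (forall e, 0 < e -> \forall u \near whp, `|Z u| <= e * Y u) -> Z @ whp --> (0 : R).
Proof.
move=> Y0 EY ZY; apply/cvgr0Pnorm_le => e e0; apply/cvgrPdist_le => d d0.
pose K := 2 * (`|C| + 1) / d.
have K0 : 0 < K by rewrite divr_gt0// mulr_gt0// ltr_wpDl.
have eK : 0 < e / K by rewrite divr_gt0.
have d2 : 0 < d / 2 by rewrite divr_gt0.
have /cvgrPdist_le/(_ _ d2) := ZY _ eK.
apply: filterS2 EY => N EYN; rewrite !sub0r !normrN !ger0_norm ?prob_ge0// => small.
have YK : prob (@P N) (fun w => K < Y (existT _ N w)) <= d / 2.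
  apply: le_trans (markov_le (P_pmf N) _ K0) _ => //.
  rewrite ler_pdivrMr//; apply: (le_trans EYN); apply: (le_trans (ler_norm C)).
  by rewrite [leRHS](_ : _ = `|C| + 1) ?lerDl// /K; field; rewrite gt_eqF.
rewrite [d]splitr; apply: le_trans (lerD small YK).
apply: prob_le_or => // w _; case: asboolP => // /negP; rewrite -ltNge => eZ _.
case: asboolP => //= ZY_w; rewrite -(ltr_pM2l eK); apply: lt_le_trans ZY_w.
by rewrite divfK// gt_eqF.
Qed.

Lemma cvg_whp_sqr X (a : R) :
  expect (@P N) (fun w => (X (existT _ N w) - a) ^+ 2) @[N --> \oo] --> (0 : R) ->
  X @ whp --> a.
Proof.
move=> EX0; apply/cvgrPdist_le => e e0; apply: (whp_le (b := fun N => (e ^+ 2)^-1 *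
  expect (@P N) (fun w => (X (existT _ N w) - a) ^+ 2))).
  by rewrite -[X in _ --> X](mulr0 (e ^+ 2)^-1); apply: cvgM => //; exact: cvg_cst.
apply: nearW => N; rewrite mulrC; apply: le_trans (markov_le (P_pmf N) _ _); last 2 first.
- by move=> w; exact: sqr_ge0.
- by rewrite exprn_gt0.
apply: le_expect => // w _; case: asboolP => // /negP.
by rewrite -ltNge distrC -ltr_sqr ?nnegrE ?(ltW e0)// real_normK ?num_real// => ->.
Qed.

Theorem slutsky_cdf (U : forall N, T N -> R) (S : forall N, T N -> \bar R) (F : R -> R) (x : R) :
  {for x, continuous F} ->
  (forall y, prob (@P N) (fun w => U N w <= y) @[N --> \oo] --> F y) ->
  (forall e, 0 < e -> \forall u \near whp,
    ((U _ (tagged u) - e)%:E <= S _ (tagged u) <= (U _ (tagged u) + e)%:E)%E) ->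
  prob (@P N) (fun w => (S N w <= x%:E)%E) @[N --> \oo] --> F x.
Proof.
move=> Fx UF SU; apply/cvgrPdist_le => e e0.
have e3 : 0 < e / 3 by rewrite divr_gt0.
have /cvgrPdist_le/(_ _ e3)/nbhs_ballP[r /= r0 F_near] := Fx.
pose d := r / 2; have d0 : 0 < d by rewrite divr_gt0.
have dr : d < r by rewrite ltr_pdivrMr// ltr_pMr// ltr1n.
have /cvgrPdist_le/(_ _ e3) bad := SU _ d0.
have /cvgrPdist_le/(_ _ e3) up := UF (x + d).
have /cvgrPdist_le/(_ _ e3) low := UF (x - d).
apply: filterS3 bad up low => N + up low; rewrite sub0r normrN ger0_norm ?prob_ge0// => bad.
have S_le : prob (@P N) (fun w => (S N w <= x%:E)%E) <=
    prob (@P N) (fun w => U N w <= x + d) + e / 3.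
  apply: le_trans (lerD (lexx _) bad).
  apply: prob_le_or => // w _ Sx; case: asboolP => /= [/andP[US _]|_]; last by rewrite orbT.
  by have := le_trans US Sx; rewrite lee_fin lerBlDr => ->.
have S_ge : prob (@P N) (fun w => U N w <= x - d) <=
    prob (@P N) (fun w => (S N w <= x%:E)%E) + e / 3.
  apply: le_trans (lerD (lexx _) bad).
  apply: prob_le_or => // w _ Ux; case: asboolP => /= [/andP[_ SU']|_]; last by rewrite orbT.
  by rewrite (le_trans SU')// lee_fin -lerBrDr.
have := F_near (x + d); have := F_near (x - d).
rewrite /ball/= !(distrC x) addrAC subrr add0r [_ + d - x]addrAC subrr add0r.
rewrite normrN gtr0_norm// => /(_ dr) near_low /(_ dr) near_up.
move: up low near_low near_up; rewrite !ler_distl => /andP[? _] /andP[_ ?] /andP[_ ?] /andP[? _].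
apply/andP; split; lra.
Qed.

End HighProbability.

(** * Independent clusters *)

Section ClusterData.
Variables (R : realType) (G M : nat) (n Ng : 'I_G -> nat).
Variable q : forall g : 'I_G, cvec M (n g) -> R.
Hypothesis q_pmf : forall g, is_pmf (@q g).
Local Notation data := (dataset M n Ng).

Definition cluster_index : finType := {g : 'I_G & 'I_(Ng g)}.

Definition clusters (d : data) : {dffun forall i : cluster_index, cvec M (n (tag i))} :=
  finfun (fun i : cluster_index => d (tag i) (tagged i)).

Definition of_clusters (w : {dffun forall i : cluster_index, cvec M (n (tag i))}) : data :=
  finfun (fun g => [ffun l : 'I_(Ng g) => w (existT _ g l)]).

Lemma clustersK : cancel clusters of_clusters.
Proof. by move=> d; apply/ffunP => g; apply/ffunP => l; rewrite !ffunE. Qed.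

Lemma of_clustersK : cancel of_clusters clusters.
Proof. by move=> w; apply/ffunP => -[g l]; rewrite !ffunE. Qed.

Lemma sum_cluster (V : nmodType) (F : forall g, 'I_(Ng g) -> V) :
  \sum_(g < G) \sum_(l < Ng g) F g l = \sum_(i : cluster_index) F (tag i) (tagged i).
Proof. by rewrite (sig_big_dep _ (fun _ _ => true)). Qed.

Lemma card_cluster_index : #|{: cluster_index}| = (\sum_(g < G) Ng g)%N.
Proof. by rewrite card_tagged sumnE big_map big_enum; apply: eq_bigr => g _; rewrite card_ord. Qed.

Lemma data_probE (d : data) :
  data_prob d q = prod_pmf (fun i : cluster_index => @q (tag i)) (clusters d).
Proof.
rewrite /data_prob (sig_big_dep _ (fun _ _ => true)) /prod_pmf.
by apply: eq_bigr => i _; rewrite ffunE.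
Qed.

Lemma data_prob_neq0 (d : data) g l : data_prob d q != 0 -> q (d g l) != 0.
Proof.
by rewrite data_probE => /(prod_pmf_neq0 (existT _ g l : cluster_index)); rewrite ffunE.
Qed.

Lemma expect_clusters (f : {dffun forall i : cluster_index, cvec M (n (tag i))} -> R) :
  expect (fun d : data => data_prob d q) (f \o clusters) =
  expect (prod_pmf (fun i : cluster_index => @q (tag i))) f.
Proof.
rewrite /expect (reindex clusters)/=; last exact/onW_bij/(Bijective clustersK of_clustersK).
by apply: eq_bigr => d _; rewrite data_probE.
Qed.

Lemma pmf_data_prob : is_pmf (fun d : data => data_prob d q).
Proof.
have [prod_ge0 prod_sum1] := pmf_prod (fun i : cluster_index => q_pmf (tag i)).
split=> [d|]; first by rewrite data_probE.
rewrite -[RHS]prod_sum1 (reindex clusters)/=; last first.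
  exact/onW_bij/(Bijective clustersK of_clustersK).
by apply: eq_bigr => d _; rewrite data_probE.
Qed.

Lemma expect_sqr_sum_clusters (h : forall g, cvec M (n g) -> R) :
  (forall g, expect (@q g) (@h g) = 0) ->
  expect (fun d : data => data_prob d q) (fun d => (\sum_g \sum_(l < Ng g) h g (d g l)) ^+ 2) =
  \sum_g (Ng g)%:R * expect (@q g) (fun v => h g v ^+ 2).
Proof.
move=> h_mean; pose f (i : cluster_index) := @h (tag i).
transitivity (expect (prod_pmf (fun i : cluster_index => @q (tag i)))
    (fun w => (\sum_i f i (w i)) ^+ 2)).
  rewrite -expect_clusters; apply: eq_bigr => d _ /=; rewrite sum_cluster; congr (_ * _ ^+ 2).
  by apply: eq_bigr => i _; rewrite ffunE.
rewrite expect_sqr_sum_centered//.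
rewrite -(sum_cluster (fun g _ => expect (@q g) (fun v => h g v ^+ 2))).
by apply: eq_bigr => g _; rewrite sumr_const card_ord -[_ *+ _]mulr_natl.
Qed.

Lemma expect_sqr_group_sum (h : forall g, cvec M (n g) -> R) g (mu := expect (@q g) (h g)) :
  expect (fun d : data => data_prob d q) (fun d => (\sum_(l < Ng g) (h g (d g l) - mu)) ^+ 2) =
  (Ng g)%:R * expect (@q g) (fun v => (h g v - mu) ^+ 2).
Proof.
pose f g' v := (g' == g)%:R * (h g' v - expect (@q g') (h g')).
have f_mean g' : expect (@q g') (f g') = 0.
  by rewrite expectZ expectB (expect_cst _ (q_pmf g')) subrr mulr0.
transitivity (expect (fun d : data => data_prob d q)
    (fun d => (\sum_g' \sum_(l < Ng g') f g' (d g' l)) ^+ 2)).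
  apply: eq_bigr => d _; congr (_ * _ ^+ 2); rewrite (bigD1 g)//= [X in _ + X]big1 ?addr0.
    by apply: eq_bigr => l _; rewrite /f eqxx mul1r.
  by move=> g' g'g; rewrite big1// => l _; rewrite /f (negbTE g'g) mul0r.
rewrite (expect_sqr_sum_clusters f_mean) (bigD1 g)//= big1 ?addr0.
  by congr (_ * _); apply: eq_bigr => v _; rewrite /f eqxx mul1r.
move=> g' g'g; rewrite [expect _ _]big1 ?mulr0// => v _.
by rewrite /f (negbTE g'g) mul0r expr0n mulr0.
Qed.

End ClusterData.

Section ClusterMoments.
Variables (R : realType) (M M0 : nat) (W : 'M[R]_(M, M0)).
Hypothesis M_gt0 : (0 < M)%N.
Variable th0 : 'cV[R]_M0.
Local Notation p0 := (pmodel W th0).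

Definition centered (n : nat) (v : cvec M n) (r : 'I_M) : R := (v r : nat)%:R - n%:R * p0 r.

Lemma centered_le n (v : cvec M n) r : `|centered v r| <= n%:R.
Proof.
have v_le : (v r : nat)%:R <= n%:R :> R by rewrite ler_nat -ltnS.
have np0_ge0 : 0 <= n%:R * p0 r by rewrite mulr_ge0// ltW ?pmodel_gt0.
have np0_le : n%:R * p0 r <= n%:R by rewrite ler_piMr// pmodel_le1.
have v_ge0 : 0 <= (v r : nat)%:R :> R by [].
by rewrite ler_norml; apply/andP; split; rewrite /centered; lra.
Qed.

Variables (n : nat) (q : cvec M n -> R) (disp : R).
Hypothesis q_pmf : is_pmf q.
Hypothesis q_mean : forall r, expect q (fun v => (v r : nat)%:R) = n%:R * p0 r.
Hypothesis q_cov : forall r s, expect q (fun v => centered v r * centered v s) =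
  disp * n%:R * ((r == s)%:R * p0 r - p0 r * p0 s).

Lemma expect_centered r : expect q (fun v => centered v r) = 0.
Proof. by rewrite expectB q_mean (expect_cst _ q_pmf) subrr. Qed.

Lemma expect_centered_sqr r :
  expect q (fun v => centered v r ^+ 2) = disp * n%:R * (p0 r * (1 - p0 r)).
Proof.
rewrite -[LHS]/(expect q (fun v => centered v r * centered v r)).
by rewrite q_cov eqxx mul1r; ring.
Qed.

Lemma expect_count_sqr r : expect q (fun v => (v r : nat)%:R ^+ 2) =
  disp * n%:R * (p0 r * (1 - p0 r)) + (n%:R * p0 r) ^+ 2.
Proof.
rewrite -expect_centered_sqr -[X in _ + X](expect_cst _ q_pmf) -expectD.
transitivity (expect q (fun v => (v r : nat)%:R ^+ 2) -
    2 * (n%:R * p0 r) * expect q (fun v => centered v r)).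
  by rewrite expect_centered mulr0 subr0.
by rewrite -expectZ -expectB; apply: eq_bigr => v _; rewrite /centered /cst; congr (_ * _); ring.
Qed.

Lemma scaled_centered_cov :
  \sum_v q v *: (scaled p0 (centered v) *m (scaled p0 (centered v))^T) =
  (disp * n%:R) *: (1%:M - sqrt_pmodel W th0 *m (sqrt_pmodel W th0)^T).
Proof.
apply/matrixP => r s; rewrite summxE !mxE big_ord1 !mxE.
have sqrt_neq0 t : Num.sqrt (p0 t) != 0 by rewrite gt_eqF// sqrtr_gt0 pmodel_gt0.
have sqr_sqrt t : p0 t = Num.sqrt (p0 t) ^+ 2 by rewrite sqr_sqrtr// ltW// pmodel_gt0.
transitivity ((Num.sqrt (p0 r) * Num.sqrt (p0 s))^-1 *
    expect q (fun v => centered v r * centered v s)).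
  rewrite -expectZ; apply: eq_bigr => v _; rewrite !mxE big_ord1 !mxE; congr (_ * _).
  by field; rewrite !sqrt_neq0.
rewrite q_cov; have [<-|_] := eqVneq r s.
  have := sqrt_neq0 r; have := sqr_sqrt r; move: (Num.sqrt (p0 r)) => a -> a0.
  by rewrite mul1r mulr1n; field.
have := sqrt_neq0 s; have := sqr_sqrt s; move: (Num.sqrt (p0 s)) => b -> b0.
have := sqrt_neq0 r; have := sqr_sqrt r; move: (Num.sqrt (p0 r)) => a -> a0.
by rewrite mul0r mulr0n; field; rewrite a0 b0.
Qed.

Hypothesis design_rank : \rank (row_mx W (const_mx 1 : 'cV[R]_M)) = M0.+1.
Local Notation proj := (tangent_resproj W th0).

Definition projected (v : cvec M n) : 'cV[R]_M := proj *m scaled p0 (centered v).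

Lemma projected_mean : \sum_v q v *: projected v = 0.
Proof.
have -> : \sum_v q v *: projected v = proj *m (\sum_v q v *: scaled p0 (centered v)).
  by rewrite mulmx_sumr; apply: eq_bigr => v _; rewrite -scalemxAr.
rewrite [X in _ *m X](_ : _ = 0) ?mulmx0//; apply/colP => r; rewrite summxE mxE.
transitivity ((Num.sqrt (p0 r))^-1 * expect q (fun v => centered v r)).
  by rewrite -expectZ; apply: eq_bigr => v _; rewrite !mxE [_^-1 * _]mulrC.
by rewrite expect_centered mulr0.
Qed.

Lemma projected_cov :
  \sum_v q v *: (projected v *m (projected v)^T) = (disp * n%:R) *: proj.
Proof.
transitivity (proj *m
    (\sum_v q v *: (scaled p0 (centered v) *m (scaled p0 (centered v))^T)) *m proj).
  rewrite mulmx_sumr mulmx_suml; apply: eq_bigr => v _.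
  by rewrite -scalemxAr -scalemxAl /projected trmx_mul resproj_sym !mulmxA.
rewrite scaled_centered_cov -scalemxAr -scalemxAl [proj *m (_ - _)]mulmxBr mulmx1 mulmxA.
rewrite tangent_resproj_sqrt_pmodel// mul0mx subr0.
by rewrite resproj_idem//; exact: rank_scaled_design.
Qed.

Lemma sqnorm_projected_le v : sqnorm (projected v) <= (\sum_r (p0 r)^-1) * n%:R ^+ 2.
Proof.
apply: le_trans (lsq_residual_le_pearson M_gt0 design_rank th0 (centered v)) _.
by apply: pearson_le_sqr => [r|r]; [exact: pmodel_gt0|exact: centered_le].
Qed.

End ClusterMoments.

Lemma cvg_natr_inv (R : realType) : (N%:R^-1 : R) @[N --> \oo] --> (0 : R).
Proof. by rewrite -(cvg_shiftS (fun N => N%:R^-1 : R)); exact: cvg_harmonic. Qed.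

Section SampleSizes.
Variables (R : realType) (G : nat) (n : 'I_G -> nat) (Ng : nat -> 'I_G -> nat).
Variable Nstar : 'I_G -> R.
Hypothesis n_gt0 : forall g, (0 < n g)%N.
Hypothesis Ng_sum : forall N, (\sum_(g < G) Ng N g = N)%N.
Hypothesis Nstar_gt0 : forall g, 0 < Nstar g.
Hypothesis Ng_cvg : forall g, (fun N : nat => (Ng N g)%:R / N%:R) @ \oo --> Nstar g.
Local Notation total N := (ntot n (Ng N)).

Lemma leq_ntot N : (N <= total N)%N.
Proof. by rewrite -{1}(Ng_sum N) /ntot; apply: leq_sum => g _; rewrite leq_pmull. Qed.

Lemma near_ntot_gt0 : \forall N \near \oo, 0 < (total N)%:R :> R.
Proof.
near=> N; rewrite ltr0n (leq_trans _ (leq_ntot N))//; near: N.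
exact: nbhs_infty_gt.
Unshelve. all: by end_near. Qed.

Lemma ntot_natrE N : (total N)%:R = \sum_g (n g)%:R * (Ng N g)%:R :> R.
Proof. by rewrite natr_sum; apply: eq_bigr => g _; rewrite natrM. Qed.

Lemma near_Ng_gt (m : nat) g : \forall N \near \oo, (m < Ng N g)%N.
Proof.
have half : Nstar g / 2 < Nstar g by rewrite ltr_pdivrMr// ltr_pMr// ltr1n.
have ratio : \forall N \near \oo, Nstar g / 2 < (Ng N g)%:R / N%:R.
  exact: cvgr_gt (@Ng_cvg g) _ half.
have large : \forall N \near \oo, 2 * m%:R / Nstar g < N%:R :> R.
  by have /cvgryPgt := @cvgr_idn R; exact.
apply: filterS2 ratio large => N ratio_gt N_gt.
have N0 : 0 < N%:R :> R by apply: le_lt_trans N_gt; rewrite divr_ge0 ?mulr_ge0// ltW.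
rewrite ltr_pdivlMr// in ratio_gt; rewrite ltr_pdivrMr// in N_gt.
rewrite -(ltr_nat R); lra.
Qed.

Lemma cvg_Ng_inv g : ((Ng N g)%:R^-1 : R) @[N --> \oo] --> (0 : R).
Proof.
have : ((Ng N g)%:R / N%:R : R)^-1 * N%:R^-1 @[N --> \oo] --> (Nstar g)^-1 * 0.
  by apply: cvgM; [apply: cvgV => //; rewrite gt_eqF|exact: cvg_natr_inv].
rewrite mulr0; apply: cvg_trans; apply: near_eq_cvg; near=> N.
have N0 : N%:R != 0 :> R by rewrite pnatr_eq0 -lt0n; near: N; exact: nbhs_infty_gt.
by rewrite invfM invrK mulfK.
Unshelve. all: by end_near. Qed.

Definition wgt_limit g : R := (n g)%:R * Nstar g / \sum_h (n h)%:R * Nstar h.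

Lemma wgt_limit_gt0 g : 0 < wgt_limit g.
Proof.
have pos h : 0 < (n h)%:R * Nstar h by rewrite mulr_gt0// ltr0n.
rewrite divr_gt0// (bigD1 g)//= ltr_pwDl// sumr_ge0// => h _; exact: ltW.
Qed.

Lemma cvg_wgt g : wgt R n (Ng N) g @[N --> \oo] --> wgt_limit g.
Proof.
have Ng_lim h : (n h)%:R * ((Ng N h)%:R / N%:R) @[N --> \oo] --> (n h)%:R * Nstar h.
  by apply: cvgM => //; exact: cvg_cst.
have : (n g)%:R * ((Ng N g)%:R / N%:R) / \sum_h (n h)%:R * ((Ng N h)%:R / N%:R)
    @[N --> \oo] --> wgt_limit g.
  apply: cvgM => //; apply: cvgV; last by apply: cvg_big => [|h _]; [exact: add_continuous|].
  by apply: contraNneq (lt0r_neq0 (wgt_limit_gt0 g)) => sum0; rewrite /wgt_limit sum0 invr0 mulr0.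
apply: cvg_trans; apply: near_eq_cvg; near=> N.
have N0 : N%:R != 0 :> R by rewrite pnatr_eq0 -lt0n; near: N; exact: nbhs_infty_gt.
under eq_bigr do rewrite mulrA.
by rewrite -mulr_suml -ntot_natrE invfM invrK mulrACA mulfVK// mulrAC.
Unshelve. all: by end_near. Qed.

Lemma group_gt0 : (0 < G)%N.
Proof.
rewrite lt0n; apply/eqP => G0; have := Ng_sum 1.
by rewrite big1// => g _; have := ltn_ord g; rewrite [X in (_ < X)%N]G0.
Qed.

End SampleSizes.

(** * Unequal cluster sizes *)

Lemma sum_sqr_dev (R : realFieldType) (m : nat) (a : 'I_m -> R) :
  \sum_l (a l - (\sum_i a i) / m%:R) ^+ 2 =
  m%:R * ((\sum_l a l ^+ 2) / m%:R - ((\sum_l a l) / m%:R) ^+ 2).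
Proof.
case: m a => [|m] a; first by rewrite mul0r big_ord0.
have m_neq0 : m.+1%:R != 0 :> R by rewrite pnatr_eq0.
set mean := (\sum_i a i) / _.
transitivity (\sum_l (a l ^+ 2 - 2 * mean * a l + mean ^+ 2)).
  by apply: eq_bigr => l _; ring.
rewrite big_split sumrB/= -mulr_sumr sumr_const card_ord -[_ *+ m.+1]mulr_natl /mean.
by field.
Qed.

Section GroupVariance.
Variables (R : realType) (G M : nat) (n Ng : 'I_G -> nat) (d : dataset M n Ng).

Definition group_var g r : R :=
  (\sum_(l < Ng g) phat_gl R d l r ^+ 2) / (Ng g)%:R - phat_g R d g r ^+ 2.

Lemma phat_gE g r : phat_g R d g r = (\sum_(l < Ng g) phat_gl R d l r) / (Ng g)%:R.
Proof. by rewrite /phat_g /phat_gl -mulr_suml invfM mulrA. Qed.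

Lemma deff_gE (pth : 'I_M -> R) g : (0 < Ng g)%N ->
  deff_g d pth g = (1 - (Ng g)%:R^-1)^-1 *
    ((n g)%:R / (M%:R - 1) * \sum_r (pth r)^-1 * group_var g r).
Proof.
move=> Ng0; have Ng_neq0 : (Ng g)%:R != 0 :> R by rewrite pnatr_eq0 -lt0n.
have -> : (1 - (Ng g)%:R^-1 : R)^-1 = (Ng g)%:R / ((Ng g)%:R - 1).
  by rewrite -[RHS]invrK invf_div mulrBl divff// mul1r.
rewrite /deff_g invfM !mulr_sumr; apply: eq_bigr => r _.
by rewrite phat_gE sum_sqr_dev -phat_gE -/(group_var g r); ring.
Qed.

End GroupVariance.

Section UnequalClusterSizes.
Variables (R : realType) (M M0 G : nat) (W : 'M[R]_(M, M0)) (th0 : 'cV[R]_M0).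
Hypothesis M0_lt : (M0 < M - 1)%N.
Hypothesis design_rank : \rank (row_mx W (const_mx 1 : 'cV[R]_M)) = M0.+1.
Local Notation p0 := (pmodel W th0).
Local Notation k := (M - M0 - 1)%N.

Let M_gt1 : (1 < M)%N.
Proof. by rewrite -subn_gt0 (leq_ltn_trans _ M0_lt). Qed.
Let M_gt0 : (0 < M)%N := ltnW M_gt1.
Let k_gt0 : (0 < k)%N.
Proof. by rewrite subn_gt0 ltn_subRL addnC -ltn_subRL. Qed.
Let p0_gt0 r : 0 < p0 r := pmodel_gt0 W M_gt0 th0 r.

(* [disp g] is the design effect of the clusters of group [g]. *)
Variables (n : 'I_G -> nat) (q : forall g : 'I_G, cvec M (n g) -> R) (disp : 'I_G -> R).
Hypothesis q_pmf : forall g, is_pmf (@q g).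
Hypothesis q_supp : forall g v, @q g v != 0 -> (\sum_(r < M) (v r : nat))%N = n g.
Hypothesis q_mean : forall g r, expect (@q g) (fun v => (v r : nat)%:R) = (n g)%:R * p0 r.
Hypothesis q_cov : forall g r s,
  expect (@q g) (fun v => centered W th0 v r * centered W th0 v s) =
  disp g * (n g)%:R * ((r == s)%:R * p0 r - p0 r * p0 s).

Section FixedSizes.
Variable Ng : 'I_G -> nat.
Local Notation data := (dataset M n Ng).
Local Notation law := (fun d : data => data_prob d q).
Local Notation total := ((ntot n Ng)%:R : R).

Definition mean_disp : R := \sum_g wgt R n Ng g * disp g.

Definition oracle_stat (d : data) : R := total * lsq_residual W th0 (phat R d \- p0) / mean_disp.

Hypothesis total_gt0 : 0 < total.

Lemma ntot_mean_disp : total * mean_disp = \sum_g (n g)%:R * (Ng g)%:R * disp g.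
Proof.
rewrite mulr_sumr; apply: eq_bigr => g _; rewrite /wgt mulrA; congr (_ * _).
by rewrite mulrC divfK// gt_eqF.
Qed.

Lemma sum_centered (d : data) r :
  \sum_g \sum_(l < Ng g) centered W th0 (d g l) r = total * (phat R d r - p0 r).
Proof.
rewrite mulrBr /phat mulrCA divff ?gt_eqF// mulr1 /Ytot natr_sum mulr_suml -sumrB.
apply: eq_bigr => g _; rewrite sumrB sumr_const card_ord; congr (_ - _).
by rewrite natrM -[_ *+ Ng g]mulr_natr mulrAC.
Qed.

Lemma phat_sum1 (d : data) : data_prob d q != 0 -> \sum_r phat R d r = 1.
Proof.
move=> d_neq0; rewrite -mulr_suml (_ : \sum_r Ytot R d r = total) ?divff ?gt_eqF//.
rewrite /Ytot exchange_big natr_sum; apply: eq_bigr => g _ /=.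
rewrite exchange_big/= (eq_bigr (fun=> (n g)%:R)).
  by rewrite sumr_const card_ord natrM mulr_natr.
by move=> l _; rewrite -natr_sum (q_supp (data_prob_neq0 _ d_neq0)).
Qed.

Lemma expect_dev_sqr r :
  expect law (fun d => (phat R d r - p0 r) ^+ 2) =
  mean_disp * (p0 r * (1 - p0 r)) * total^-1.
Proof.
have total_neq0 : total != 0 by rewrite gt_eqF.
transitivity (total^-1 ^+ 2 * expect law
    (fun d => (\sum_g \sum_(l < Ng g) centered W th0 (d g l) r) ^+ 2)).
  rewrite -expectZ; apply: eq_bigr => d _; congr (_ * _).
  by rewrite sum_centered// -exprMn mulKf.
rewrite (@expect_sqr_sum_clusters _ _ _ _ Ng q q_pmf
  (fun g v => centered W th0 v r))//; last first.
  by move=> g; exact: expect_centered.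
under eq_bigr do rewrite (expect_centered_sqr (@q_cov _)).
rewrite (_ : \sum_g _ = total * mean_disp * (p0 r * (1 - p0 r))); first by field.
rewrite ntot_mean_disp// mulr_suml; apply: eq_bigr => g _; ring.
Qed.

Lemma expect_ntot_pearson_dev :
  expect law (fun d => total * pearson p0 (phat R d \- p0)) =
  mean_disp * (M%:R - 1).
Proof.
rewrite expectZ.
have -> : expect law (fun d => pearson p0 (phat R d \- p0)) =
    \sum_r (p0 r)^-1 * expect law (fun d => (phat R d r - p0 r) ^+ 2).
  under [RHS]eq_bigr do rewrite -expectZ; rewrite -expect_sum.
  apply: eq_bigr => d _; rewrite pearsonE//; congr (_ * _).
  by apply: eq_bigr => r _; rewrite mulrC.
rewrite -(sum_onem_pmodel W M_gt0 th0).
rewrite !mulr_sumr; apply: eq_bigr => r _; rewrite expect_dev_sqr//; field.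
by rewrite !gt_eqF.
Qed.

Hypothesis mean_disp_gt0 : 0 < mean_disp.

Lemma oracle_statE (d : data) : oracle_stat d = sqnorm (\sum_(i : cluster_index Ng)
  (Num.sqrt (total * mean_disp))^-1 *: projected W th0 (clusters d i)).
Proof.
rewrite -scaler_sumr sqnormZ exprVn sqr_sqrtr ?mulr_ge0 ?(ltW total_gt0) ?(ltW mean_disp_gt0)//.
have -> : \sum_(i : cluster_index Ng) projected W th0 (clusters d i) =
    total *: (tangent_resproj W th0 *m scaled p0 (phat R d \- p0)).
  rewrite -mulmx_sumr scalemxAr; congr (_ *m _); apply/colP => r.
  rewrite summxE !mxE mulrA -sum_centered sum_cluster mulr_suml.
  by apply: eq_bigr => i _; rewrite !mxE ffunE.
rewrite sqnormZ -/(lsq_residual W th0 _) /oracle_stat; field.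
by rewrite !gt_eqF.
Qed.

Lemma laplace_oracle_stat_le (b l : R) : 0 < l -> 0 <= b ->
  (forall g, (\sum_r (p0 r)^-1) * (n g)%:R ^+ 2 <= b ^+ 2 * (total * mean_disp)) ->
  `|expect law (fun d => expR (- (l * oracle_stat d))) - (1 + 2 * l) `^ (- (k%:R / 2))|
  <= lindeberg_const k l * ((\sum_g Ng g)%N%:R * b ^+ 3 + b ^+ 2).
Proof.
move=> l0 b0 bounded; have S0 : 0 < total * mean_disp by rewrite mulr_gt0.
pose a : R := (Num.sqrt (total * mean_disp))^-1.
have a2 : a ^+ 2 = (total * mean_disp)^-1 by rewrite exprVn sqr_sqrtr// ltW.
pose x (i : cluster_index Ng) (v : cvec M (n (tag i))) := a *: projected W th0 v.
pose c (i : cluster_index Ng) := a ^+ 2 * (disp (tag i) * (n (tag i))%:R).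
rewrite -card_cluster_index.
have -> : expect law (fun d => expR (- (l * oracle_stat d))) =
    expect (prod_pmf (fun i : cluster_index Ng => @q (tag i)))
      (fun w => expR (- (l * sqnorm (\sum_i x i (w i))))).
  by rewrite -expect_clusters; apply: eq_bigr => d _; rewrite oracle_statE.
apply: (laplace_sqnorm_sum (proj := tangent_resproj W th0) (c := c)) => //.
- by apply: tangent_resproj_trace => //; exact: leq_trans M0_lt (leq_subr _ _).
- move=> i v; rewrite /x -scalemxAr /projected mulmxA resproj_idem//.
  exact: rank_scaled_design.
- move=> i; transitivity (a *: (\sum_v @q (tag i) v *: projected W th0 v)).
    by rewrite scaler_sumr; apply: eq_bigr => v _; rewrite /x !scalerA mulrC.
  by rewrite (projected_mean (q_pmf _) (@q_mean _)) scaler0.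
- move=> i; rewrite /c -scalerA -(projected_cov M_gt0 (q_cov (tag i)) design_rank).
  rewrite scaler_sumr; apply: eq_bigr => v _.
  by rewrite /x linearZ/= -scalemxAl -scalemxAr !scalerA expr2; congr (_ *: _); ring.
- move=> i v; rewrite sqnormZ a2 mulrC ler_pdivrMr//.
  by apply: le_trans (bounded (tag i)); exact: sqnorm_projected_le.
rewrite -mulr_sumr -(sum_cluster (fun g _ => disp g * (n g)%:R)) a2.
rewrite (_ : \sum_g _ = total * mean_disp); first by rewrite mulVf// gt_eqF.
rewrite ntot_mean_disp; apply: eq_bigr => g _.
by rewrite sumr_const card_ord -[_ *+ Ng g]mulr_natr; ring.
Qed.

End FixedSizes.

Variables (Ng : nat -> 'I_G -> nat) (Nstar : 'I_G -> R).
Hypothesis n_gt0 : forall g, (0 < n g)%N.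
Hypothesis disp_gt0 : forall g, 0 < disp g.
Hypothesis Ng_sum : forall N, (\sum_(g < G) Ng N g = N)%N.
Hypothesis Nstar_gt0 : forall g, 0 < Nstar g.
Hypothesis Ng_cvg : forall g, (fun N : nat => (Ng N g)%:R / N%:R) @ \oo --> Nstar g.
Local Notation data N := (dataset M n (Ng N)).
Local Notation law := (fun (N : nat) (d : data N) => data_prob d q).
Local Notation total N := ((ntot n (Ng N))%:R : R).
Local Notation obs u := (tagged u : data (tag u)).

Let law_pmf N : is_pmf (law N) := pmf_data_prob (Ng N) q_pmf.
Let whp_law_filter : Filter (whp law) := whp_filter law_pmf.
Local Existing Instance whp_law_filter.

Definition mean_disp_limit : R := \sum_g wgt_limit n Nstar g * disp g.

Lemma mean_disp_limit_gt0 : 0 < mean_disp_limit.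
Proof.
have term_gt0 g : 0 < wgt_limit n Nstar g * disp g by rewrite mulr_gt0// wgt_limit_gt0.
rewrite /mean_disp_limit (bigD1 (Ordinal (group_gt0 Ng_sum)))//= ltr_pwDl// sumr_ge0// => g _.
exact: ltW.
Qed.

Lemma cvg_mean_disp : mean_disp (Ng N) @[N --> \oo] --> mean_disp_limit.
Proof.
apply: cvg_big => [|g _]; first exact: add_continuous.
by apply: cvgM; [exact: cvg_wgt|exact: cvg_cst].
Qed.

Lemma oracle_stat_ge0 N (d : data N) : 0 <= oracle_stat d.
Proof.
rewrite divr_ge0 ?mulr_ge0 ?lsq_residual_ge0//; apply: sumr_ge0 => g _.
by rewrite mulr_ge0 ?(ltW (disp_gt0 g))// divr_ge0// mulr_ge0.
Qed.

Lemma cvg_laplace_oracle_stat (l : R) : 0 < l ->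
  expect (law N) (fun d => expR (- (l * oracle_stat d))) @[N --> \oo] -->
  (1 + 2 * l) `^ (- (k%:R / 2)).
Proof.
move=> l0; pose s := \sum_r (p0 r)^-1; pose delta := mean_disp_limit / 2.
have s0 : 0 <= s by apply: sumr_ge0 => r _; rewrite invr_ge0 ltW// pmodel_gt0.
have lim0 := mean_disp_limit_gt0; have delta0 : 0 < delta by rewrite divr_gt0.
have delta_lt : delta < mean_disp_limit by rewrite ltr_pdivrMr// ltr_pMr// ltr1n.
pose A := s * (\sum_g (n g)%:R) ^+ 2 / delta.
have A0 : 0 <= A by rewrite divr_ge0 ?(ltW delta0)// mulr_ge0// sqr_ge0.
pose b N : R := Num.sqrt (A * N%:R^-1).
have b_cvg0 : b N @[N --> \oo] --> (0 : R).
  rewrite -(sqrtr0 R); apply: (@cvg_comp _ _ _ (fun N => A * N%:R^-1) Num.sqrt _ (nbhs (0 : R))).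
    by rewrite -(mulr0 A); apply: cvgM; [exact: cvg_cst|exact: cvg_natr_inv].
  exact: sqrt_continuous.
have bound_cvg0 : lindeberg_const k l * (A * b N + b N ^+ 2) @[N --> \oo] --> (0 : R).
  rewrite (_ : 0 = lindeberg_const k l * (A * 0 + 0 ^+ 2)); last by ring.
  apply: cvgM; first exact: cvg_cst.
  by apply: cvgD; [apply: cvgM => //; exact: cvg_cst|exact: cvgM].
apply/cvgrPdist_le => e e0; near=> N.
have bound_le : `|lindeberg_const k l * (A * b N + b N ^+ 2)| <= e.
  by near: N; move/cvgr0Pnorm_le: bound_cvg0; exact.
have N0 : (0 < N)%N by near: N; exact: nbhs_infty_gt.
have disp_ge : delta <= mean_disp (Ng N) by near: N; exact: cvgr_ge cvg_mean_disp _ delta_lt.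
have b2 : b N ^+ 2 = A / N%:R by rewrite sqr_sqrtr// divr_ge0.
have total_ge : N%:R <= (ntot n (Ng N))%:R :> R by rewrite ler_nat leq_ntot.
have N0R : 0 < N%:R :> R by rewrite ltr0n.
rewrite distrC; apply: le_trans (@laplace_oracle_stat_le _ _ _ (b N) l l0 (sqrtr_ge0 _) _) _.
- exact: lt_le_trans total_ge.
- exact: lt_le_trans disp_ge.
- move=> g; apply: (@le_trans _ _ (b N ^+ 2 * (N%:R * delta))).
        rewrite [leRHS](_ : _ = s * (\sum_g (n g)%:R) ^+ 2); last first.
      by rewrite b2 /A; field; rewrite !gt_eqF.
    rewrite ler_wpM2l// lerXn2r ?nnegrE ?sumr_ge0// (bigD1 g)//= lerDl sumr_ge0//.
  by rewrite ler_wpM2l ?sqr_ge0// ler_pM// ltW.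
apply: le_trans (le_trans (ler_norm _) bound_le).
rewrite Ng_sum (_ : N%:R * b N ^+ 3 = A * b N)//.
by rewrite exprS b2; field; rewrite gt_eqF.
Unshelve. all: by end_near. Qed.

Theorem cvg_cdf_oracle_stat (y : R) :
  prob (law N) (fun d => oracle_stat d <= y) @[N --> \oo] --> chi2_cdf k y.
Proof.
rewrite chi2_cdfE//; apply: laplace_cvg_cdf => [| | |N|N d|l l0].
- exact: chi2_density_ge0.
- exact: integrable_chi2_density.
- exact: Rintegral_chi2_density.
- exact: pmf_data_prob.
- exact: oracle_stat_ge0.
- by rewrite laplace_chi2_density ?ltW//; exact: cvg_laplace_oracle_stat.
Qed.

Lemma cvg_ntot_inv : (total N)^-1 @[N --> \oo] --> (0 : R).
Proof.
apply: (@squeeze_cvgr _ _ _ _ (cst 0) (fun N => N%:R^-1)); last 2 first.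
- exact: cvg_cst.
- exact: cvg_natr_inv.
near=> N.
have N0 : (0 < N)%N by near: N; exact: nbhs_infty_gt.
have total_ge : N%:R <= total N by rewrite ler_nat leq_ntot.
have N0R : 0 < N%:R :> R by rewrite ltr0n.
by rewrite invr_ge0 (le_trans (ltW N0R))//= lef_pV2 ?posrE// (lt_le_trans N0R).
Unshelve. all: by end_near. Qed.

Lemma cvg_phat r : phat R (obs u) r @[u --> whp law] --> p0 r.
Proof.
apply: (cvg_whp_sqr law_pmf) => /=.
have : mean_disp (Ng N) * (p0 r * (1 - p0 r)) * (total N)^-1 @[N --> \oo]
    --> mean_disp_limit * (p0 r * (1 - p0 r)) * 0.
  apply: cvgM; last exact: cvg_ntot_inv.
  by apply: cvgM; [exact: cvg_mean_disp|exact: cvg_cst].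
rewrite mulr0; apply: cvg_trans; apply: near_eq_cvg.
by apply: filterS (near_ntot_gt0 R n_gt0 Ng_sum) => N total_gt0; rewrite expect_dev_sqr.
Qed.

Lemma cvg_group_mean (h : forall g, cvec M (n g) -> R) g :
  (\sum_(l < Ng (tag u) g) h g (obs u g l)) / (Ng (tag u) g)%:R @[u --> whp law]
  --> expect (@q g) (h g).
Proof.
set mu := expect _ _; pose var := expect (@q g) (fun v => (h g v - mu) ^+ 2).
apply: (cvg_whp_sqr law_pmf) => /=.
have : (Ng N g)%:R^-1 * var @[N --> \oo] --> 0 * var.
  by apply: cvgM; [exact: (cvg_Ng_inv Nstar_gt0 Ng_cvg g)|exact: cvg_cst].
rewrite mul0r; apply: cvg_trans; apply: near_eq_cvg.
apply: filterS (near_Ng_gt Nstar_gt0 Ng_cvg 0 g) => N Ng0.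
have Ng_neq0 : (Ng N g)%:R != 0 :> R by rewrite pnatr_eq0 -lt0n.
transitivity ((Ng N g)%:R^-1 ^+ 2 * expect (law N)
    (fun d => (\sum_(l < Ng N g) (h g (d g l) - mu)) ^+ 2)).
  by rewrite (expect_sqr_group_sum (Ng N) q_pmf) -/mu -/var; field.
rewrite -expectZ; apply: eq_bigr => d _; congr (_ * _).
rewrite -exprMn sumrB sumr_const card_ord -[mu *+ _]mulr_natl mulrBr mulKf//.
by rewrite [_^-1 * _]mulrC.
Qed.

Lemma cvg_group_var g r :
  group_var R (obs u) g r @[u --> whp law] --> disp g * (p0 r * (1 - p0 r)) / (n g)%:R.
Proof.
have n_neq0 : (n g)%:R != 0 :> R by rewrite pnatr_eq0 -lt0n.
pose freq g' (v : cvec M (n g')) : R := (v r : nat)%:R / (n g')%:R.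
have freq_mean : expect (@q g) (freq g) = p0 r.
  transitivity ((n g)%:R^-1 * expect (@q g) (fun v => (v r : nat)%:R)).
    by rewrite -expectZ; apply: eq_bigr => v _; rewrite [_^-1 * _]mulrC.
  by rewrite q_mean mulKf.
have freq_sqr : expect (@q g) (fun v => freq g v ^+ 2) =
    disp g * (p0 r * (1 - p0 r)) / (n g)%:R + p0 r ^+ 2.
  transitivity ((n g)%:R^-1 ^+ 2 * expect (@q g) (fun v => (v r : nat)%:R ^+ 2)).
    by rewrite -expectZ; apply: eq_bigr => v _; congr (_ * _); rewrite /freq exprMn mulrC.
  by rewrite (expect_count_sqr (q_pmf g) (@q_mean g) (@q_cov g)); field.
have phat_g_cvg : phat_g R (obs u) g r @[u --> whp law] --> p0 r.
  by under eq_cvg do rewrite phat_gE; rewrite -freq_mean; exact: (cvg_group_mean (h := freq)).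
rewrite -[X in _ --> X](addrK (p0 r ^+ 2)) -freq_sqr.
rewrite /group_var; apply: cvgB; first exact: (cvg_group_mean (h := fun g' v => freq g' v ^+ 2)).
exact: cvgM.
Qed.

Lemma cvg_deff_g (pth : {N & data N} -> 'I_M -> R) g : (forall r, pth ^~ r @ whp law --> p0 r) ->
  deff_g (obs u) (pth u) g @[u --> whp law] --> disp g.
Proof.
move=> pth_cvg.
have : (1 - (Ng (tag u) g)%:R^-1)^-1 * ((n g)%:R / (M%:R - 1) *
    \sum_r (pth u r)^-1 * group_var R (obs u) g r) @[u --> whp law] -->
    (1 - 0)^-1 * ((n g)%:R / (M%:R - 1) *
    \sum_r (p0 r)^-1 * (disp g * (p0 r * (1 - p0 r)) / (n g)%:R)).
  apply: cvgM.
    apply: cvgV; first by rewrite subr0 oner_eq0.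
    apply: cvgB; first exact: cvg_cst.
    apply: (cvg_tag law_pmf (f := fun N => (Ng N g)%:R^-1)).
    exact: (cvg_Ng_inv Nstar_gt0 Ng_cvg g).
  apply: cvgM; first exact: cvg_cst.
  apply: cvg_big => [|r _]; first exact: add_continuous.
  by apply: cvgM; [apply: cvgV => //; rewrite gt_eqF|exact: cvg_group_var].
have M1_neq0 : M%:R - 1 != 0 :> R by rewrite subr_eq0 pnatr_eq1 gtn_eqF.
have n_neq0 : (n g)%:R != 0 :> R by rewrite pnatr_eq0 -lt0n.
have -> : \sum_r (p0 r)^-1 * (disp g * (p0 r * (1 - p0 r)) / (n g)%:R) =
    disp g / (n g)%:R * (M%:R - 1).
  rewrite -(sum_onem_pmodel W M_gt0 th0) mulr_sumr; apply: eq_bigr => r _; field.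
  by rewrite n_neq0 gt_eqF.
rewrite subr0 invr1 mul1r (_ : _ * (_ * _) = disp g); last by field; rewrite M1_neq0 n_neq0.
apply: cvg_trans; apply: near_eq_cvg; near=> u.
have Ng0 : (0 < Ng (tag u) g)%N.
  near: u; apply: (near_tag law_pmf (B := [set N | (0 < Ng N g)%N])).
  exact: near_Ng_gt Nstar_gt0 Ng_cvg _ _.
by rewrite -deff_gE.
Unshelve. all: by end_near. Qed.

Lemma cvg_deff (pth : {N & data N} -> 'I_M -> R) : (forall r, pth ^~ r @ whp law --> p0 r) ->
  deff (obs u) (pth u) @[u --> whp law] --> mean_disp_limit.
Proof.
move=> pth_cvg; apply: cvg_big => [|g _]; first exact: add_continuous.
apply: cvgM; last exact: cvg_deff_g.
by apply: (cvg_tag law_pmf (f := fun N => wgt R n (Ng N) g)); exact: cvg_wgt.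
Qed.

Variables (phi1 phi2 : R -> R) (thetahat : forall N, data N -> 'cV[R]_M0).
Hypothesis phi1_adm : admissible phi1.
Hypothesis phi2_adm : admissible phi2.
Hypothesis thetahat_min : forall N (d : data N),
  (exists th, forall th',
    (dphi phi2 (phat R d) (pmodel W th) <= dphi phi2 (phat R d) (pmodel W th'))%E) ->
  forall th',
    (dphi phi2 (phat R d) (pmodel W (thetahat d)) <= dphi phi2 (phat R d) (pmodel W th'))%E.

Local Notation freq u := (phat R (obs u)).
Local Notation fitted u := (pmodel W (thetahat (obs u))).

Lemma near_freq_gt0 : \forall u \near whp law, forall r, 0 < freq u r.
Proof. exact: (near_forall_gt0 p0_gt0 cvg_phat). Qed.

Lemma near_ntot_tag_gt0 : \forall u \near whp law, 0 < total (tag u).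
Proof. by apply: (near_tag law_pmf (B := [set N | 0 < total N])); exact: near_ntot_gt0. Qed.

Lemma near_freq_sum1 : \forall u \near whp law, \sum_r freq u r = 1.
Proof.
apply: filterS2 near_ntot_tag_gt0 (near_pmf_neq0 law_pmf) => u total_gt0.
exact: phat_sum1 total_gt0 _.
Qed.

Lemma near_thetahat_min : \forall u \near whp law, forall th',
  phi_div phi2 (freq u) (fitted u) <= phi_div phi2 (freq u) (pmodel W th').
Proof.
near=> u.
have freq_gt0 : forall r, 0 < freq u r by near: u; exact: near_freq_gt0.
have dphi_real th : dphi phi2 (freq u) (pmodel W th) = (phi_div phi2 (freq u) (pmodel W th))%:E.
  by rewrite dphiE// => r; exact: pmodel_gt0.
have [th th_min] : exists th, forall th',
    phi_div phi2 (freq u) (pmodel W th) <= phi_div phi2 (freq u) (pmodel W th').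
  near: u.
  exact: (near_minimizer_exists (p := fun u => freq u) M_gt0 design_rank phi2_adm cvg_phat).
move=> th'; rewrite -lee_fin -!dphi_real; apply: thetahat_min.
by exists th => th''; rewrite !dphi_real lee_fin.
Unshelve. all: by end_near. Qed.

Definition studentized N (d : data N) : R :=
  total N * (2 / derive1n 2 phi1 1 * phi_div phi1 (phat R d) (pmodel W (thetahat d))) /
  deff d (pmodel W (thetahat d)).

Lemma near_studentizedE : \forall u \near whp law,
  (Tstat W phi1 (obs u) (thetahat (obs u)) * ((deff (obs u) (fitted u))^-1)%:E)%E =
  (studentized (obs u))%:E.
Proof.
near=> u; have freq_gt0 : forall r, 0 < freq u r by near: u; exact: near_freq_gt0.
rewrite /Tstat dphiE//; last by move=> r; exact: pmodel_gt0.
by rewrite -!EFinM; congr _%:E; rewrite /studentized; ring.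
Unshelve. all: by end_near. Qed.

Let fitted_cvg_p0 r : fitted u r @[u --> whp law] --> p0 r.
Proof.
exact: (fitted_cvg (p := fun u => freq u) (th := fun u => thetahat (obs u))
  M_gt0 cvg_phat phi2_adm near_thetahat_min).
Qed.

Lemma cvg_deff_inv : (deff (obs u) (fitted u))^-1 @[u --> whp law] --> mean_disp_limit^-1.
Proof.
apply: cvgV; first by rewrite gt_eqF ?mean_disp_limit_gt0.
exact: cvg_deff.
Qed.

Lemma cvg_deff_inv_mean_disp :
  (deff (obs u) (fitted u))^-1 - (mean_disp (Ng (tag u)))^-1 @[u --> whp law] --> (0 : R).
Proof.
rewrite -(subrr mean_disp_limit^-1); apply: cvgB; first exact: cvg_deff_inv.
apply: (cvg_tag law_pmf (f := fun N => (mean_disp (Ng N))^-1)).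
by apply: cvgV cvg_mean_disp; rewrite gt_eqF ?mean_disp_limit_gt0.
Qed.

Lemma near_expect_ntot_pearson_le : \forall N \near \oo,
  expect (law N) (fun d => total N * pearson p0 (phat R d \- p0)) <=
  (mean_disp_limit + 1) * (M%:R - 1).
Proof.
near=> N.
have total_gt0 : 0 < total N by near: N; exact: near_ntot_gt0.
have disp_le : mean_disp (Ng N) <= mean_disp_limit + 1.
  by near: N; apply: cvgr_le cvg_mean_disp _ _; rewrite ltrDl.
rewrite (expect_ntot_pearson_dev total_gt0) ler_wpM2r//.
by rewrite subr_ge0 ler1n.
Unshelve. all: by end_near. Qed.

Lemma cvg_studentized :
  studentized (obs u) - oracle_stat (obs u) @[u --> whp law] --> (0 : R).
Proof.
apply: (cvg0_of_le_tight law_pmf (Y := fun u => total (tag u) * pearson p0 (freq u \- p0))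
  _ near_expect_ntot_pearson_le) => [u|e e0].
  by rewrite mulr_ge0 ?pearson_ge0.
have lim0 : 0 < mean_disp_limit^-1 by rewrite invr_gt0 mean_disp_limit_gt0.
pose K := mean_disp_limit^-1 + 2; have K0 : 0 < K by rewrite addr_gt0.
pose eta := e / K; have eta0 : 0 < eta by rewrite divr_gt0.
near=> u.
have expansion : `|2 / derive1n 2 phi1 1 * phi_div phi1 (freq u) (fitted u) -
    lsq_residual W th0 (freq u \- p0)| <= eta * pearson p0 (freq u \- p0).
  near: u; exact: (near_phi_div_residual (p := fun u => freq u) (th := fun u => thetahat (obs u))
    M_gt0 design_rank cvg_phat phi2_adm near_thetahat_min near_freq_sum1 phi1_adm eta0).
have inv_close : `|(deff (obs u) (fitted u))^-1 - (mean_disp (Ng (tag u)))^-1| <= eta.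
  by near: u; move/cvgr0Pnorm_le: cvg_deff_inv_mean_disp; exact.
have inv_le : `|(deff (obs u) (fitted u))^-1| <= mean_disp_limit^-1 + 1.
  near: u; apply: cvgr_norm_le cvg_deff_inv _ _; rewrite gtr0_norm// ltrDl//.
set S := total _; set D := pearson _ _ in expansion *.
rewrite (_ : _ - _ = S * ((2 / derive1n 2 phi1 1 * phi_div phi1 (freq u) (fitted u) -
    lsq_residual W th0 (freq u \- p0)) * (deff (obs u) (fitted u))^-1 +
    lsq_residual W th0 (freq u \- p0) *
    ((deff (obs u) (fitted u))^-1 - (mean_disp (Ng (tag u)))^-1))); last first.
  by rewrite /studentized /oracle_stat -/S; ring.
have D0 : 0 <= D by exact: pearson_ge0.
rewrite normrM ger0_norm// mulrCA ler_wpM2l//.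
rewrite (_ : e * D = eta * D * (mean_disp_limit^-1 + 1) + D * eta).
  apply: le_trans (ler_normD _ _) _; rewrite !normrM; apply: lerD; apply: ler_pM => //.
  by rewrite ger0_norm ?lsq_residual_ge0//; exact: lsq_residual_le_pearson.
have -> : mean_disp_limit^-1 + 1 = K - 1 by rewrite /K; ring.
by rewrite /eta; field; rewrite gt_eqF.
Unshelve. all: by end_near. Qed.

Lemma near_Tstat_close (e : R) : 0 < e -> \forall u \near whp law,
  ((oracle_stat (obs u) - e)%:E <=
   Tstat W phi1 (obs u) (thetahat (obs u)) * ((deff (obs u) (fitted u))^-1)%:E <=
   (oracle_stat (obs u) + e)%:E)%E.
Proof.
move=> e0; near=> u.
have -> : (Tstat W phi1 (obs u) (thetahat (obs u)) * ((deff (obs u) (fitted u))^-1)%:E)%E =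
    (studentized (obs u))%:E by near: u; exact: near_studentizedE.
have : `|studentized (obs u) - oracle_stat (obs u)| <= e.
  by near: u; move/cvgr0Pnorm_le: cvg_studentized; exact.
by rewrite !lee_fin -ler_distl.
Unshelve. all: by end_near. Qed.

End UnequalClusterSizes.

Theorem theorem7 (R : realType) (M M0 G : nat) (W : 'M[R]_(M, M0))
  (th0 : 'cV[R]_M0) (rho2 : R) (n : 'I_G -> nat)
  (Ng : nat -> 'I_G -> nat) (Nstar : 'I_G -> R)
  (q : forall g : 'I_G, cvec M (n g) -> R)
  (phi1 phi2 : R -> R)
  (thetahat : forall N : nat, dataset M n (Ng N) -> 'cV[R]_M0) :
  (3 <= M)%N -> (1 <= M0)%N -> (M0 < M - 1)%N ->
  \rank W = M0 ->
  \rank (row_mx W (const_mx 1 : 'cV[R]_M)) = M0.+1 ->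
  (forall g, 2 <= n g)%N -> injective n ->
  (forall N : nat, \sum_(g < G) Ng N g = N)%N ->
  (forall g, 0 < Nstar g <= 1) ->
  (forall g, (fun N : nat => (Ng N g)%:R / N%:R) @ \oo --> Nstar g) ->
  0 <= rho2 ->
  (* law of a cluster vector of group g: pmf q g, supported on vectors
     with nonnegative integer entries summing to n_g *)
  (forall g v, 0 <= q g v) ->
  (forall g, \sum_(v : cvec M (n g)) q g v = 1) ->
  (forall g v, q g v != 0 -> (\sum_(r < M) (v r : nat))%N = n g) ->
  (* E[Y^(g,l)] = n_g p(theta0) *)
  (forall g (r : 'I_M),
     \sum_(v : cvec M (n g)) q g v * (v r : nat)%:R
     = (n g)%:R * pmodel W th0 r) ->
  (* Var[Y^(g,l)] = (1 + (n_g - 1) rho^2) n_g Sigma_{p(theta0)} *)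
  (forall g (r s : 'I_M),
     \sum_(v : cvec M (n g)) q g v *
        (((v r : nat)%:R - (n g)%:R * pmodel W th0 r) *
         ((v s : nat)%:R - (n g)%:R * pmodel W th0 s))
     = (1 + ((n g)%:R - 1) * rho2) * (n g)%:R *
       ((r == s)%:R * pmodel W th0 r - pmodel W th0 r * pmodel W th0 s)) ->
  admissible phi1 -> admissible phi2 ->
  (* hat theta_{phi2} is a minimizer of d_{phi2}(hat p, p(theta))
     whenever a minimizer exists *)
  (forall (N : nat) (d : dataset M n (Ng N)),
     (exists th : 'cV[R]_M0, forall th' : 'cV[R]_M0,
        (dphi phi2 (phat R d) (pmodel W th) <= dphi phi2 (phat R d) (pmodel W th'))%E) ->
     forall th' : 'cV[R]_M0,
       (dphi phi2 (phat R d) (pmodel W (thetahat N d))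
          <= dphi phi2 (phat R d) (pmodel W th'))%E) ->
  (* convergence in law (of the distribution functions, at every point) of
     T^{phi1}(Y, hat theta_{phi2}) / tilde vartheta_{hat n*, N, phi2}
     to chi^2_{M - M0 - 1} *)
  forall x : R,
    (fun N : nat =>
       \sum_(d : dataset M n (Ng N))
          data_prob d q *
          ((Tstat W phi1 d (thetahat N d) *
            ((deff d (pmodel W (thetahat N d)))^-1)%:E <= x%:E)%E)%:R)
    @ \oo --> chi2_cdf (M - M0 - 1) x.
Proof.
move=> M3 _ M0_lt _ design_rank n_ge2 _ Ng_sum Nstar_itv Ng_cvg rho2_ge0 q_ge0 q_sum1 q_supp
  q_mean q_cov phi1_adm phi2_adm thetahat_min x.
pose disp g := 1 + ((n g)%:R - 1) * rho2.
have n_gt0 g : (0 < n g)%N by exact: ltnW.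
have disp_gt0 g : 0 < disp g by rewrite ltr_pwDl// mulr_ge0// subr_ge0 ler1n.
have Nstar_gt0 g : 0 < Nstar g by have /andP[] := Nstar_itv g.
have q_pmf g : is_pmf (@q g) by [].
have chi2_limit := cvg_cdf_oracle_stat M0_lt design_rank q_pmf q_mean q_cov n_gt0 disp_gt0
  Ng_sum Nstar_gt0 Ng_cvg.
have close := near_Tstat_close M0_lt design_rank q_pmf q_supp q_mean q_cov n_gt0 disp_gt0
  Ng_sum Nstar_gt0 Ng_cvg phi1_adm phi2_adm thetahat_min.
apply: (slutsky_cdf (fun N => pmf_data_prob (Ng N) q_pmf) _ chi2_limit close).
by apply: continuous_chi2_cdf; rewrite -subnDA subnDAC subn_gt0.
Qed.
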